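(* There exists $\varepsilon_0>0$ such that, given $0<\xi<1$ (with $\zeta,\beta,\gamma,\tau$ fixed for this $\xi$ as in the context), there exist a finite scale $\widetilde{L}=\widetilde{L}(\varepsilon_0,\xi)$ and $m_\xi=m(\xi,\widetilde{L})>0$ such that for all $0<\varepsilon\leq\varepsilon_0$, $$\inf_{x\in\mathbb{R}^d}\mathbb{P}\{\Lambda_L(x)\text{ is }m_\xi\text{-localizing for }H_{\varepsilon,\omega}\}\geq1-\mathrm{e}^{-L^\xi}\quad\text{for all }L\geq\widetilde{L}.$$
   Context: Anderson model: $H_{\varepsilon,\omega}=-\varepsilon\Delta+V_\omega$ on $\ell^2(\mathbb{Z}^d)$, $\varepsilon>0$, where $(\Delta\varphi)(x)=\sum_{y\in\mathbb{Z}^d,|y-x|=1}\varphi(y)$ and $V_\omega(x)=\omega_x$, with $\{\omega_x\}$ i.i.d. with non-degenerate distribution $\mu$ of bounded support, Hölder continuous of order $\alpha\in(\tfrac12,1]$: $\sup_{a}\mu([a,a+t])\leq Kt^\alpha$ for $t\in[0,1]$. Parameters: fix $\theta>\left(\tfrac{6}{2\alpha-1}+\tfrac{9}{2}\right)d$ and $q,p,\gamma_1$ with $\tfrac{3d}{2\alpha-1}<q<\tfrac12(\theta-\tfrac92 d)$, $0<p<(2\alpha-1)q-3d$, $1<\gamma_1<\min\{1+\tfrac{p}{p+2d},\tfrac{2\theta-4d}{5d+4q}\}$. Given $\xi\in(0,1)$, fix $\zeta,\beta,\gamma,\tau$ with $0<\xi<\zeta<\beta<\tfrac1\gamma<1<\gamma<\sqrt{\zeta/\xi}$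 and $\max\{\tfrac{1+\gamma_1}{2\gamma_1},\tfrac{1+\gamma\beta}{2},\tfrac{(\gamma-1)\beta+1}{\gamma}\}<\tau<1$. Notation: $\|x\|=\max_j|x_j|$; $\Lambda_L(x)=\{y\in\mathbb{Z}^d:\|y-x\|\leq L/2\}$ for $x\in\mathbb{R}^d$; $H_\Theta=\chi_\Theta H\chi_\Theta$ on $\ell^2(\Theta)$; $L_\tau=\lfloor L^\tau\rfloor$. For $x\in\Lambda_L$ and normalized $\varphi\in\ell^2(\Lambda_L)$, $\varphi$ is $(x,m)$-localized if $|\varphi(y)|\leq\mathrm{e}^{-m\|y-x\|}$ for all $y\in\Lambda_L$ with $\|y-x\|\geq L_\tau$. $\Lambda_L$ is $m$-localizing for $H$ if all eigenvalues of $H_{\Lambda_L}$ are simple with $|\lambda-\lambda'|\geq\mathrm{e}^{-L^\beta}$ for distinct eigenvalues, and there is an orthonormal basis of eigenfunctions $\{\varphi_x\}_{x\in\Lambda_L}$ of $H_{\Lambda_L}$ (with eigenvalues $\lambda_x$) such that each $\varphi_x$ is $(x,m)$-localized. *)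

(* Defs.v *)
From HB Require Import structures.
From mathcomp Require Import all_boot all_order all_algebra.
From mathcomp Require Import all_classical all_reals all_analysis.
From mathcomp Require Import complex.
Set Implicit Arguments. Unset Strict Implicit. Unset Printing Implicit Defensive.
Import Order.TTheory GRing.Theory Num.Theory.
Import numFieldNormedType.Exports.
Local Open Scope classical_set_scope.
Local Open Scope ring_scope.
Local Open Scope complex_scope.

(* Lattice sites Z^d and points of R^d, as row vectors. *)
Definition site (d : nat) := 'rV[int]_d.
Definition point (R : realType) (d : nat) := 'rV[R]_d.

Section Anderson.
Variables (R : realType) (d : nat).

(* embedding Z^d -> R^d *)
Definition emb (y : site d) : point R d := map_mx (fun k : int => k%:~R) y.

(* sup norm ||v|| = max_j |v_j| *)
Definition supn (v : point R d) : R := \big[Num.max/0]_(j < d) `|v 0 j|.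

(* |y - x| = 1 (Euclidean norm) for lattice points *)
Definition adj (y z : site d) : bool := (\sum_(j < d) (y 0 j - z 0 j) ^+ 2 == 1)%R.

(* box Lambda_L(x) = {y in Z^d : ||y - x|| <= L/2} *)
Definition box (L : R) (x : point R d) : set (site d) :=
  [set y | supn (emb y - x) <= L / 2].

(* matrix entries of H_{eps,omega} = - eps Delta + V_omega *)
Definition Hker (eps : R) (V : site d -> R) (y z : site d) : R :=
  - eps * (adj y z)%:R + (y == z)%:R * V y.

(* H_Theta phi = chi_Theta H chi_Theta phi, evaluated at y in Theta *)
Definition Hrestr (Th : set (site d)) (eps : R) (V : site d -> R)
  (phi : site d -> R[i]) (y : site d) : R[i] :=
  (\sum_(z \in Th) (Hker eps V y z)%:C * phi z)%R.

(* inner product on l^2(Theta) *)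
Definition inner (Th : set (site d)) (phi psi : site d -> R[i]) : R[i] :=
  (\sum_(y \in Th) phi y * (psi y)^*)%R.

Definition is_eigvec (Th : set (site d)) eps V (lam : R[i]) (phi : site d -> R[i]) :=
  (exists2 y, Th y & phi y != 0) /\
  (forall y, Th y -> Hrestr Th eps V phi y = lam * phi y).

Definition is_eigval Th eps V (lam : R[i]) := exists phi, is_eigvec Th eps V lam phi.

(* simple: eigenspace is one-dimensional *)
Definition simple_eigval Th eps V (lam : R[i]) :=
  forall phi psi, is_eigvec Th eps V lam phi -> is_eigvec Th eps V lam psi ->
    exists c : R[i], forall y, Th y -> psi y = c * phi y.

(* L_tau = floor(L^tau) *)
Definition Ltau (L tau : R) : R := (Num.floor (L `^ tau))%:~R.

(* phi normalized and (x,m)-localized in Lambda_L(x0) *)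
Definition localized (L tau : R) (x0 : point R d) (x : site d) (m : R)
  (phi : site d -> R[i]) :=
  inner (box L x0) phi phi = 1 /\
  forall y, box L x0 y -> supn (emb y - emb x) >= Ltau L tau ->
    `|phi y| <= (expR (- m * supn (emb y - emb x)))%:C.

(* Lambda_L(x0) is m-localizing for H_{eps,omega} (V = omega) *)
Definition m_localizing (L beta tau m eps : R) (V : site d -> R) (x0 : point R d) :=
  let Th := box L x0 in
  (forall lam, is_eigval Th eps V lam -> simple_eigval Th eps V lam) /\
  (forall lam lam', is_eigval Th eps V lam -> is_eigval Th eps V lam' -> lam != lam' ->
     `|lam - lam'| >= (expR (- L `^ beta))%:C) /\
  (exists (Phi : site d -> site d -> R[i]) (lams : site d -> R[i]),
     (forall x x', Th x -> Th x' -> inner Th (Phi x) (Phi x') = (x == x')%:R) /\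
     (forall x, Th x -> forall y, Th y -> Hrestr Th eps V (Phi x) y = lams x * Phi x y) /\
     (forall x, Th x -> localized L tau x0 x m (Phi x))).

End Anderson.

(* {omega_y}_{y in Z^d} are i.i.d. random variables with law mu *)
Definition iid_with_law (R : realType) (d : nat) (dT : measure_display)
  (T : measurableType dT) (P : probability T R) (omega : site d -> T -> R)
  (mu : probability R R) :=
  (forall y, measurable_fun setT (omega y)) /\
  (forall y (B : set R), measurable B -> P (omega y @^-1` B) = mu B) /\
  (forall (s : seq (site d)) (B : site d -> set R), uniq s ->
     (forall y, measurable (B y)) ->
     P (\bigcap_(y in [set` s]) (omega y @^-1` B y)) =
     (\prod_(y <- s) P (omega y @^-1` B y))%E).

(* Main.v *)
(** At large disorder no multiscale analysis is needed: everything holds at the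
    single scale [L], with [m = 1].

    - Fractional moments.  Removing the site [x] gives
      [G_S(x,y) = eps G_S(x,x) \sum_(u ~ x) G_(S\x)(u,y)] and
      [G_S(x,x) = 1 / (v_x - b)], where [b] and [G_(S\x)] do not depend on [v_x].
      Averaging over [v_x] first, Hoelder continuity of order [alpha > 1/2] bounds
      the moments of order 1/2, and induction on [S] gives
      [E |G_S(x,y)|^(1/2) <= C e^(-2 |x-y|)] once [eps] is small.
    - Level spacing.  If two eigenvalues lie within [delta] of [E], the resolvent at
      [E + i delta] of the full box is large at some diagonal entry [x], and so is
      that of the box without [x]: two independent small events of probability
      [O(delta^alpha)] each.  Since [2 alpha > 1], a net of energies of mesh
      [e^(-L^beta)] can be summed over.
    - Eigenfunctions.  When the gaps exceed [g = e^(-L^beta)], the cutoff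
      [1 / (1 + ((H - E) / r)^(2^k))], with [r = g / 4] and [E] in the net, isolates
      one eigenprojection up to [2^(-2^k)] and is an average of [2^k] resolvents at
      nonreal energies; a union bound is affordable because [beta < tau].
    - Centers.  Deleting the small entries of the unitary matrix of eigenvectors
      keeps it invertible, so a nonzero term of its Leibniz expansion assigns to
      every eigenvector its own center, where it is not small.

    Measurability of the event: it is the zero set in [w] of the minimum over a
    compact set of matrices [U] of a continuous defect, which can be tested on
    rational [U]. *)
Require Import Defs.
From HB Require Import structures.
From mathcomp Require Import all_boot all_order all_algebra.
From mathcomp Require Import all_classical all_reals all_analysis.
From mathcomp Require Import complex.
From mathcomp Require Import measurable_realfun perm zify ring lra.
Set Implicit Arguments.
Unset Strict Implicit.
Unset Printing Implicit Defensive.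
Import Order.TTheory GRing.Theory Num.Theory.
Import numFieldNormedType.Exports.
Local Open Scope ring_scope.
Local Open Scope complex_scope.

(** The order 1/2 meets two demands: [|t - b|^(-1/2)] has to be integrable against a law that is
    only Hoelder continuous of some order above 1/2, and the square root is subadditive, so it
    passes through the sum over neighbours. The moment bound does not deteriorate as the energy
    approaches the real axis, which is what permits resolvents at distance [e^(-L^beta)] or less
    from it.

    Level spacing is the delicate point, since the law need not have a density. Removing [x] makes
    two resonances usable together: the one in the depleted box does not involve [v_x], and,
    conditionally on all other sites, the one at [x] still has small probability.

    On the rates: moments decay at rate 2. Markov's inequality with the threshold [e^(-2 |x-y|)] for
    the resolvent leaves the probability [e^(-|x-y|)], and the distance from rate 2 to the final
    rate 1 absorbs every power of the volume. All bounds may therefore be crude in the volume. *)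

Section Unitary.

(** * Unitary matrices and the spectral resolution of a Hermitian matrix *)

Variables (C : numClosedFieldType) (n : nat).
Implicit Types (P H : 'M[C]_n) (dg : 'rV[C]_n).
Local Open Scope sesquilinear_scope.

Lemma unitary_rows P : P \is unitarymx ->
  forall i k, \sum_j P i j * (P k j)^* = (i == k)%:R.
Proof.
move/unitarymxP/matrixP => h i k; have := h i k; rewrite !mxE => <-.
by apply: eq_bigr => j _; rewrite !mxE.
Qed.

Lemma unitary_entry_le1 P : P \is unitarymx -> forall i j, `|P i j| <= 1.
Proof.
move=> hP i j; have := unitary_rows hP i i; rewrite eqxx mulr1n (bigD1 j) //= => h.
rewrite -(@expr_le1 _ 2) // normCK -h lerDl.
by apply: sumr_ge0 => k _; rewrite -normCK exprn_ge0.
Qed.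

(** The fourth clause fixes the convention: eigenvectors are the rows of [P], so [P i x] is the
    value of the [i]-th one at site [x]. *)
Lemma hermitian_spectralP H : H \is hermsymmx ->
  exists P dg, [/\ P \is unitarymx, (forall i, dg 0 i \is Num.real),
    H = P^t* *m diag_mx dg *m P & P *m H = diag_mx dg *m P].
Proof.
move=> hH; exists (spectralmx H), (spectral_diag H).
have hU := spectral_unitarymx H.
have e : H = invmx (spectralmx H) *m diag_mx (spectral_diag H) *m spectralmx H.
  exact/orthomx_spectralP/hermitian_normalmx.
split=> //.
- by move=> i; have /mxOverP := hermitian_spectral_diag_real hH; apply.
- by rewrite {1}e invmx_unitary.
- by rewrite {2}e !mulmxA mulmxV ?mul1mx // spectral_unit.
Qed.

Lemma diag_resolvent P dg z : P \is unitarymx -> (forall i, dg 0 i != z) ->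
  (P^t* *m diag_mx dg *m P - z%:M) *m
    (P^t* *m diag_mx (\row_i (dg 0 i - z)^-1) *m P) = 1%:M.
Proof.
move=> hP hz.
have hPP : P *m P^t* = 1%:M by apply/unitarymxP.
have hV : P^t* *m P = 1%:M by rewrite -invmx_unitary // mulVmx // unitarymx_unit.
have -> : P^t* *m diag_mx dg *m P - z%:M = P^t* *m (diag_mx dg - z%:M) *m P.
  by rewrite mulmxBr mulmxBl -scalemx1 -scalemxAr mulmx1 -scalemxAl hV.
rewrite !mulmxA -[X in X *m _ *m _]mulmxA hPP mulmx1 -[X in X *m P]mulmxA.
suff -> : (diag_mx dg - z%:M) *m diag_mx (\row_i (dg 0 i - z)^-1) = 1%:M.
  by rewrite mulmx1.
apply/matrixP => i j; rewrite mul_mx_diag !mxE.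
case: eqP => [->|_]; last by rewrite !mulr0n subr0 mul0r.
by rewrite !mulr1n divff // subr_eq0.
Qed.

Lemma hermitian_resolvent_unit H z : H \is hermsymmx -> z \isn't Num.real ->
  H - z%:M \in unitmx.
Proof.
move=> /hermitian_spectralP[P [dg [hP hr -> _]]] hz.
have hne i : dg 0 i != z by apply: contraNneq hz => <-.
by have /mulmx1_unit[] := diag_resolvent hP hne.
Qed.

Lemma resolvent_entry H P dg z : H = P^t* *m diag_mx dg *m P ->
  P \is unitarymx -> (forall i, dg 0 i != z) -> forall x y,
  invmx (H - z%:M) x y = \sum_i (P i x)^* * P i y * (dg 0 i - z)^-1.
Proof.
move=> -> hP hz x y; have h := diag_resolvent hP hz.
have [hu _] := mulmx1_unit h.
have -> : invmx (P^t* *m diag_mx dg *m P - z%:M) =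
   P^t* *m diag_mx (\row_i (dg 0 i - z)^-1) *m P.
  by rewrite -[LHS]mulmx1 -h mulKmx.
rewrite mxE; apply: eq_bigr => i _; rewrite mul_mx_diag !mxE; ring.
Qed.

(* Deleting the entries of a unitary matrix below the threshold leaves an
   invertible matrix; its Leibniz expansion has a nonzero term. *)
Lemma unitary_perm_large P : (0 < n)%N -> P \is unitarymx ->
  exists s : 'S_n, forall i, (2 * n%:R ^+ 2)^-1 <= `|P i (s i)|.
Proof.
move=> n0 hP; set eta : C := (2 * n%:R ^+ 2)^-1.
have nr0 : 0 < n%:R :> C by rewrite ltr0n.
have eta0 : 0 < eta by rewrite invr_gt0 mulr_gt0 // exprn_gt0.
pose B := \matrix_(i, j) if eta <= `|P i j| then P i j else 0.
have hB i j : `|(P - B) i j| <= eta.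
  rewrite !mxE; case: ifPn => [_|]; first by rewrite subrr normr0 ltW.
  by rewrite -real_ltNge ?ger0_real ?normr_ge0 ?(ltW eta0) // subr0 => /ltW.
suff : \det B != 0.
  rewrite /determinant => /eqP hd.
  have [s hs|hs] := pickP (fun s : 'S_n => [forall i, B i (s i) != 0]).
    exists s => i; have /forallP/(_ i) := hs; rewrite !mxE.
    by case: ifPn => //; rewrite eqxx.
  case: hd; rewrite big1 // => s _.
  have /negbT := hs s; rewrite negb_forall => /existsP[k]; rewrite negbK => /eqP hk.
  by rewrite (bigD1 k) //= hk mul0r mulr0.
rewrite -unitfE -[_ \is a _]/(B \in unitmx) -row_free_unit -kermx_eq0.
apply/eqP/row_matrixP => i0; rewrite row0; set w := row i0 _.
have hw : w *m B = 0.
  by apply/sub_kermxP; rewrite row_sub.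
(* A row vector [w] killed by [B] is reproduced by [P - B] followed by the adjoint of [P]. The
   entries of [P - B] are at most [eta] and those of the adjoint at most 1, so two sums over [n]
   indices give [n ^ 2 * eta = 1/2]: the largest entry of [w] is at most half of itself. *)
have hwP : w = w *m (P - B) *m P^t*.
  rewrite mulmxBr hw subr0 -mulmxA (_ : P *m P^t* = 1%:M) ?mulmx1 //.
  exact/unitarymxP.
clearbody w.
have [i1 hmax] : exists i1, forall i, `|w 0 i| <= `|w 0 i1|.
  case: n n0 w {hw hwP} => // m _ w.
  have [i1 _ hi1] := @real_arg_maxP _ _ ord0 xpredT (fun i => `|w 0 i|)
    isT (fun i _ => normr_real _).
  by exists i1 => // i; apply: hi1.
suff h0 : `|w 0 i1| = 0.
  apply/rowP => i; rewrite mxE; apply/normr0_eq0/eqP.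
  by rewrite eq_le normr_ge0 -h0 hmax.
have : `|w 0 i1| <= 2^-1 * `|w 0 i1|.
  rewrite {1}hwP mxE; apply: le_trans (ler_norm_sum _ _ _) _.
  apply: le_trans (_ : \sum_(j < n) (n%:R * (`|w 0 i1| * eta)) <= _).
    apply: ler_sum => j _; rewrite normrM -[leRHS]mulr1.
    apply: ler_pM; rewrite ?normr_ge0 //; last first.
      by rewrite !mxE norm_conjC unitary_entry_le1.
    rewrite mxE; apply: le_trans (ler_norm_sum _ _ _) _.
    apply: le_trans (_ : \sum_(j < n) (`|w 0 i1| * eta) <= _).
      by apply: ler_sum => k _; rewrite normrM ler_pM ?normr_ge0 // hmax.
    by rewrite sumr_const card_ord mulr_natl.
  rewrite sumr_const card_ord -[_ *+ n]mulr_natl /eta invfM.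
  have nn0 : n%:R != 0 :> C by rewrite gt_eqF.
  rewrite le_eqVlt; apply/orP; left; apply/eqP; field.
  by rewrite nn0.
have := normr_ge0 (w 0 i1); set a := `|w 0 i1| => ha hle.
apply/eqP; rewrite eq_le ha andbT.
have : a - 2^-1 * a <= 0 by rewrite subr_le0.
have -> : a - 2^-1 * a = 2^-1 * a by field.
by rewrite pmulr_rle0 // invr_gt0.
Qed.

End Unitary.

(** * The Hamiltonian of a set of sites and the effect of removing one site *)

Section Hamiltonian.
Variables (R : rcfType) (n : nat) (A : rel 'I_n) (eps : R).
Hypotheses (A_sym : symmetric A) (A_irr : irreflexive A).
Implicit Types (v : 'I_n -> R) (S : {set 'I_n}) (z : R[i]).

(* All sites are kept: those outside [S] are decoupled and carry the entry 0,
   so that the dimension does not change when a site is removed. *)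
Definition ham S v : 'M[R[i]]_n :=
  \matrix_(i, j) if (i \in S) && (j \in S)
    then (- eps * (A i j)%:R + (i == j)%:R * v i)%:C else 0.

Definition green S v z : 'M[R[i]]_n := invmx (ham S v - z%:M).

Lemma ham_conj S v i j : (ham S v i j)^* = ham S v i j.
Proof. by rewrite !mxE; case: ifP => _; rewrite ?conjc_real ?conjc0. Qed.

Lemma ham_tr S v : (ham S v)^T = ham S v.
Proof.
apply/matrixP => i j; rewrite !mxE andbC; case: ifP => // _.
by rewrite A_sym eq_sym; case: eqP => [->//|_]; rewrite !mul0r.
Qed.

Lemma ham_herm S v : ham S v \is hermsymmx.
Proof.
apply/is_hermitianmxP; rewrite expr0 scale1r ham_tr.
by apply/matrixP => i j; rewrite [RHS]mxE; apply/esym/ham_conj.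
Qed.

Lemma ham_eq S v w : (forall i, i \in S -> v i = w i) -> ham S v = ham S w.
Proof.
move=> h; apply/matrixP => i j; rewrite !mxE.
by case: ifP => // /andP[iS _]; rewrite h.
Qed.

Lemma green_eq S v w z : (forall i, i \in S -> v i = w i) ->
  green S v z = green S w z.
Proof. by move=> h; rewrite /green (ham_eq h). Qed.

Lemma ImN0_nreal z : complex.Im z != 0 -> z \isn't Num.real.
Proof. by case: z => a b /= hb; rewrite complex_real. Qed.

Section Nonreal.
Variables (v : 'I_n -> R) (z : R[i]).
Hypothesis hz : complex.Im z != 0.

Lemma green_unit S : ham S v - z%:M \in unitmx.
Proof. by apply: hermitian_resolvent_unit; rewrite ?ham_herm ?ImN0_nreal. Qed.

Lemma z_neq0 : z != 0.
Proof. by apply: contraNneq hz => ->. Qed.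

Lemma mul_green S : (ham S v - z%:M) *m green S v z = 1%:M.
Proof. by rewrite mulmxV // green_unit. Qed.

Lemma green_mul S : green S v z *m (ham S v - z%:M) = 1%:M.
Proof. by rewrite mulVmx // green_unit. Qed.

Lemma green_tr S : (green S v z)^T = green S v z.
Proof. by rewrite /green trmx_inv linearB /= ham_tr tr_scalar_mx. Qed.

Lemma green_sym S x y : green S v z x y = green S v z y x.
Proof. by rewrite -{1}green_tr mxE. Qed.

Lemma green_out S x y : x \notin S -> y != x -> green S v z x y = 0.
Proof.
move=> xS yx; have /matrixP/(_ x y) := mul_green S.
rewrite mxE (bigD1 x) //= big1 => [|k kx]; last first.
  by rewrite !mxE (negbTE xS) /= eq_sym (negbTE kx) subrr mul0r.
rewrite !mxE (negbTE xS) /= eqxx addr0 sub0r [x == y]eq_sym (negbTE yx) mulNr.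
by move/eqP; rewrite oppr_eq0 mulf_eq0 (negbTE z_neq0) /= => /eqP.
Qed.

(** Resolvent identity [G (H' - H) G' = G - G'] between [S] and [S :\ x]. The difference [H' - H]
    lives on the row and column of [x], and [G'] decouples [x] from the rest, so [G' x y] vanishes
    and only the hops from [x] to a remaining neighbour survive. *)
Lemma green_step S x y : x \in S -> y != x ->
  green S v z x y = eps%:C * green S v z x x *
    \sum_(u in S :\ x | A x u) green (S :\ x) v z u y.
Proof.
move=> xS yx; set S' := S :\ x; set G := green S v z; set G' := green S' v z.
have -> : G x y = (G *m (ham S' v - ham S v) *m G') x y.
  have -> : ham S' v - ham S v = (ham S' v - z%:M) - (ham S v - z%:M).
    by rewrite opprB addrA subrK.
  rewrite mulmxBr mulmxBl -mulmxA mul_green mulmx1 green_mul mul1mx mxE.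
  by rewrite [X in _ = _ + X]mxE (green_out (S := S')) ?subr0 // /S' setD11.
rewrite mxE mulr_sumr [RHS]big_mkcond /=; apply: eq_bigr => b _.
have [->|bx] := eqVneq b x.
  by rewrite (green_out (S := S')) ?mulr0 // /S' setD11.
rewrite mxE (bigD1 x) //= big1 => [|a ax]; last first.
  by rewrite !mxE !inE ax bx /= subrr mulr0.
rewrite addr0 !mxE !inE eqxx /= ?bx /= xS /= sub0r.
rewrite eq_sym (negbTE bx) mul0r addr0.
case: (b \in S) => /=; last by rewrite oppr0 mulr0 mul0r.
case: (A x b); rewrite /= ?mulr1 ?mulr0 ?rmorph0 ?oppr0 ?mulr0 ?mul0r //.
by rewrite rmorphN opprK; ring.
Qed.

(** Schur complement at [x]: the energy [z] plus the self-energy of the excursions through the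
    neighbours. It involves the potential on [S :\ x] only, which is what allows averaging over
    [v x] alone. *)
Definition green_shift S x : R[i] :=
  z + eps%:C ^+ 2 * \sum_(u in S :\ x | A x u) \sum_(w in S :\ x | A x w)
    green (S :\ x) v z u w.

(** The row of [x] in [(H - z) G = 1], with each [G w x] expanded by [green_step] through the
    symmetry of [G]. *)
Lemma green_diag S x : x \in S ->
  green S v z x x * ((v x)%:C - green_shift S x) = 1.
Proof.
move=> xS; have /matrixP/(_ x x) := mul_green S.
rewrite mxE (bigD1 x) //= [in RHS]mxE eqxx mulr1n => <-.
set G := green S v z.
have -> : \sum_(i < n | i != x) (ham S v - z%:M) x i * G i x =
   \sum_(w in S :\ x | A x w) (- eps)%:C * G w x.
  rewrite big_mkcond [RHS]big_mkcond; apply: eq_bigr => i _ /=.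
  rewrite !inE; case: eqVneq => //= ix.
  rewrite !mxE eq_sym (negbTE ix) mulr0n subr0 xS /= mul0r addr0.
  case: (i \in S) => /=; last by rewrite mul0r.
  by case: (A x i); rewrite ?mulr1 ?mulr0 ?rmorph0 ?mul0r.
have -> : (ham S v - z%:M) x x = (v x)%:C - z.
  by rewrite !mxE xS /= A_irr mulr0 add0r eqxx mul1r mulr1n.
have -> : \sum_(w in S :\ x | A x w) (- eps)%:C * G w x =
  - (eps%:C ^+ 2 * G x x * \sum_(w in S :\ x | A x w)
     \sum_(u in S :\ x | A x u) green (S :\ x) v z u w).
  rewrite mulr_sumr -sumrN; apply: eq_bigr => w /andP[]; rewrite !inE.
  move=> /andP[wx wS] _; rewrite /G green_sym green_step // rmorphN /=; ring.
rewrite /green_shift exchange_big /=; ring.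
Qed.

Lemma green_diag_norm S x : x \in S ->
  Normc.normc (green S v z x x) = (Normc.normc ((v x)%:C - green_shift S x))^-1.
Proof.
move=> xS; have := green_diag xS.
set D := _ - _ => h; have D0 : D != 0.
  by apply: contra_eq_neq h => ->; rewrite mulr0 eq_sym oner_eq0.
by rewrite -Normc.normcV -[green S v z x x](mulfK D0) h mul1r.
Qed.

End Nonreal.

Lemma green_shift_eq S x v w z : (forall i, i != x -> v i = w i) ->
  green_shift v z S x = green_shift w z S x.
Proof.
move=> h; rewrite /green_shift (@green_eq _ v w) // => i.
by rewrite !inE => /andP[/h].
Qed.

End Hamiltonian.

(** * Cauchy-Schwarz and the Ward identity *)

Section Ward.
Variables (C : numClosedFieldType) (n : nat).
Local Open Scope sesquilinear_scope.

(** Lagrange's identity for the moduli: the difference of the two sides is half a double sum of real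
    squares. *)
Lemma Cauchy_Schwarz_sum (I : finType) (a b : I -> C) :
  `|\sum_i a i * b i| ^+ 2 <= (\sum_i `|a i| ^+ 2) * (\sum_i `|b i| ^+ 2).
Proof.
apply: le_trans (_ : (\sum_i `|a i| * `|b i|) ^+ 2 <= _).
  have f0 : 0 <= \sum_i `|a i| * `|b i| by apply: sumr_ge0 => i _; rewrite mulr_ge0.
  rewrite lerXn2r ?nnegrE //.
  apply: le_trans (ler_norm_sum _ _ _) _.
  by apply: ler_sum => i _; rewrite normrM.
pose f i : C := `|a i|; pose g i : C := `|b i|.
rewrite -subr_ge0.
have -> : (\sum_i `|a i| ^+ 2) * (\sum_i `|b i| ^+ 2) -
    (\sum_i `|a i| * `|b i|) ^+ 2 =
   2^-1 * \sum_i \sum_j (f i * g j - f j * g i) ^+ 2.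
  have -> : \sum_i \sum_j (f i * g j - f j * g i) ^+ 2 =
    \sum_i \sum_j (f i ^+ 2 * g j ^+ 2) + \sum_i \sum_j (f j ^+ 2 * g i ^+ 2)
    - 2 * \sum_i \sum_j (f i * g i) * (f j * g j).
    rewrite mulr_sumr -sumrN -!big_split /=; apply: eq_bigr => i _.
    rewrite mulr_sumr -sumrN -!big_split /=; apply: eq_bigr => j _; ring.
  rewrite [X in _ + X - _]exchange_big /= expr2 !big_distrlr /= /f /g; by field.
apply: mulr_ge0; first by rewrite invr_ge0.
do 2!(apply: sumr_ge0 => ? _); apply: real_exprn_even_ge0 => //.
by rewrite rpredB ?rpredM ?normr_real.
Qed.

(** Taking adjoints, [(z - conj z) G G^adj = G - G^adj]; its diagonal entry at [x] bounds the l^2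
    mass of a whole row of [G] by the single entry [G x x]. *)
Lemma resolvent_ward (H : 'M[C]_n) z x : H \is hermsymmx ->
  H - z%:M \in unitmx ->
  `|z - z^*| * \sum_y `|invmx (H - z%:M) x y| ^+ 2 <=
     2 * `|invmx (H - z%:M) x x|.
Proof.
move=> hH hu; set D := H - z%:M; set G := invmx D.
have hD : D^t* = D + (z - z^*)%:M.
  have hH' : H = H^t* by have /is_hermitianmxP := hH; rewrite expr0 scale1r.
  rewrite /D linearB /= map_mxB -hH' tr_scalar_mx map_scalar_mx /=.
  by rewrite raddfB /= addrA subrK.
have hDG : D^t* *m G^t* = 1%:M.
  by rewrite -map_mxM -trmx_mul mulVmx // trmx1 map_mx1.
have e : (z - z^*) *: (G *m G^t*) = G - G^t*.
  have h1 : G *m (D^t* - D) *m G^t* = G - G^t*.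
    by rewrite mulmxBr mulmxBl -mulmxA hDG mulmx1 mulVmx // mul1mx.
  by rewrite -h1 hD [D + _]addrC addrK mul_mx_scalar -scalemxAl.
have /matrixP/(_ x x) := e; rewrite !mxE.
have -> : \sum_j G x j * G^t* j x = \sum_y `|G x y| ^+ 2.
  by apply: eq_bigr => y _; rewrite !mxE normCK.
move/(congr1 Num.norm); rewrite normrM => h.
rewrite -[X in _ * X <= _]ger0_norm; last first.
  by apply: sumr_ge0 => y _; rewrite exprn_ge0.
rewrite h (le_trans (ler_normB _ _)) // norm_conjC.
by rewrite mulr_natl mulr2n.
Qed.
End Ward.

(** * Approximate eigenvectors force large diagonal resolvent entries *)

Section ApproximateEigenvectors.
Variables (R : rcfType) (n : nat) (A : rel 'I_n) (eps : R).
Hypotheses (A_sym : symmetric A) (A_irr : irreflexive A).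
Variables (v : 'I_n -> R) (E delta : R).
Local Notation sT := (finset.setTfor 'I_n).
Hypotheses (delta0 : 0 < delta).
Let z := E +i* delta.
Let Im_z : complex.Im z != 0. Proof. by rewrite /= gt_eqF. Qed.

(** With [w = u (H - z)], of squared norm at most [4 delta^2 |u|^2], one has [u = w G]. Only the
    rows of [G] in [S] contribute, since [u], hence [w], vanishes elsewhere. If all their diagonal
    entries were below [1 / (8 delta n)], the Ward identity would bound the squared Hilbert-Schmidt
    norm of these rows by [1 / (8 delta^2)], and Cauchy-Schwarz would give [|u|^2 <= |u|^2 / 2]. *)
Lemma approx_eigenvector_green (S : {set 'I_n}) (u : 'rV[R[i]]_n) :
  (0 < n)%N -> u != 0 -> (forall x, x \notin S -> u 0 x = 0) ->
  \sum_x `|(u *m (ham A eps S v - E%:C%:M)) 0 x| ^+ 2 <=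
     delta%:C ^+ 2 * \sum_x `|u 0 x| ^+ 2 ->
  exists2 x, x \in S &
    (8 * delta * n%:R)^-1 <= Normc.normc (green A eps S v z x x).
Proof.
move=> n0 u0 uS; set r := u *m _ => hr; set G := green A eps S v z.
have [/existsP[x /andP[xS hx]]|] :=
  boolP [exists x, (x \in S) && ((8 * delta * n%:R)^-1 <= Normc.normc (G x x))].
  by exists x.
rewrite negb_exists => /forallP hsmall; exfalso.
have d0 : 0 < delta%:C by rewrite ltcR.
have nr0 : 0 < n%:R :> R[i] by rewrite ltr0n.
pose c := (8 * delta%:C * n%:R)^-1.
have hG x : x \in S -> `|G x x| <= c.
  move=> xS; have := hsmall x; rewrite xS /= -ltNge => h.
  have -> : c = ((8 * delta * n%:R)^-1)%:C.
    by rewrite fmorphV !rmorphM /= !rmorph_nat.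
  by rewrite -[`|_|]/(Normc.normc _)%:C lecR ltW.
pose w := u *m (ham A eps S v - z%:M).
have hw : w = r - (delta *i) *: u.
  rewrite /w /r; have -> : z%:M = E%:C%:M + (delta *i)%:M :> 'M[R[i]]_n.
    by rewrite -raddfD /= /z; congr (_%:M); rewrite /real_complex_def; simpc.
  by rewrite opprD addrA [in LHS]mulmxBr mul_mx_scalar.
clearbody r.
have wS x : x \notin S -> w 0 x = 0.
  move=> xS; rewrite /w mxE big1 // => k _; rewrite !mxE (negbTE xS) andbF sub0r.
  by case: eqP => [->|_]; [rewrite uS ?mul0r|rewrite mulr0n oppr0 mulr0].
have huG : u = w *m G by rewrite /w -mulmxA mul_green ?mulmx1.
set U := \sum_x `|u 0 x| ^+ 2 in hr.
have U0 : 0 < U.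
  have [x hx] : exists x, u 0 x != 0.
    apply/existsP; apply: contraNT u0; rewrite negb_exists => /forallP h.
    by apply/eqP/rowP => x; rewrite mxE; apply/eqP; rewrite -[_ == _]negbK.
  rewrite /U (bigD1 x) //= ltr_pwDl ?exprn_gt0 ?normr_gt0 //.
  by apply: sumr_ge0 => k _; rewrite exprn_ge0.
have hW : \sum_x `|w 0 x| ^+ 2 <= 4 * delta%:C ^+ 2 * U.
  apply: le_trans (_ : \sum_x (2 * `|r 0 x| ^+ 2 +
      2 * (delta%:C ^+ 2 * `|u 0 x| ^+ 2)) <= _).
    apply: ler_sum => x _; rewrite hw !mxE.
    have hn : `|delta *i| = delta%:C.
      by rewrite normc_def /= expr0n /= add0r sqrtr_sqr gtr0_norm.
    apply: le_trans (_ : (`|r 0 x| + delta%:C * `|u 0 x|) ^+ 2 <= _).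
      have d1 : 0 <= delta%:C * `|u 0 x| by rewrite mulr_ge0 // ltW.
      rewrite lerXn2r ?nnegrE ?addr_ge0 //.
      by apply: le_trans (ler_normB _ _) _; rewrite normrM hn lexx.
    rewrite -subr_ge0.
    set a : R[i] := `|_|; set b : R[i] := `|_|; set e := delta%:C.
    have -> : 2 * a ^+ 2 + 2 * (e ^+ 2 * b ^+ 2) - (a + e * b) ^+ 2 =
      (a - e * b) ^+ 2 by ring.
    apply: real_exprn_even_ge0 => //.
    by rewrite rpredB ?rpredM ?normr_real // gtr0_real.
  rewrite big_split /= -!mulr_sumr -/U.
  have -> : 4 * delta%:C ^+ 2 * U = 2 * (delta%:C ^+ 2 * U) + 2 * (delta%:C ^+ 2 * U).
    by ring.
  by rewrite lerD2r ler_pM2l.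
have hUW : U <= (\sum_x `|w 0 x| ^+ 2) * \sum_(x in S) \sum_y `|G x y| ^+ 2.
  rewrite exchange_big /= mulr_sumr /U; apply: ler_sum => y _.
  rewrite {1}huG mxE.
  have -> : \sum_j w 0 j * G j y = \sum_j w 0 j * (if j \in S then G j y else 0).
    by apply: eq_bigr => j _; case: ifPn => // /wS ->; rewrite !mul0r.
  apply: le_trans (Cauchy_Schwarz_sum _ _) _.
  rewrite [X in _ <= _ * X]big_mkcond /=.
  apply: ler_wpM2l; first by apply: sumr_ge0 => k _; rewrite exprn_ge0.
  by apply: ler_sum => j _; case: ifP => // _; rewrite normr0 expr0n.
have hz2 : `|z - z^*| = 2 * delta%:C.
  have -> : z - z^* = 0 +i* (2 * delta).
    change (z - conjc z = 0 +i* (2 * delta)).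
    apply/eqP; rewrite eq_complex /= subrr eqxx /= opprK; apply/eqP; ring.
  rewrite normc_def /= expr0n /= add0r sqrtr_sqr ger0_norm ?mulr_ge0 ?(ltW delta0) //.
  by rewrite rmorphM /= rmorph_nat.
have hS : \sum_(x in S) \sum_y `|G x y| ^+ 2 <= (8 * delta%:C ^+ 2)^-1.
  apply: le_trans (_ : \sum_(x in S) (c / delta%:C) <= _).
    apply: ler_sum => x xS; rewrite ler_pdivlMr // mulrC.
    have := resolvent_ward x (ham_herm eps A_sym S v) (green_unit eps A_sym v Im_z S).
    rewrite hz2 -mulrA ler_pM2l // => h; apply: le_trans h _.
    exact: hG.
  rewrite sumr_const -[_ *+ _]mulr_natl.
  apply: le_trans (_ : n%:R * (c / delta%:C) <= _).
    apply: ler_wpM2r; last by rewrite ler_nat (leq_trans (max_card _)) ?card_ord.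
    by apply: divr_ge0; rewrite ?(ltW d0) // /c invr_ge0; apply/ltW; rewrite !mulr_gt0.
  rewrite /c le_eqVlt; apply/orP; left; apply/eqP; field.
  by rewrite !gt_eqF.
have : U <= 4 * delta%:C ^+ 2 * U * (8 * delta%:C ^+ 2)^-1.
  apply: le_trans hUW _; apply: ler_pM => //.
    by apply: sumr_ge0 => k _; rewrite exprn_ge0.
  by apply: sumr_ge0 => x _; apply: sumr_ge0 => k _; rewrite exprn_ge0.
have -> : 4 * delta%:C ^+ 2 * U * (8 * delta%:C ^+ 2)^-1 = 2^-1 * U.
  by field; rewrite gt_eqF.
rewrite -subr_le0; have -> : U - 2^-1 * U = 2^-1 * U by field.
by rewrite pmulr_rle0 ?invr_gt0 // => /(lt_le_trans U0); rewrite ltxx.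
Qed.

(* The span of two eigenvectors contains a nonzero vector vanishing at any
   given site, hence an approximate eigenvector of the depleted operator. *)
Lemma two_eigenvalues_green (P : 'M[R[i]]_n) (dg : 'rV[R[i]]_n) (i j : 'I_n) :
  P \is unitarymx -> P *m ham A eps sT v = diag_mx dg *m P -> i != j ->
  `|dg 0 i - E%:C| <= delta%:C -> `|dg 0 j - E%:C| <= delta%:C ->
  (exists x, (8 * delta * n%:R)^-1 <= Normc.normc (green A eps sT v z x x)) /\
  (forall x, exists2 y, y \in sT :\ x &
    (8 * delta * n%:R)^-1 <= Normc.normc (green A eps (sT :\ x) v z y y)).
Proof.
move=> hP hPH ij hi hj.
have n0 : (0 < n)%N by apply: leq_ltn_trans (ltn_ord i).
pose u a b := a *: row i P + b *: row j P.
have norm_u a b : \sum_x `|u a b 0 x| ^+ 2 = `|a| ^+ 2 + `|b| ^+ 2.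
  have h := unitary_rows hP.
  transitivity (\sum_x (a * a^* * (P i x * (P i x)^*) + a * b^* * (P i x * (P j x)^*)
      + b * a^* * (P j x * (P i x)^*) + b * b^* * (P j x * (P j x)^*))).
    apply: eq_bigr => x _; rewrite normCK !mxE rmorphD !rmorphM /=; ring.
  rewrite !big_split /= -!mulr_sumr !h !eqxx (negbTE ij) eq_sym (negbTE ij).
  by rewrite !normCK !mulr0n !mulr0 !addr0 !mulr1n !mulr1.
have rowH k : row k P *m (ham A eps sT v - E%:C%:M) = (dg 0 k - E%:C) *: row k P.
  rewrite mulmxBr -row_mul hPH mul_mx_scalar scalerBl; congr (_ - _).
  by apply/rowP => x; rewrite mul_diag_mx !mxE.
have uH a b : u a b *m (ham A eps sT v - E%:C%:M) =
    u (a * (dg 0 i - E%:C)) (b * (dg 0 j - E%:C)).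
  by rewrite /u mulmxDl -!scalemxAl !rowH !scalerA.
have normH a b : \sum_x `|(u a b *m (ham A eps sT v - E%:C%:M)) 0 x| ^+ 2 <=
     delta%:C ^+ 2 * \sum_x `|u a b 0 x| ^+ 2.
  rewrite uH !norm_u !normrM !exprMn mulrDr.
  have h (t : R[i]) : `|t| <= delta%:C -> `|t| ^+ 2 <= delta%:C ^+ 2.
    by move=> ht; rewrite lerXn2r ?nnegrE // ?ler0c ?ltW // (le_trans _ ht).
  by apply: lerD; rewrite mulrC ler_wpM2r ?exprn_ge0 ?h.
have u_neq0 a b : (a != 0) || (b != 0) -> u a b != 0.
  move=> hab; apply: contraTneq hab => h0.
  have := norm_u a b; rewrite h0 big1 => [|x _]; last first.
    by rewrite mxE normr0 expr0n.
  move/esym/eqP; rewrite paddr_eq0 ?exprn_ge0 // !expf_eq0 /= !normr_eq0.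
  by rewrite negb_or !negbK.
split.
  have [|||x _ hx] := @approx_eigenvector_green sT (u 1 0) n0.
  - by apply: u_neq0; rewrite oner_eq0.
  - by move=> x; rewrite inE.
  - exact: normH.
  - by exists x.
move=> x.
(* Coefficients of a combination vanishing at [x]. If both eigenvectors already vanish there, the
   general formula would give zero, and the first eigenvector is taken instead. *)
pose ab := if (P i x == 0) && (P j x == 0) then (1, 0) else (P j x, - P i x).
have abN0 : (ab.1 != 0) || (ab.2 != 0).
  rewrite /ab; case: ifPn => /=; first by rewrite oner_eq0.
  by rewrite negb_and oppr_eq0 orbC.
have ux : u ab.1 ab.2 0 x = 0.
  rewrite /u /ab !mxE; case: ifPn => /=; last by move=> _; ring.
  by move=> /andP[/eqP-> /eqP->]; rewrite !mulr0 addr0.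
apply: (@approx_eigenvector_green _ (u ab.1 ab.2)) => //.
- exact: u_neq0.
- by move=> y; rewrite !inE andbT negbK => /eqP->.
(* On vectors vanishing at [x] the depleted operator agrees with the full one except that its output
   at [x] is 0, so the residual can only decrease. *)
- apply: le_trans (normH ab.1 ab.2); apply: ler_sum => y _.
  set w := u ab.1 ab.2 in ux *; clearbody w; rewrite !mxE.
  have [->|yx] := eqVneq y x.
    rewrite [X in `|X| ^+ 2 <= _]big1 => [|k _].
      by rewrite normr0 expr0n exprn_ge0.
    rewrite !mxE !inE eqxx /= andbF sub0r.
    by case: eqP => [->|_]; [rewrite ux ?mul0r|rewrite mulr0n oppr0 mulr0].
  rewrite le_eqVlt; apply/orP; left; apply/eqP; congr (`|_| ^+ 2).
  apply: eq_bigr => k _; have [->|kx] := eqVneq k x; first by rewrite ux !mul0r.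
  by rewrite !mxE !inE kx yx.
Qed.
End ApproximateEigenvectors.

(** * A rational spectral cutoff as an average of resolvents *)

Section SpectralCutoff.
Variable C : numClosedFieldType.
Implicit Types (c t : C) (k : nat).

(** The [2 ^ k]-th roots of [c], produced by repeated square roots so that the partial fraction
    expansion below goes by induction on [k]. *)
Fixpoint iter_sqrt k c : seq C :=
  if k is k'.+1 then iter_sqrt k' (sqrtC c) ++ iter_sqrt k' (- sqrtC c)
  else [:: c].

Lemma size_iter_sqrt k c : size (iter_sqrt k c) = (2 ^ k)%N.
Proof. by elim: k c => //= k IH c; rewrite size_cat !IH addnn -mul2n expnS. Qed.

Lemma iter_sqrt_pow k c c' : c' \in iter_sqrt k c -> c' ^+ (2 ^ k) = c.
Proof.
elim: k c => [|k IH] c /=; first by rewrite inE => /eqP->; rewrite expr1.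
rewrite mem_cat expnSr exprM => /orP[] /IH ->; first by rewrite sqrtCK.
by rewrite sqrrN sqrtCK.
Qed.

Lemma iter_sqrtN1_norm k c : c \in iter_sqrt k (-1) -> `|c| = 1.
Proof.
move=> /iter_sqrt_pow /(congr1 Num.norm); rewrite normrX normrN1 => /eqP.
by rewrite pexpr_eq1 ?expn_gt0 // => /eqP.
Qed.

(** An even power of a real number is not -1. Hence the energies [E + r / c] used below are off the
    real axis. *)
Lemma iter_sqrtN1_nreal k c : (0 < k)%N -> c \in iter_sqrt k (-1) ->
  c \isn't Num.real.
Proof.
case: k => // k _ /iter_sqrt_pow; rewrite expnS => h; apply/negP => cr.
have : 0 <= c ^+ (2 * 2 ^ k).
  by apply: real_exprn_even_ge0; rewrite // mul2n odd_double.
by rewrite h oppr_ge0 ler10.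
Qed.

(* Iterates 1/(1 - a^2) = (1/(1 - a) + 1/(1 + a)) / 2. *)
Lemma cutoff_average k c t : 1 - c * t ^+ (2 ^ k) != 0 ->
  (1 - c * t ^+ (2 ^ k))^-1 =
  (2 ^+ k)^-1 * \sum_(c' <- iter_sqrt k c) (1 - c' * t)^-1.
Proof.
elim: k c => [|k IH] c; first by rewrite big_seq1 expr1 expr0 invr1 mul1r.
rewrite expnSr exprM; set s := sqrtC c; set T := t ^+ (2 ^ k).
have hs : 1 - c * T ^+ 2 = (1 - s * T) * (1 - - s * T).
  by rewrite -{1}(sqrtCK c) -/s; ring.
rewrite hs mulf_eq0 negb_or => /andP[h1 h2].
rewrite [iter_sqrt _ _]/= -/s big_cat /=.
have := IH _ h1; have := IH _ h2; rewrite -/T.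
set X := \sum_(_ <- _) _; set Y := \sum_(_ <- _) _ => e2 e1.
have -> : (2 ^+ k.+1)^-1 * (Y + X) = 2^-1 * ((2 ^+ k)^-1 * Y + (2 ^+ k)^-1 * X).
  by rewrite exprS invfM -mulrA mulrDr.
rewrite -e1 -e2.
by field; rewrite h1; move: h2; rewrite mulNr opprK => ->.
Qed.

Variable n : nat.
Local Open Scope sesquilinear_scope.

(** The [x y] entry of [f(H)], with [f = 1 / (1 + t^(2^k))] and [t = (lambda - E) / r], is computed
    twice. As an average of resolvents at [E + r / c] with weights [- r / c], it is at most [r * B].
    As a spectral sum it is the term of [j], where [f >= 1/2], plus fewer than [n] terms of size at
    most [2^(-2^k)], because [|t| >= 2] there. Dividing by the 1/2 doubles both errors. *)
Lemma eigenvector_product_le (P H : 'M[C]_n) (dg : 'rV[C]_n) (E r B : C)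
    (k : nat) (j x y : 'I_n) :
  P \is unitarymx -> (forall i, dg 0 i \is Num.real) ->
  H = P^t* *m diag_mx dg *m P -> E \is Num.real -> 0 < r -> (0 < k)%N ->
  `|dg 0 j - E| <= r / 2 -> (forall i, i != j -> 2 * r <= `|dg 0 i - E|) ->
  (forall c, c \in iter_sqrt k (-1) ->
     `|invmx (H - (E + r / c)%:M) x y| <= B) ->
  `|P j x| * `|P j y| <= 2 * r * B + 2 * n%:R / 2 ^+ (2 ^ k).
Proof.
move=> hP hd hH hE r0 k0 hj hi hB.
have rN0 : r != 0 by rewrite gt_eqF.
have rr : r \is Num.real by rewrite gtr0_real.
pose t i := (dg 0 i - E) / r.
have tr i : t i \is Num.real by rewrite rpred_div // rpredB.
have te0 i : 0 <= t i ^+ (2 ^ k).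
  apply: real_exprn_even_ge0 => //.
  by case: k k0 {hB} => // k _; rewrite expnS mul2n odd_double.
have f0 i : 0 < 1 + t i ^+ (2 ^ k) by rewrite ltr_pwDl.
pose f i := (1 + t i ^+ (2 ^ k))^-1.
have hf i : f i = (2 ^+ k)^-1 * \sum_(c <- iter_sqrt k (-1)) (1 - c * t i)^-1.
  have h : 1 + t i ^+ (2 ^ k) = 1 - -1 * t i ^+ (2 ^ k) by ring.
  by rewrite /f h cutoff_average // -h gt_eqF.
pose a i := (P i x)^* * P i y.
have ha i : `|a i| <= 1.
  rewrite normrM norm_conjC -[leRHS]mulr1.
  by rewrite ler_pM ?unitary_entry_le1.
have hsum : `|\sum_i a i * f i| <= r * B.
  have -> : \sum_i a i * f i = (2 ^+ k)^-1 * \sum_(c <- iter_sqrt k (-1))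
      - (r / c) * invmx (H - (E + r / c)%:M) x y.
    rewrite (eq_bigr (fun i => (2 ^+ k)^-1 *
      \sum_(c <- iter_sqrt k (-1)) a i * (1 - c * t i)^-1)); last first.
      by move=> i _; rewrite hf mulrCA mulr_sumr.
    rewrite -mulr_sumr exchange_big /=; congr (_ * _).
    rewrite !big_seq; apply: eq_bigr => c hc.
    have cN0 : c != 0 by rewrite -normr_eq0 (iter_sqrtN1_norm hc) oner_eq0.
    have hne i : dg 0 i != E + r / c.
      apply: contraNneq (iter_sqrtN1_nreal k0 hc) => e.
      have -> : c = r / (dg 0 i - E).
        have -> : dg 0 i - E = r / c by rewrite e addrAC subrr add0r.
        by field; rewrite rN0 cN0.
      by rewrite rpred_div // rpredB.
    rewrite (resolvent_entry hH hP hne) mulr_sumr; apply: eq_bigr => i _.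
    rewrite /t -/(a i).
    have h1 : dg 0 i - (E + r / c) != 0 by rewrite subr_eq0.
    have h2 : 1 - c * ((dg 0 i - E) / r) = - (c / r) * (dg 0 i - (E + r / c)).
      by field; rewrite rN0 cN0.
    rewrite h2 invfM invrN invf_div; ring.
  rewrite normrM normfV normrX ger0_norm // ler_pdivrMl ?exprn_gt0 //.
  apply: le_trans (ler_norm_sum _ _ _) _.
  apply: le_trans (_ : \sum_(c <- iter_sqrt k (-1)) r * B <= _).
    rewrite big_seq [leRHS]big_seq; apply: ler_sum => c hc.
    rewrite normrM normrN normrM normfV (iter_sqrtN1_norm hc) invr1 mulr1.
    by rewrite gtr0_norm // ler_pM2l // hB.
  by rewrite big_const_seq count_predT size_iter_sqrt iter_addr_0 -[leLHS]mulr_natl natrX.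
have q0 : 0 < 2 ^+ (2 ^ k) :> C by rewrite exprn_gt0.
have hother i : i != j -> `|a i * f i| <= (2 ^+ (2 ^ k))^-1.
  move=> ij; rewrite normrM -[leRHS]mul1r ler_pM // /f normfV gtr0_norm //.
  rewrite lef_pV2 ?posrE // -[leLHS]add0r lerD //.
  rewrite -[t i ^+ _]ger0_norm // normrX lerXn2r ?nnegrE //.
  by rewrite /t normrM normfV (gtr0_norm r0) ler_pdivlMr // hi.
have hfj : 2^-1 <= `|f j|.
  rewrite /f normfV gtr0_norm // lef_pV2 ?posrE //.
  rewrite (_ : 2 = 1 + 1) // lerD2l -[leLHS]ger0_norm // normrX exprn_ile1 //.
  rewrite /t normrM normfV (gtr0_norm r0) ler_pdivrMr // mul1r.
  by apply: le_trans hj _; rewrite ler_pdivrMr // ler_peMr ?ler1n // ltW.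
have haj : `|a j * f j| <= r * B + n%:R / 2 ^+ (2 ^ k).
  have -> : a j * f j = \sum_i a i * f i - \sum_(i | i != j) a i * f i.
    by rewrite [X in X - _](bigD1 j) //= addrK.
  apply: le_trans (ler_normB _ _) _; apply: lerD => //.
  apply: le_trans (ler_norm_sum _ _ _) _.
  apply: le_trans (_ : \sum_(i | i != j) (2 ^+ (2 ^ k))^-1 <= _).
    by apply: ler_sum => i; apply: hother.
  rewrite sumr_const -[leLHS]mulr_natl ler_pM2r ?invr_gt0 // ler_nat.
  by rewrite (leq_trans (max_card _)) ?card_ord.
have -> : `|P j x| * `|P j y| = 2 * (`|a j| * 2^-1).
  by rewrite /a normrM norm_conjC; field.
rewrite -!mulrA -mulrDr ler_pM2l //; apply: le_trans haj.
by rewrite [leRHS]normrM ler_wpM2l.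
Qed.
End SpectralCutoff.

Local Open Scope classical_set_scope.
Local Open Scope ring_scope.
Local Open Scope complex_scope.

(** * Averaging over the potential at one site *)

Section Resampling.
Context (R : realType) (dT : measure_display) (T : measurableType dT).
Variables (P : probability T R) (mu : probability R R) (n : nat).
Variables (v : 'I_n -> T -> R) (x : 'I_n).
Hypothesis mv : forall i, measurable_fun setT (v i).
Hypothesis v_law : forall i (B : set R), measurable B -> P (v i @^-1` B) = mu B.
Hypothesis v_ind : forall B : 'I_n -> set R, (forall i, measurable (B i)) ->
  P [set w | forall i, B i (v i w)] = (\prod_i P (v i @^-1` B i))%E.

Definition cylinders_off : set (set T) :=
  [set A | exists2 B : 'I_n -> set R, forall i, measurable (B i) &
     A = [set w | forall i, i != x -> B i (v i w)]].

(** The sample space with the sigma-algebra of the potentials off [x]: measurability on [off_type]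
    is how not depending on [v x] is expressed. *)
Definition off_type := g_sigma_algebraType cylinders_off.

Lemma measurable_cylinder (B : 'I_n -> set R) : (forall i, measurable (B i)) ->
  measurable [set w | forall i, B i (v i w)].
Proof.
move=> mB.
have -> : [set w | forall i, B i (v i w)] = \bigcap_(i in [set: 'I_n]) (v i @^-1` B i).
  by apply/seteqP; split => [w h i _|w h i]; [exact: h|exact: (h i I)].
apply: fin_bigcap_measurable => // i _.
by rewrite -[X in measurable X]setTI; apply: mv.
Qed.

Lemma cylinder_offE (B : 'I_n -> set R) :
  [set w | forall i, i != x -> B i (v i w)] =
  [set w | forall i, (if i == x then setT else B i) (v i w)].
Proof.
apply/seteqP; split=> w /= h i.
  by case: eqP => // /eqP; apply: h.
by move=> ix; have := h i; rewrite (negbTE ix).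
Qed.

Definition to_off (w : T) : off_type := w.

Lemma measurable_to_off : measurable_fun [set: T] to_off.
Proof.
apply: (measurability _ (erefl : @measurable _ off_type = <<s cylinders_off >>)).
move=> _ [_ [B mB ->] <-]; rewrite setTI -[to_off @^-1` _]/[set w | forall i, i != x -> B i (v i w)] cylinder_offE.
by apply: (measurable_cylinder (B := fun i => if i == x then setT else B i)) => i; case: eqP.
Qed.

Lemma measurable_off_coord i : i != x ->
  measurable_fun [set: off_type] (v i : off_type -> R).
Proof.
move=> ix _ A mA; rewrite setTI; apply: sub_sigma_algebra.
exists (fun j => if j == i then A else setT); first by move=> j; case: eqP.
apply/seteqP; split=> w /= h; first by move=> j _; case: eqP => // ->.
by have := h i ix; rewrite eqxx.
Qed.

HB.instance Definition _ := isMeasurableFun.Build _ _ _ _ to_off measurable_to_off.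

Let offP := distribution P (to_off : {mfun T >-> off_type}).

(** Both sides are finite measures in [B], and on the cylinders, a generating pi-system, they agree
    by the product formula. The left one is [P] restricted to [v x] in [A], the right one a multiple
    of [P]. *)
Lemma indep_off (A : set R) (B : set off_type) : measurable A -> measurable B ->
  P (v x @^-1` A `&` B) = (mu A * P B)%E.
Proof.
move=> mA mB.
have mvA : measurable (v x @^-1` A).
  by rewrite -[X in measurable X]setTI; apply: mv.
have muA0 : 0 <= fine (mu A) by rewrite fine_ge0.
pose c := NngNum muA0.
have cE : (c%:num)%:E = mu A by rewrite /c /= fineK // fin_num_measure.
pose m1 := pushforward (mrestr P mvA) (to_off : {mfun T >-> off_type}).
pose m2 := mscale c offP.
have h : m1 B = m2 B.
  apply: (@measure_unique _ _ off_type cylinders_off (fun=> setT) _ _ _ _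
    (measure_function_pushforward__canonical__measure_function_Measure (mrestr P mvA) measurable_to_off)
    [the {measure set off_type -> \bar R} of m2]) => //.
  - move=> _ _ [B1 mB1 ->] [B2 mB2 ->]; exists (fun i => B1 i `&` B2 i).
      by move=> i; apply: measurableI.
    apply/seteqP; split=> w /=; first by move=> [h1 h2] i ix; split; [apply: h1|apply: h2].
    by move=> h; split=> i ix; have [] := h i ix.
  - move=> _; exists (fun=> setT) => //; by apply/seteqP; split.
  - by rewrite bigcup_const.
  - move=> _ [C mC ->]; rewrite /m1 /m2 /offP /mscale /distribution /= /pushforward /mrestr /=.
    rewrite -[to_off @^-1` _]/[set w | forall i, i != x -> C i (v i w)] cylinder_offE.
    rewrite -[RHS]/((c%:num)%:E * P [set w | forall i, (if i == x then setT else C i) (v i w)])%E cE.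
    pose D i := if i == x then A else C i.
    pose D' i := if i == x then setT else C i.
    have mD i : measurable (D i) by rewrite /D; case: eqP.
    have mD' i : measurable (D' i) by rewrite /D'; case: eqP.
    have -> : [set w | forall i, (if i == x then setT else C i) (v i w)] `&`
       v x @^-1` A = [set w | forall i, D i (v i w)].
      apply/seteqP; split=> w /=.
        move=> [h hA] i; rewrite /D; case: eqP => [->//|/eqP ix].
        by have := h i; rewrite (negbTE ix).
      move=> h; split=> [i|]; last by have := h x; rewrite /D eqxx.
      by have := h i; rewrite /D; case: eqP.
    rewrite (v_ind mD) (v_ind mD') (bigD1 x) //= [in RHS](bigD1 x) //=.
    rewrite /D /D' eqxx v_law // preimage_setT probability_setT mul1e.
    by congr (_ * _)%E; apply: eq_bigr => i /negbTE ->.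
  - move=> _; rewrite /m1 /= /pushforward /mrestr /= preimage_setT setTI.
    by rewrite ltey_eq fin_num_measure.
transitivity (m1 B); first by rewrite /m1 /pushforward /mrestr /= setIC.
by rewrite h -cE.
Qed.

(** By [indep_off] the pair of [v x] and the remaining potentials has a product law; Tonelli then
    replaces [v x] by an independent copy [t], integrated first. *)
Lemma resample (f : R * off_type -> \bar R) :
  measurable_fun [set: R * off_type] f -> (forall p, (0 <= f p)%E) ->
  (\int[P]_w f (v x w, to_off w) = \int[P]_w \int[mu]_t f (t, to_off w))%E.
Proof.
move=> mf f0.
have mZ : measurable_fun [set: T] (fun w => (v x w, to_off w) : R * off_type).
  by apply: measurable_fun_pair => //; apply: measurable_to_off.
pose Zmix := isMeasurableFun.Build _ _ _ _ _ mZ.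
pose Z : {mfun T >-> _} := HB.pack (fun w => (v x w, to_off w) : R * off_type) Zmix.
have hprod (X : set (R * off_type)) : measurable X ->
    (mu \x offP)%E X = pushforward P Z X.
  move=> mX; apply: (@product_measure_unique _ _ _ _ _ mu offP
    (measure_function_pushforward__canonical__measure_function_Measure P mZ)) => //.
  by move=> A B mA mB; rewrite -indep_off.
transitivity (\int[pushforward P Z]_p f p)%E.
  by rewrite ge0_integral_pushforward.
transitivity (\int[mu \x offP]_p f p)%E.
  by apply: eq_measure_integral => A mA _; exact/esym/hprod.
rewrite fubini_tonelli2 // /offP.
rewrite ge0_integral_pushforward //.
- exact: measurable_fun_fubini_tonelli_G.
- by move=> w _; apply: integral_ge0.
Qed.

End Resampling.

(** * Function classes closed under algebra and square roots *)

Section FunctionClass.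
Variables (R : realType) (T : Type) (Q : (T -> R) -> Prop).
Hypotheses (Qcst : forall c, Q (fun=> c))
  (QD : forall f g, Q f -> Q g -> Q (fun t => f t + g t))
  (QM : forall f g, Q f -> Q g -> Q (fun t => f t * g t))
  (Qsqrt : forall f, Q f -> Q (fun t => Num.sqrt (f t))).
Implicit Types (f g : T -> R[i]).

(** Used with [Q] measurability on the sample space and with [Q] continuity in the entries of a
    matrix; closure under square roots is there for the modulus. *)
Definition complex_class f :=
  Q (fun t => complex.Re (f t)) /\ Q (fun t => complex.Im (f t)).

Lemma class_opp (f : T -> R) : Q f -> Q (fun t => - f t).
Proof.
move=> hf; rewrite (_ : (fun t => _) = (fun t => (-1) * f t)); first exact: QM.
by apply/funext => t; rewrite mulN1r.
Qed.

Lemma class_sum (I : Type) (s : seq I) (h : I -> T -> R) :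
  (forall i, Q (h i)) -> Q (fun t => \sum_(i <- s) h i t).
Proof.
move=> hh; elim: s => [|i s IH].
  by rewrite (_ : (fun t => _) = (fun=> 0)) //; apply/funext => t; rewrite big_nil.
rewrite (_ : (fun t => _) = (fun t => h i t + \sum_(i <- s) h i t)); first exact: QD.
by apply/funext => t; rewrite big_cons.
Qed.

Lemma complex_class_cst c : complex_class (fun=> c).
Proof. by split; exact: Qcst. Qed.

Lemma complex_classD f g : complex_class f -> complex_class g ->
  complex_class (fun t => f t + g t).
Proof.
move=> [f1 f2] [g1 g2]; split.
  rewrite (_ : (fun t => _) = (fun t => complex.Re (f t) + complex.Re (g t))).
    exact: QD.
  by apply/funext => t; case: (f t) (g t) => ? ? [].
rewrite (_ : (fun t => _) = (fun t => complex.Im (f t) + complex.Im (g t))).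
  exact: QD.
by apply/funext => t; case: (f t) (g t) => ? ? [].
Qed.

Lemma complex_classM f g : complex_class f -> complex_class g ->
  complex_class (fun t => f t * g t).
Proof.
move=> [f1 f2] [g1 g2]; split.
  rewrite (_ : (fun t => _) = (fun t => complex.Re (f t) * complex.Re (g t) +
      - (complex.Im (f t) * complex.Im (g t)))).
    by apply: QD; [exact: QM|apply: class_opp; exact: QM].
  by apply/funext => t; case: (f t) (g t) => ? ? [].
rewrite (_ : (fun t => _) = (fun t => complex.Re (f t) * complex.Im (g t) +
      complex.Im (f t) * complex.Re (g t))).
  by apply: QD; exact: QM.
by apply/funext => t; case: (f t) (g t) => ? ? [].
Qed.

Lemma complex_classB f g : complex_class f -> complex_class g ->
  complex_class (fun t => f t - g t).
Proof.
move=> hf hg; rewrite (_ : (fun t => _) = (fun t => f t + (-1) * g t)).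
  by apply: complex_classD => //; apply: complex_classM => //; exact: complex_class_cst.
by apply/funext => t; rewrite mulN1r.
Qed.

Lemma complex_classJ f : complex_class f -> complex_class (fun t => conjc (f t)).
Proof.
move=> [f1 f2]; split.
  by rewrite (_ : (fun t => _) = (fun t => complex.Re (f t))) //;
    apply/funext => t; case: (f t).
rewrite (_ : (fun t => _) = (fun t => - complex.Im (f t))); first exact: class_opp.
by apply/funext => t; case: (f t).
Qed.

Lemma complex_class_sum (I : Type) (s : seq I) (h : I -> T -> R[i]) :
  (forall i, complex_class (h i)) -> complex_class (fun t => \sum_(i <- s) h i t).
Proof.
move=> hh; elim: s => [|i s IH].
  rewrite (_ : (fun t => _) = (fun=> 0)); first exact: complex_class_cst.
  by apply/funext => t; rewrite big_nil.
rewrite (_ : (fun t => _) = (fun t => h i t + \sum_(i <- s) h i t)).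
  exact: complex_classD.
by apply/funext => t; rewrite big_cons.
Qed.

Lemma class_normc f : complex_class f -> Q (fun t => Normc.normc (f t)).
Proof.
move=> [f1 f2]; rewrite (_ : (fun t => _) = (fun t => Num.sqrt
   (complex.Re (f t) * complex.Re (f t) + complex.Im (f t) * complex.Im (f t)))).
  by apply: Qsqrt; apply: QD; exact: QM.
by apply/funext => t; case: (f t) => a b; rewrite /= !expr2.
Qed.
End FunctionClass.

(** * Measurability of resolvent entries *)

Section ComplexMeasurable.
Context (R : realType) (d : measure_display) (T : measurableType d).
Implicit Types (f g : T -> R[i]).

Definition cmeasurable f :=
  complex_class (fun g : T -> R => measurable_fun [set: T] g) f.

Lemma measurable_inv (f : T -> R) : (forall w, 0 <= f w) ->
  measurable_fun [set: T] f -> measurable_fun [set: T] (fun w => (f w)^-1).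
Proof.
move=> f0 mf; rewrite (_ : (fun w => _) = (fun w => f w `^ (-1))).
  exact: (measurableT_comp (measurable_powR (-1)) mf).
by apply/funext => w; rewrite powR_inv1.
Qed.

Lemma measurable_sqrt (f : T -> R) :
  measurable_fun [set: T] f -> measurable_fun [set: T] (fun w => Num.sqrt (f w)).
Proof.
move=> mf; apply: (measurableT_comp _ mf).
exact: continuous_measurable_fun (@sqrt_continuous R).
Qed.

Let mcst (c : R) : measurable_fun [set: T] (fun=> c).
Proof. exact: measurable_cst. Qed.
Let mD (f g : T -> R) : measurable_fun [set: T] f -> measurable_fun [set: T] g ->
  measurable_fun [set: T] (fun w => f w + g w).
Proof. exact: measurable_funD. Qed.
Let mM (f g : T -> R) : measurable_fun [set: T] f -> measurable_fun [set: T] g ->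
  measurable_fun [set: T] (fun w => f w * g w).
Proof. exact: measurable_funM. Qed.

Lemma cmeasurable_cst c : cmeasurable (fun=> c).
Proof. exact: (complex_class_cst mcst). Qed.

Lemma cmeasurable_real (f : T -> R) : measurable_fun [set: T] f ->
  cmeasurable (fun w => (f w)%:C).
Proof. by move=> mf; split => //=; exact: measurable_cst. Qed.

Lemma cmeasurableD f g : cmeasurable f -> cmeasurable g ->
  cmeasurable (fun w => f w + g w).
Proof. exact: (complex_classD mD). Qed.

Lemma cmeasurableM f g : cmeasurable f -> cmeasurable g ->
  cmeasurable (fun w => f w * g w).
Proof. exact: (complex_classM mcst mD mM). Qed.

Lemma cmeasurableB f g : cmeasurable f -> cmeasurable g ->
  cmeasurable (fun w => f w - g w).
Proof. exact: (complex_classB mcst mD mM). Qed.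

Lemma cmeasurableV f : cmeasurable f -> cmeasurable (fun w => (f w)^-1).
Proof.
move=> [f1 f2].
have mn : measurable_fun [set: T] (fun w => (complex.Re (f w) ^+ 2 + complex.Im (f w) ^+ 2)^-1).
  apply: measurable_inv; first by move=> w; rewrite addr_ge0 ?sqr_ge0.
  by apply: measurable_funD; exact: measurable_funX.
split.
  rewrite (_ : (fun w => _) = (fun w => complex.Re (f w) *
      (complex.Re (f w) ^+ 2 + complex.Im (f w) ^+ 2)^-1)).
    exact: measurable_funM.
  by apply/funext => w; case: (f w).
rewrite (_ : (fun w => _) = (fun w => - (complex.Im (f w) *
      (complex.Re (f w) ^+ 2 + complex.Im (f w) ^+ 2)^-1))).
  by apply: measurable_funN; exact: measurable_funM.
by apply/funext => w; case: (f w).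
Qed.

Lemma cmeasurable_sum (I : Type) (s : seq I) (Q : pred I) (h : I -> T -> R[i]) :
  (forall i, Q i -> cmeasurable (h i)) -> cmeasurable (fun w => \sum_(i <- s | Q i) h i w).
Proof.
move=> hh; elim: s => [|i s IH].
  rewrite (_ : (fun w => _) = cst 0); first exact: cmeasurable_cst.
  by apply/funext => w; rewrite big_nil.
rewrite (_ : (fun w => _) = (fun w => (if Q i then h i w else 0) + \sum_(i <- s | Q i) h i w)).
  apply: cmeasurableD => //; case E : (Q i); first exact: hh.
  exact: cmeasurable_cst.
by apply/funext => w; rewrite big_cons; case: ifP; rewrite ?add0r.
Qed.

Lemma cmeasurable_prod (I : Type) (s : seq I) (h : I -> T -> R[i]) :
  (forall i, cmeasurable (h i)) -> cmeasurable (fun w => \prod_(i <- s) h i w).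
Proof.
move=> hh; elim: s => [|i s IH].
  rewrite (_ : (fun w => _) = cst 1); first exact: cmeasurable_cst.
  by apply/funext => w; rewrite big_nil.
rewrite (_ : (fun w => _) = (fun w => h i w * \prod_(i <- s) h i w)).
  exact: cmeasurableM.
by apply/funext => w; rewrite big_cons.
Qed.

Lemma measurable_normc f : cmeasurable f ->
  measurable_fun [set: T] (fun w => Normc.normc (f w)).
Proof. exact: (class_normc mD mM measurable_sqrt). Qed.

Lemma cmeasurable_det n (M : T -> 'M[R[i]]_n) :
  (forall i j, cmeasurable (fun w => M w i j)) -> cmeasurable (fun w => \det (M w)).
Proof.
move=> hM; rewrite /determinant; apply: cmeasurable_sum => s _.
apply: cmeasurableM; first exact: cmeasurable_cst.
by apply: cmeasurable_prod => i; exact: hM.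
Qed.

Lemma cmeasurable_invmx n (M : T -> 'M[R[i]]_n) i j :
  (forall w, M w \in unitmx) -> (forall i j, cmeasurable (fun w => M w i j)) ->
  cmeasurable (fun w => invmx (M w) i j).
Proof.
move=> uM hM; rewrite (_ : (fun w => _) = (fun w => (\det (M w))^-1 *
    ((-1) ^+ (j + i) * \det (row' j (col' i (M w)))))).
  apply: cmeasurableM; first by apply/cmeasurableV/cmeasurable_det.
  apply: cmeasurableM; first exact: cmeasurable_cst.
  apply: cmeasurable_det => k l.
  rewrite (_ : (fun w => _) = (fun w => M w (lift j k) (lift i l))); first exact: hM.
  by apply/funext => w; rewrite !mxE.
by apply/funext => w; rewrite /invmx uM !mxE.
Qed.

Lemma cmeasurable_ham n (A : rel 'I_n) (eps : R) (S : {set 'I_n})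
    (v : 'I_n -> T -> R) i j :
  (forall i, i \in S -> measurable_fun [set: T] (v i)) ->
  cmeasurable (fun w => ham A eps S (v ^~ w) i j).
Proof.
move=> mv; rewrite (_ : (fun w => _) = (fun w => if (i \in S) && (j \in S)
    then (- eps * (A i j)%:R + (i == j)%:R * v i w)%:C else 0)).
  case E : (i \in S) => /=; last exact: cmeasurable_cst.
  case: (j \in S); last exact: cmeasurable_cst.
  apply: cmeasurable_real; apply: measurable_funD; first exact: measurable_cst.
  by apply: measurable_funM; [exact: measurable_cst|exact: mv].
by apply/funext => w; rewrite !mxE.
Qed.

Lemma cmeasurable_green n (A : rel 'I_n) (eps : R) (S : {set 'I_n})
    (v : 'I_n -> T -> R) z x y : symmetric A -> complex.Im z != 0 ->
  (forall i, i \in S -> measurable_fun [set: T] (v i)) ->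
  cmeasurable (fun w => green A eps S (v ^~ w) z x y).
Proof.
move=> Asym hz mv; apply: cmeasurable_invmx => [w|i j]; first exact: green_unit.
rewrite (_ : (fun w => _) = (fun w => ham A eps S (v ^~ w) i j - z *+ (i == j))).
  by apply: cmeasurableB; [exact: cmeasurable_ham|exact: cmeasurable_cst].
by apply/funext => w; rewrite mxE [in X in _ + X]mxE [in X in _ - X]mxE.
Qed.

Lemma cmeasurable_green_shift n (A : rel 'I_n) (eps : R) (S : {set 'I_n})
    (v : 'I_n -> T -> R) z x : symmetric A -> complex.Im z != 0 ->
  (forall i, i \in S :\ x -> measurable_fun [set: T] (v i)) ->
  cmeasurable (fun w => green_shift A eps (v ^~ w) z S x).
Proof.
move=> Asym hz mv; apply: cmeasurableD; first exact: cmeasurable_cst.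
apply: cmeasurableM; first exact: cmeasurable_cst.
apply: cmeasurable_sum => u _; apply: cmeasurable_sum => u' _.
exact: cmeasurable_green.
Qed.
End ComplexMeasurable.

(** * A single Hoelder continuous variable: moments of order 1/2 *)

Section SingleSite.
Variables (R : realType) (mu : probability R R) (alpha K : R).
Hypotheses (alpha_gt : 1 / 2 < alpha) (K0 : 0 < K).
Hypothesis mu_holder : forall a t : R, 0 <= t -> t <= 1 ->
  (mu [set r : R | (a <= r <= a + t)%R] <= (K * t `^ alpha)%:E)%E.

Lemma cmeasurable_realB (b : R[i]) : cmeasurable (fun t : R => t%:C - b).
Proof.
apply: cmeasurableB; last exact: cmeasurable_cst.
by apply: cmeasurable_real; exact: measurable_id.
Qed.

Lemma measurable_normc_le (b : R[i]) (r : R) :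
  measurable [set t : R | Normc.normc (t%:C - b) <= r].
Proof.
rewrite -[X in measurable X]setTI.
apply: (measurable_fun_le measurableT (measurable_normc (cmeasurable_realB b))).
exact: measurable_cst.
Qed.

Lemma mu_normc_le (b : R[i]) (r : R) : 0 <= r -> 2 * r <= 1 ->
  (mu [set t : R | (Normc.normc (t%:C - b) <= r)%R] <= (K * (2 * r) `^ alpha)%:E)%E.
Proof.
move=> r0 r1; apply: le_trans (mu_holder (complex.Re b - r) _ r1); last lra.
apply: le_measure; rewrite ?inE; first exact: measurable_normc_le.
  rewrite [X in measurable X](_ : _ =
      `[complex.Re b - r, complex.Re b - r + 2 * r]%classic).
    exact: measurable_itv.
  by apply/seteqP; split => t /=; rewrite in_itv.
move=> t /= ht.
have : `|t - complex.Re b| <= r.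
  apply: le_trans ht; case: (b) => x y /=.
  by rewrite -[leLHS]sqrtr_sqr ler_wsqrtr // lerDl sqr_ge0.
by rewrite ler_norml => /andP[h1 h2]; apply/andP; split; lra.
Qed.

Let q : R := Num.sqrt 2 * 2 `^ (- alpha).
(** On the dyadic shell [2^(-k-2) < |t - b| <= 2^(-k-1)], of probability at most [K 2^(-alpha k)],
    the integrand is at most [2 * sqrt(2)^k]. These contributions form a geometric series of ratio
    [q], which is below 1 because [alpha > 1/2]; the leading 2 covers [|t - b| >= 1/2]. *)
Definition half_moment : R := 2 + 2 * K / (1 - q).

Lemma half_ratio_bounds : 0 < q < 1.
Proof.
have s2 : Num.sqrt 2 = 2 `^ (2^-1) :> R by rewrite powR12_sqrt.
rewrite /q s2 -powRD ?pnatr_eq0 ?implybT //.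
rewrite powR_gt0 //= /powR pnatr_eq0 /= expR_lt1 pmulr_llt0; last first.
  by rewrite ln_gt0 // ltr1n.
by have := alpha_gt; lra.
Qed.

Lemma half_moment_ge1 : 1 <= half_moment.
Proof.
have /andP[q0 q1] := half_ratio_bounds; rewrite /half_moment.
by have : 0 <= 2 * K / (1 - q); [rewrite divr_ge0 ?mulr_ge0 ?(ltW K0) //; lra|lra].
Qed.

(** [k] is the least index with [2 ^- k.+2 < c], so that minimality yields [c <= 2 ^- k.+1]; at
    [k = 0] this is the case assumption [c < 1/2]. *)
Lemma sqrt_inv_dyadic (c : R) : 0 < c -> Num.sqrt c^-1 <= 2 \/
  exists k : nat, c <= 2 ^- k.+1 /\ Num.sqrt c^-1 <= 2 * Num.sqrt 2 ^+ k.
Proof.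
move=> c0; have [c1|c1] := leP (1 / 2) c.
  left; have -> : 2 = Num.sqrt (2 ^+ 2) :> R by rewrite sqrtr_sqr ger0_norm.
  rewrite ler_wsqrtr // -[leRHS]invrK lef_pV2 ?posrE ?invr_gt0 ?exprn_gt0 //.
  by apply: le_trans c1; rewrite div1r lef_pV2 ?posrE ?exprn_gt0 // expr2; lra.
right; have ex : exists k, 2 ^- k.+2 < c.
  have [m hm] : exists m : nat, c^-1 < m%:R.
    by exists (Num.truncn c^-1).+1; rewrite truncnS_gt.
  exists m; rewrite -[ltRHS]invrK ltf_pV2 ?posrE ?invr_gt0 ?exprn_gt0 //.
  apply: lt_le_trans hm _; rewrite -natrX ler_nat.
  by apply: leq_trans (ltnW (ltn_expl m (leqnn 2))) _; rewrite leq_exp2l // leqW.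
case: (ex_minnP ex) => k hk hmin; exists k; split.
  case: k hk hmin => [|k] hk hmin; first by rewrite expr1; lra.
  by rewrite leNgt; apply/negP => /hmin; rewrite ltnn.
have -> : 2 * Num.sqrt 2 ^+ k = Num.sqrt (2 ^+ k.+2) :> R.
  have e2 : 2 = Num.sqrt (2 ^+ 2) :> R by rewrite sqrtr_sqr ger0_norm.
  elim: k {hk hmin} => [|k IH]; first by rewrite expr0 mulr1.
  by rewrite exprS mulrCA IH [in RHS]exprS sqrtrM.
by rewrite ler_wsqrtr // -[leRHS]invrK lef_pV2 ?posrE ?invr_gt0 ?exprn_gt0 // ltW.
Qed.

(** Pointwise domination by 2 plus the dyadic series, integrated term by term. The bound is the same
    for all [b] off the real axis, however close. *)
Lemma half_moment_le (b : R[i]) : complex.Im b != 0 ->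
  (\int[mu]_t (Num.sqrt (Normc.normc (t%:C - b))^-1)%R%:E <= half_moment%:E)%E.
Proof.
move=> hb; have /andP[q0 q1] := half_ratio_bounds.
pose Ak k := [set t : R | Normc.normc (t%:C - b) <= 2 ^- k.+1].
pose h k (t : R) : \bar R := ((2 * Num.sqrt 2 ^+ k) * \1_(Ak k) t)%:E.
have mh k : measurable_fun [set: R] (h k).
  apply/measurable_EFinP; apply: measurable_funM; first exact: measurable_cst.
  by apply: measurable_indic; exact: measurable_normc_le.
have c0 k : 0 <= 2 * Num.sqrt 2 ^+ k :> R by rewrite mulr_ge0 ?exprn_ge0.
have h0 k t : (0 <= h k t)%E by rewrite lee_fin mulr_ge0.
apply: (@le_trans _ _ (\int[mu]_t (2%:E + \sum_(k <oo) h k t))%E).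
  apply: ge0_le_integral => //.
  - apply/measurable_EFinP/measurable_sqrt/measurable_inv.
      by move=> t; case: (_ - _) => ? ? /=; rewrite sqrtr_ge0.
    exact/measurable_normc/cmeasurable_realB.
  - apply: emeasurable_funD; first exact: measurable_cst.
    by apply: ge0_emeasurable_sum.
  - move=> t _; have c_gt0 : 0 < Normc.normc (t%:C - b).
      case: b hb {Ak h mh h0} => x y /= y0; rewrite sqrtr_gt0.
      by rewrite ltr_wpDl ?sqr_ge0 // exprn_even_gt0 //= sub0r oppr_eq0.
    have s0 : (0 <= \sum_(k <oo) h k t)%E by apply: nneseries_ge0.
    have [h2|[k [hk1 hk2]]] := sqrt_inv_dyadic c_gt0.
      by apply: (@le_trans _ _ 2%:E); rewrite ?lee_fin // leeDl.
    apply: (@le_trans _ _ (h k t)).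
      by rewrite lee_fin indicE mem_set ?mulr1.
    apply: (@le_trans _ _ (\sum_(k <oo) h k t)%E); last first.
      by rewrite leeDr // lee_fin.
    rewrite (@nneseriesD1 _ _ k) // leeDl //; exact: nneseries_ge0.
rewrite ge0_integralD //; last 2 first.
  - by move=> t _; apply: nneseries_ge0.
  - by apply: ge0_emeasurable_sum.
have -> : (\int[mu]_t (2%:E : \bar R) = 2%:E)%E.
  have mu1 : (mu [set: R] = 1)%E by exact: probability_setT.
  apply: (etrans (integral_cst mu measurableT 2%:E)).
  exact: (etrans (congr1 (fun m => 2%:E * m)%E mu1) (mule1 _)).
suff hs : (\int[mu]_t \sum_(k <oo) h k t <= (2 * K / (1 - q))%R%:E)%E.
  by rewrite /half_moment [leRHS]EFinD; exact: (@leeD _ 2%:E).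
rewrite integral_nneseries //.
apply: lime_le; first by apply: is_cvg_nneseries => k _ _; apply: integral_ge0.
apply: nearW => m.
apply: (@le_trans _ _ (\sum_(0 <= k < m) (2 * K * q ^+ k)%:E)%E).
  apply: lee_sum => k _; rewrite /h.
  under eq_integral do rewrite EFinM.
  rewrite ge0_integralZl_EFin //; last first.
    by apply/measurable_EFinP/measurable_indic; exact: measurable_normc_le.
  rewrite integral_indic //; last exact: measurable_normc_le.
  rewrite setIT; apply: (@le_trans _ _ ((2 * Num.sqrt 2 ^+ k)%:E * (K * (2 * 2 ^- k.+1) `^ alpha)%:E)%E).
    rewrite lee_wpmul2l ?lee_fin //; apply: mu_normc_le => //.
    by rewrite exprS invfM mulVKf // invf_le1 ?exprn_gt0 // exprn_ege1 // ler1n.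
  rewrite -EFinM lee_fin; have -> : 2 * 2 ^- k.+1 = 2 ^- k :> R.
    by rewrite exprS invfM mulVKf.
  have -> : (2 ^- k) `^ alpha = (2 `^ (- alpha)) ^+ k :> R.
    rewrite -[2 ^+ k]powR_mulrn // -[_^-1]powR_inv1 ?powR_ge0 // -!powRrM.
    rewrite -[RHS]powR_mulrn ?powR_ge0 // -powRrM.
    by congr (_ `^ _); ring.
  rewrite /q exprMn le_eqVlt; apply/orP; left; apply/eqP; ring.
rewrite sumEFin lee_fin -mulr_sumr ler_wpM2l ?mulr_ge0 ?(ltW K0) //.
rewrite -[(1 - q)^-1]mul1r ler_pdivlMr ?subr_gt0 // mulrC.
have -> : (1 - q) * \sum_(0 <= i < m) q ^+ i = 1 - q ^+ m.
  elim: m => [|m IH]; first by rewrite big_geq // mulr0 expr0 subrr.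
  by rewrite big_nat_recr //= mulrDr IH exprS; ring.
by rewrite lerBlDr lerDl exprn_ge0 // ltW.
Qed.
End SingleSite.

Lemma measure_exists_le (R : realType) (d : measure_display) (T : measurableType d)
    (P : {measure set T -> \bar R}) (I : finType) (E : I -> set T) (c : R) :
  (forall i, measurable (E i)) -> (forall i, (P (E i) <= c%:E)%E) ->
  measurable [set w | exists i, E i w] /\
  (P [set w | exists i, E i w] <= (#|I|%:R * c)%:E)%E.
Proof.
move=> mE hE.
have eqE : [set w | exists i, E i w] = \big[setU/set0]_(i <- enum I) E i.
  rewrite -bigcup_seq; apply/seteqP; split=> w /=.
    by move=> [i Ei]; exists i => //=; rewrite mem_enum.
  by move=> [i _ Ei]; exists i.
rewrite eqE cardE; elim: (enum I) => [|i s [IH1 IH2]].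
  by rewrite big_nil measure0 mul0r.
rewrite big_cons; split; first exact: measurableU.
apply: le_trans (measureU2 _ _ _) _ => //.
by rewrite /= -natr1 mulrDl mul1r addrC EFinD; apply: leeD.
Qed.

(** * Probabilistic estimates for the resolvent *)

Section Moments.
Context (R : realType) (dT : measure_display) (T : measurableType dT).
Variables (P : probability T R) (mu : probability R R) (n : nat) (alpha K : R).
Hypotheses (alpha_gt : 1 / 2 < alpha) (K0 : 0 < K).
Hypothesis mu_holder : forall a t : R, 0 <= t -> t <= 1 ->
  (mu [set r : R | (a <= r <= a + t)%R] <= (K * t `^ alpha)%:E)%E.
Variables (v : 'I_n -> T -> R).
Hypothesis mv : forall i, measurable_fun setT (v i).
Hypothesis v_law : forall i (B : set R), measurable B -> P (v i @^-1` B) = mu B.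
Hypothesis v_ind : forall B : 'I_n -> set R, (forall i, measurable (B i)) ->
  P [set w | forall i, B i (v i w)] = (\prod_i P (v i @^-1` B i))%E.
Variables (A : rel 'I_n) (eps : R).
Hypotheses (A_sym : symmetric A) (A_irr : irreflexive A) (eps0 : 0 < eps).
Local Notation sT := (finset.setTfor 'I_n).
Implicit Types (S : {set 'I_n}) (x y u : 'I_n).

(** Given the other sites, [v x] lies within [r] of [b] with probability at most [K (2 r)^alpha].
    The event [B] is carried along so that a second resonance, decided by the other sites,
    multiplies the bound. *)
Lemma single_site x (b : off_type v x -> R[i]) (B : set (off_type v x)) (r : R) :
  cmeasurable b -> measurable B -> 0 <= r -> 2 * r <= 1 ->
  (P ([set w | (Normc.normc ((v x w)%:C - b w) <= r)%R] `&` B) <=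
     (K * (2 * r) `^ alpha)%:E * P B)%E.
Proof.
move=> [b1 b2] mB r0 r1.
pose E : set (R * off_type v x) :=
  [set p | (Normc.normc (p.1%:C - b p.2) <= r)%R] `&` (snd @^-1` B).
have mE : measurable E.
  apply: measurableI.
    rewrite -[X in measurable X]setTI.
    apply: (measurable_fun_le measurableT); last exact: measurable_cst.
    apply: measurable_normc; apply: cmeasurableB.
      by apply: cmeasurable_real; exact: measurable_fst.
    by split; [apply: (measurableT_comp b1)|apply: (measurableT_comp b2)];
      exact: measurable_snd.
  by rewrite -[X in measurable X]setTI; exact: measurable_snd.
have mBT : measurable (B : set T).
  by have := measurable_to_off (x := x) mv measurableT mB; rewrite setTI.
have mET : measurable ((fun w => (v x w, to_off v x w)) @^-1` E).
  rewrite -[X in measurable X]setTI.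
  by apply: measurable_fun_pair => //; exact: measurable_to_off.
have := resample mv v_law v_ind (f := fun p => (\1_E p : R)%:E).
have h0 (p : R * off_type v x) : (0 <= (\1_E p : R)%:E)%E by rewrite lee_fin.
have mE1 : measurable_fun [set: R * off_type v x] (fun p => (\1_E p : R)%:E).
  by apply/measurable_EFinP; exact: measurable_indic.
move=> /(_ mE1 h0).
have -> : (\int[P]_w (\1_E (v x w, to_off v x w) : R)%:E =
   P ([set w | (Normc.normc ((v x w)%:C - b w) <= r)%R] `&` B))%E.
  transitivity (\int[P]_w (\1_((fun w => (v x w, to_off v x w)) @^-1` E) w)%:E)%E.
    by apply: eq_integral => w _; rewrite !indicE.
  by rewrite integral_indic // setIT.
move=> ->.
apply: (@le_trans _ _ (\int[P]_w ((K * (2 * r) `^ alpha)%:E * (\1_(B : set T) w)%:E))%E).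
  have mG : measurable_fun [set: T] (fun w : T => (K * (2 * r) `^ alpha)%:E * (\1_(B : set T) w)%:E)%E.
    apply/measurable_funeM/measurable_EFinP; exact: measurable_indic.
  apply: ge0_le_integral => //.
  - by move=> w _; apply: integral_ge0.
  - have mF : measurable_fun [set: off_type v x] (fun w => \int[mu]_t (\1_E (t, w) : R)%:E)%E.
      exact: (@measurable_fun_fubini_tonelli_G _ _ _ (off_type v x) R mu (fun p => (\1_E p : R)%:E)).
    exact: (measurableT_comp mF (measurable_to_off (x := x) mv)).
  - move=> w _.
    have [wB|wB] := pselect (B w).
      rewrite [X in (_ * X)%E](_ : _ = 1%E) ?mule1; last by rewrite indicE mem_set.
      apply: le_trans (mu_normc_le mu_holder (b w) r0 r1).
      set N := [set t | _].
      have -> : (mu N = \int[mu]_t (\1_N t : R)%:E)%E.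
        by rewrite integral_indic ?setIT //; exact: measurable_normc_le.
      rewrite le_eqVlt; apply/orP; left; apply/eqP; apply: eq_integral => t _.
      rewrite !indicE; congr ((nat_of_bool _)%:R%:E); apply/idP/idP; rewrite !inE.
        by case.
      by move=> h; split.
    rewrite (eq_integral (cst 0%E)); first by rewrite integral0 mule_ge0 // lee_fin ?mulr_ge0 ?powR_ge0 ?(ltW K0).
    by move=> t _; rewrite indicE memNset // => -[].
rewrite ge0_integralZl_EFin //.
- by rewrite integral_indic // setIT.
- by apply/measurable_EFinP; exact: measurable_indic.
- by rewrite mulr_ge0 ?powR_ge0 ?(ltW K0).
Qed.

(** * Exponential decay of fractional moments *)

Section Green.
Variable z : R[i].
Hypothesis hz : complex.Im z != 0.

(** [green_shift] does not see [v x]. Were it real, choosing [v x] equal to it would make the second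
    factor in [green_diag] vanish, although the product is 1. *)
Lemma Im_green_shift S x w : x \in S ->
  complex.Im (green_shift A eps (v ^~ w) z S x) != 0.
Proof.
move=> xS; set b := green_shift _ _ _ _ _ _; apply/negP => /eqP hb.
pose v' i := if i == x then complex.Re b else v i w.
have := green_diag eps A_sym A_irr v' hz xS.
have -> : green_shift A eps v' z S x = b.
  by apply: green_shift_eq => i ix; rewrite /v' (negbTE ix).
have -> : (v' x)%:C - b = 0.
  have hb' : b = (complex.Re b)%:C.
    by rewrite [LHS]complexE hb rmorph0 mulr0 addr0.
  by rewrite /v' eqxx -hb' subrr.
by rewrite mulr0 => /eqP; rewrite eq_sym oner_eq0.
Qed.

Lemma cmeasurable_off_green S x (z' : R[i]) u y : complex.Im z' != 0 -> x \notin S ->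
  cmeasurable (fun w : off_type v x => green A eps S (v ^~ w) z' u y).
Proof.
move=> hz' xS; apply: cmeasurable_green => // i iS.
by apply: measurable_off_coord; apply: contraNneq xS => <-.
Qed.

Lemma cmeasurable_off_shift S x :
  cmeasurable (fun w : off_type v x => green_shift A eps (v ^~ w) z S x).
Proof.
apply: cmeasurable_green_shift => // i; rewrite !inE => /andP[ix _].
exact: measurable_off_coord.
Qed.

(** [Y] does not depend on [v x], so it comes out of the average over [v x]; the remaining factor is
    [|v x - green_shift|^(-1/2)], which [half_moment_le] controls. *)
Lemma half_moment_green S x (Y : off_type v x -> \bar R) : x \in S ->
  measurable_fun [set: off_type v x] Y -> (forall w, (0 <= Y w)%E) ->
  (\int[P]_w ((Num.sqrt (Normc.normc (green A eps S (v ^~ w) z x x)))%R%:E * Y w) <=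
     (half_moment alpha K)%:E * \int[P]_w Y w)%E.
Proof.
move=> xS mY Y0.
pose b (w : off_type v x) := green_shift A eps (v ^~ w) z S x.
have mb : cmeasurable b by exact: cmeasurable_off_shift.
pose h (p : R * off_type v x) : R := Num.sqrt (Normc.normc (p.1%:C - b p.2))^-1.
have mh : measurable_fun [set: R * off_type v x] h.
  apply/measurable_sqrt/measurable_inv.
    by move=> p; case: (_ - _) => ? ? /=; rewrite sqrtr_ge0.
  apply: measurable_normc; apply: cmeasurableB.
    by apply: cmeasurable_real; exact: measurable_fst.
  by case: mb => b1 b2; split; [apply: (measurableT_comp b1)|apply: (measurableT_comp b2)];
      exact: measurable_snd.
have mYT : measurable_fun [set: T] (Y : T -> \bar R).
  exact: (measurableT_comp mY (measurable_to_off (x := x) mv)).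
pose f p := ((h p)%:E * Y p.2)%E.
have mf : measurable_fun [set: R * off_type v x] f.
  apply: emeasurable_funM; first exact/measurable_EFinP.
  exact: (measurableT_comp mY measurable_snd).
have f0 p : (0 <= f p)%E by rewrite mule_ge0 // lee_fin sqrtr_ge0.
have -> : (\int[P]_w ((Num.sqrt (Normc.normc (green A eps S (v ^~ w) z x x)))%R%:E * Y w) =
   \int[P]_w f (v x w, to_off v x w))%E.
  apply: eq_integral => w _; rewrite /f /h /=.
  by rewrite (green_diag_norm eps A_sym A_irr (v ^~ w) hz xS).
rewrite (resample mv v_law v_ind mf f0).
have mC : (0 <= (half_moment alpha K)%:E)%E.
  by rewrite lee_fin (le_trans ler01) // half_moment_ge1.
rewrite -ge0_integralZl //.
apply: ge0_le_integral => //.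
- by move=> w _; apply: integral_ge0.
- have mF : measurable_fun [set: off_type v x] (fun w => \int[mu]_t f (t, w))%E.
    exact: (@measurable_fun_fubini_tonelli_G _ _ _ (off_type v x) R mu f).
  exact: (measurableT_comp mF (measurable_to_off (x := x) mv)).
- exact: measurable_funeM.
- move=> w _; rewrite /f /=.
  have mhw : measurable_fun [set: R] (fun t => (h (t, to_off v x w))%:E).
    by apply/measurable_EFinP; exact: (measurable_fun_pair1 _ mh).
  under eq_integral do rewrite muleC.
  rewrite ge0_integralZl //; last by move=> t _; rewrite lee_fin sqrtr_ge0.
  rewrite muleC lee_wpmul2r //.
  have hm := half_moment_le alpha_gt K0 mu_holder (Im_green_shift w xS).
  exact: hm.
Qed.

Variables (rho : 'I_n -> 'I_n -> R) (D : nat).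
Hypotheses (rho_diag : forall x, rho x x = 0)
  (rho_step : forall x u y, A x u -> rho x y <= rho u y + 1)
  (A_deg : forall x, (#|A x| <= D)%N)
  (small : D%:R * Num.sqrt eps * half_moment alpha K * expR 2 <= 1).

Lemma sqrt_normc_sum (I : finType) (Q : pred I) (a : I -> R[i]) :
  Num.sqrt (Normc.normc (\sum_(i | Q i) a i)) <=
  \sum_i (if Q i then Num.sqrt (Normc.normc (a i)) else 0).
Proof.
rewrite -big_mkcond /=.
apply: (big_ind2 (fun (s : R[i]) (t : R) => Num.sqrt (Normc.normc s) <= t)) => //.
  by rewrite Normc.normc0 sqrtr0.
have n0 (y : R[i]) : 0 <= Normc.normc y by case: y => ? ? /=; rewrite sqrtr_ge0.
move=> x1 x2 y1 y2 h1 h2; apply: le_trans (lerD h1 h2).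
rewrite -(@ler_pXn2r _ 2) ?nnegrE ?addr_ge0 ?sqrtr_ge0 //.
rewrite sqrrD !sqr_sqrtr // -addrA [X in _ <= _ + X]addrC addrA.
apply: le_trans (le_normcD _ _) _.
by rewrite lerDl mulrn_wge0 // mulr_ge0 ?sqrtr_ge0.
Qed.

Lemma measurable_sqrt_green S u y :
  measurable_fun [set: T] (fun w => Num.sqrt (Normc.normc (green A eps S (v ^~ w) z u y))).
Proof. by apply/measurable_sqrt/measurable_normc/cmeasurable_green. Qed.

(** Induction on the number of sites. One removal costs [sqrt eps] for the hop, [half_moment] for
    the average over [v x], [D] for the neighbours and [expR 2] for the unit by which [rho] may
    drop; [small] says that the product is at most 1, so the constant does not grow along the
    induction. *)
Lemma fractional_moment S x y : x \in S -> y \in S ->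
  (\int[P]_w (Num.sqrt (Normc.normc (green A eps S (v ^~ w) z x y)))%R%:E <=
    (half_moment alpha K * expR (- 2 * rho x y))%:E)%E.
Proof.
have C1 := half_moment_ge1 alpha_gt K0; set C := half_moment alpha K in C1 *.
have C0 : 0 <= C by lra.
have [m] := ubnP #|S|; elim: m S x y => // m IH S x y hm xS yS.
have [->|yx] := eqVneq y x.
  rewrite rho_diag mulr0 expR0 mulr1.
  have /(_ xS) := @half_moment_green S x (cst 1%E).
  under eq_integral do rewrite mule1.
  have mcst : measurable_fun [set: off_type v x] (cst 1%E : off_type v x -> \bar R).
    exact: measurable_cst.
  have c0 : forall w : off_type v x, (0 <= (cst 1%E : off_type v x -> \bar R) w)%E.
    by move=> w; exact: lee01.
  move=> h; apply: le_trans (h mcst c0) _.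
  rewrite (_ : (\int[P]_w cst 1%E w = 1%E)%E) ?mule1 //.
  by apply: (etrans (integral_cst P measurableT 1%E)); rewrite mul1e; exact: probability_setT.
set S' := S :\ x.
pose a u w := if (u \in S') && A x u
  then Num.sqrt (Normc.normc (green A eps S' (v ^~ w) z u y)) else 0.
have a0 u w : 0 <= a u w by rewrite /a; case: ifP; rewrite ?sqrtr_ge0.
have xS' : x \notin S' by rewrite /S' !inE eqxx.
have ma u : measurable_fun [set: T] (a u).
  rewrite /a; case: ((u \in S') && A x u); last exact: measurable_cst.
  exact: measurable_sqrt_green.
have maO u : measurable_fun [set: off_type v x] (a u : off_type v x -> R).
  rewrite /a; case: ((u \in S') && A x u); last exact: measurable_cst.
  by apply/measurable_sqrt/measurable_normc/cmeasurable_off_green.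
pose Y w := (\sum_u a u w)%:E.
apply: (@le_trans _ _ (\int[P]_w ((Num.sqrt eps)%:E *
   ((Num.sqrt (Normc.normc (green A eps S (v ^~ w) z x x)))%R%:E * Y w)))%E).
  apply: ge0_le_integral => //.
  - exact/measurable_EFinP/measurable_sqrt_green.
  - apply/measurable_funeM/emeasurable_funM.
      exact/measurable_EFinP/measurable_sqrt_green.
    by apply/measurable_EFinP; exact: measurable_sum.
  - move=> w _; rewrite (green_step eps A_sym (v ^~ w) hz xS yx).
    rewrite -!EFinM lee_fin !Normc.normcM.
    have n0 (t : R[i]) : 0 <= Normc.normc t by case: t => ? ? /=; rewrite sqrtr_ge0.
    have -> : Normc.normc eps%:C = eps by rewrite /= expr0n addr0 sqrtr_sqr gtr0_norm.
    rewrite !sqrtrM ?mulr_ge0 ?(ltW eps0) // -mulrA !ler_wpM2l ?sqrtr_ge0 //.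
    exact: sqrt_normc_sum.
have mYO : measurable_fun [set: off_type v x] (Y : off_type v x -> \bar R).
  by apply/measurable_EFinP; exact: measurable_sum.
have Y0 w : (0 <= Y w)%E by rewrite lee_fin sumr_ge0.
have mGY : measurable_fun [set: T] (fun w =>
    (Num.sqrt (Normc.normc (green A eps S (v ^~ w) z x x)))%R%:E * Y w)%E.
  apply: emeasurable_funM; first exact/measurable_EFinP/measurable_sqrt_green.
  by apply/measurable_EFinP; exact: measurable_sum.
rewrite ge0_integralZl_EFin ?sqrtr_ge0 //; last first.
  by move=> w _; rewrite mule_ge0 // lee_fin sqrtr_ge0.
apply: (@le_trans _ _ ((Num.sqrt eps)%:E * (C%:E * \int[P]_w Y w))%E).
  by rewrite lee_wpmul2l ?lee_fin ?sqrtr_ge0 //; exact: half_moment_green.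
have hY : (\int[P]_w Y w <= (D%:R * (C * (expR 2 * expR (- 2 * rho x y))))%:E)%E.
  have -> : (\int[P]_w Y w = \sum_u \int[P]_w (a u w)%:E)%E.
    rewrite -ge0_integral_sum //.
    - by apply: eq_integral => w _; rewrite /Y sumEFin.
    - by move=> u; exact/measurable_EFinP.
    - by move=> u w _; rewrite lee_fin.
  apply: (@le_trans _ _ (\sum_u (if A x u then C * (expR 2 * expR (- 2 * rho x y)) else 0)%:E)%E).
    apply: lee_sum => u _; rewrite /a.
    case uS : (u \in S') => /=; last first.
      rewrite integral0 lee_fin; case: ifP => // _.
      by rewrite !mulr_ge0 ?expR_ge0.
    case Au : (A x u); last by rewrite integral0.
    apply: le_trans (IH _ _ _ _ uS _) _.
    - by move: hm; rewrite (cardsD1 x S) xS add1n ltnS.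
    - by rewrite /S' !inE yx yS.
    - rewrite lee_fin ler_wpM2l // -expRD ler_expR.
      by have := rho_step y Au; lra.
  rewrite sumEFin lee_fin -big_mkcond /= sumr_const -[leLHS]mulr_natl ler_wpM2r ?mulr_ge0 ?expR_ge0 //.
  by rewrite ler_nat; exact: A_deg.
apply: (@le_trans _ _ ((Num.sqrt eps)%:E * (C%:E * (D%:R * (C * (expR 2 * expR (- 2 * rho x y))))%:E))%E).
  by rewrite !lee_wpmul2l ?lee_fin ?sqrtr_ge0.
rewrite -!EFinM lee_fin.
have -> : Num.sqrt eps * (C * (D%:R * (C * (expR 2 * expR (- 2 * rho x y))))) =
  (D%:R * Num.sqrt eps * C * expR 2) * (C * expR (- 2 * rho x y)) by ring.
by rewrite ler_piMl // mulr_ge0 ?expR_ge0.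
Qed.

(** Markov's inequality for the square root: its moment, of order [e^(-2 rho)], is divided by the
    threshold [e^(-rho)]. *)
Lemma green_large_prob x y :
  measurable [set w | expR (- 2 * rho x y) < Normc.normc (green A eps sT (v ^~ w) z x y)] /\
  (P [set w | (expR (- 2 * rho x y) < Normc.normc (green A eps sT (v ^~ w) z x y))%R] <=
    (half_moment alpha K * expR (- rho x y))%:E)%E.
Proof.
set E := [set w | _]; set g := fun w => Normc.normc (green A eps sT (v ^~ w) z x y).
have mE : measurable E.
  have -> : E = ~` ([set: T] `&` [set w | g w <= expR (- 2 * rho x y)]).
    by apply/seteqP; split=> w; rewrite setTI /E /= ltNge => /negP.
  apply: measurableC; apply: (measurable_fun_le measurableT); last exact: measurable_cst.
  exact/measurable_normc/cmeasurable_green.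
split => //.
have mg : measurable_fun [set: T] (fun w => (Num.sqrt (g w))%:E).
  exact/measurable_EFinP/measurable_sqrt_green.
have -> : (P E = \int[P]_w (\1_E w : R)%:E)%E by rewrite integral_indic // setIT.
apply: (@le_trans _ _ (\int[P]_w ((expR (rho x y))%:E * (Num.sqrt (g w))%:E))%E).
  apply: ge0_le_integral => //.
  - by apply/measurable_EFinP; exact: measurable_indic.
  - exact: measurable_funeM.
  - move=> w _; rewrite -EFinM lee_fin indicE.
    have [wE|_] := boolP (w \in E); last by rewrite mulr_ge0 ?expR_ge0 ?sqrtr_ge0.
    rewrite -[leLHS](mulVr (x := expR (- rho x y))) ?unitfE ?gt_eqF ?expR_gt0 //.
    rewrite -expRN opprK ler_wpM2l ?expR_ge0 //.
    rewrite -[leLHS]ger0_norm ?expR_ge0 // -sqrtr_sqr ler_wsqrtr //.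
    move: wE; rewrite inE /E /= => /ltW; rewrite -/(g w) => h; apply: le_trans h.
    by rewrite expr2 -expRD ler_expR; lra.
rewrite ge0_integralZl_EFin ?expR_ge0 //.
apply: (@le_trans _ _ ((expR (rho x y))%:E * (half_moment alpha K * expR (- 2 * rho x y))%:E)%E).
  by rewrite lee_wpmul2l ?lee_fin ?expR_ge0 //; apply: fractional_moment; rewrite inE.
rewrite -EFinM lee_fin mulrCA ler_wpM2l //.
  by rewrite (le_trans ler01) // half_moment_ge1.
by rewrite -expRD ler_expR; lra.
Qed.
End Green.

(** * Double resonances *)

Section Wegner.
Variables (E delta : R).
Hypotheses (delta0 : 0 < delta) (n0 : (0 < n)%N) (delta_small : 16 * delta * n%:R <= 1).
Let z := E +i* delta.
Let Im_z : complex.Im z != 0. Proof. by rewrite /= gt_eqF. Qed.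
Let thr := (8 * delta * n%:R)^-1.
Let r0 : 0 <= 8 * delta * n%:R. Proof. by rewrite !mulr_ge0 ?(ltW delta0). Qed.
Let r1 : 2 * (8 * delta * n%:R) <= 1. Proof. by move: delta_small; lra. Qed.
(** A diagonal entry above [thr] puts [v x] within [8 * delta * n] of the Schur complement; [c] is
    the Hoelder bound for an interval of that radius, whose length is at most 1 by [delta_small]. *)
Let c := K * (2 * (8 * delta * n%:R)) `^ alpha.

Definition resonant (S : {set 'I_n}) : set T :=
  [set w | exists y, y \in S /\ thr <= Normc.normc (green A eps S (v ^~ w) z y y)].

Lemma green_diag_large S x w : x \in S ->
  thr <= Normc.normc (green A eps S (v ^~ w) z x x) ->
  Normc.normc ((v x w)%:C - green_shift A eps (v ^~ w) z S x) <= 8 * delta * n%:R.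
Proof.
move=> xS; rewrite (green_diag_norm eps A_sym A_irr (v ^~ w) Im_z xS) /thr.
have t0 : 0 < 8 * delta * n%:R by rewrite !mulr_gt0 ?ltr0n.
set N := Normc.normc _; have [N0|N0] := leP N 0; first by move=> _; exact: le_trans N0 _.
by rewrite lef_pV2 ?posrE.
Qed.

Lemma measurable_green_large S x : measurable [set w | x \in S /\
  thr <= Normc.normc (green A eps S (v ^~ w) z x x)].
Proof.
case xS : (x \in S); last first.
  by rewrite (_ : [set w | _] = set0) //; apply/seteqP; split => w //= [].
rewrite (_ : [set w | _] = [set: T] `&` [set w | thr <= Normc.normc (green A eps S (v ^~ w) z x x)]).
  apply: (measurable_fun_le measurableT); first exact: measurable_cst.
  exact/measurable_normc/cmeasurable_green.
by apply/seteqP; split => w /= [_ ?].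
Qed.

Lemma resonant_prob S : measurable (resonant S) /\ (P (resonant S) <= (n%:R * c)%:E)%E.
Proof.
rewrite -[X in X%:R * _]card_ord; apply: measure_exists_le => x.
  exact: measurable_green_large.
case xS : (x \in S); last first.
  set F := (fun w : T => false /\ _).
  have -> : F = set0 by apply/seteqP; split => w //= [].
  by rewrite measure0 lee_fin mulr_ge0 ?powR_ge0 ?(ltW K0).
have := single_site (cmeasurable_off_shift Im_z S x) measurableT r0 r1.
rewrite setIT probability_setT mule1; apply: le_trans; apply: le_measure; rewrite ?inE.
- by have := measurable_green_large S x; rewrite xS.
- rewrite -[X in measurable X]setTI.
  apply: (measurable_fun_le measurableT); last exact: measurable_cst.
  apply/measurable_normc/cmeasurableB; first exact: cmeasurable_real.
  by apply: cmeasurable_green_shift.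
- by move=> w /= [_]; exact: green_diag_large.
Qed.

(** For fixed [x], resonance of the box without [x] is an event of the other sites, of probability
    at most [n * c]; [single_site] charges another factor [c] for the entry at [x]. The union over
    [x] gives the outer [n]. *)
Lemma double_resonance_prob :
  measurable [set w | exists x, thr <= Normc.normc (green A eps sT (v ^~ w) z x x) /\
     resonant (sT :\ x) w] /\
  (P [set w | exists x, (thr <= Normc.normc (green A eps sT (v ^~ w) z x x))%R /\
     resonant (sT :\ x) w] <= (n%:R * (c * (n%:R * c)))%:E)%E.
Proof.
have mT x : measurable [set w | thr <= Normc.normc (green A eps sT (v ^~ w) z x x)].
  rewrite -[X in measurable X]setTI.
  apply: (measurable_fun_le measurableT); first exact: measurable_cst.
  exact/measurable_normc/cmeasurable_green.
rewrite -[X in X%:R * (_ * _)]card_ord; apply: measure_exists_le => x.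
  exact: (measurableI _ _ (mT x) (resonant_prob (sT :\ x)).1).
(* [single_site] asks for measurability in the smaller sigma-algebra off [x], which [resonant_prob]
   does not provide. *)
have mW : measurable (resonant (sT :\ x) : set (off_type v x)).
  rewrite (_ : resonant _ = \big[setU/set0]_(y <- enum 'I_n)
     [set w | y \in sT :\ x /\ thr <= Normc.normc (green A eps (sT :\ x) (v ^~ w) z y y)]); last first.
    rewrite -bigcup_seq; apply/seteqP; split=> w /=.
      by move=> [y Ey]; exists y => //=; rewrite mem_enum.
    by move=> [y _ Ey]; exists y.
  apply: bigsetU_measurable => y _.
  case xS : (y \in sT :\ x); last first.
    by rewrite (_ : [set w | _] = set0) //; apply/seteqP; split => w //= [].
  rewrite (_ : [set w | _] = [set: off_type v x] `&`
     [set w | thr <= Normc.normc (green A eps (sT :\ x) (v ^~ w) z y y)]).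
    apply: (measurable_fun_le measurableT); first exact: measurable_cst.
    by apply/measurable_normc/cmeasurable_off_green; rewrite ?inE ?eqxx.
  by apply/seteqP; split => w /= [_ ?].
have := single_site (cmeasurable_off_shift Im_z sT x) mW r0 r1.
move=> h; apply: (@le_trans _ _ (c%:E * P (resonant (sT :\ x)))%E).
  apply: le_trans h; apply: le_measure; rewrite ?inE.
  - exact: (measurableI _ _ (mT x) (resonant_prob (sT :\ x)).1).
  - apply: measurableI; last exact: (resonant_prob _).1.
    rewrite -[X in measurable X]setTI.
    apply: (measurable_fun_le measurableT); last exact: measurable_cst.
    apply/measurable_normc/cmeasurableB; first exact: cmeasurable_real.
    by apply: cmeasurable_green_shift.
  - by move=> w /= [h1 h2]; split => //; apply: green_diag_large; rewrite ?inE.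
have -> : (c * (n%:R * c))%:E = (c%:E * (n%:R * c)%:E)%E by rewrite -EFinM.
rewrite lee_wpmul2l ?lee_fin ?mulr_ge0 ?powR_ge0 ?(ltW K0) //.
exact: (resonant_prob _).2.
Qed.
End Wegner.
End Moments.

(** * Localization as a measurable condition on a matrix *)

Section LocalizingMatrix.
Variables (R : realType) (n : nat) (gap : R) (far : rel 'I_n) (bd : 'I_n -> 'I_n -> R).
Implicit Types (H U : 'M[R[i]]_n).

(** Row [x] of [U] is the eigenvector assigned to the centre [x]. For positive [gap], the condition
    on [l] carries both simplicity and separation of the eigenvalues. *)
Definition localizing_mx H := exists (U : 'M[R[i]]_n) (l : 'I_n -> R[i]),
  [/\ forall x x', \sum_y U x y * conjc (U x' y) = (x == x')%:R,
      forall x y, \sum_z H y z * U x z = l x * U x y,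
      forall x x', x != x' -> gap <= Normc.normc (l x - l x') &
      forall x y, far x y -> Normc.normc (U x y) <= bd x y].

(* Written with a square root so that it stays inside the function classes
   closed under constants, sums, products and square roots. *)
Definition excess (t : R) := t + Num.sqrt (t * t).

(** Expresses the eigenvalue through the eigenvector, so that the only unknown left is [U], which
    ranges over a bounded set. *)
Definition rayleigh H U x := \sum_y conjc (U x y) * \sum_z H y z * U x z.

Definition defect H U : R :=
  \sum_x \sum_x' Normc.normc (\sum_y U x y * conjc (U x' y) - (x == x')%:R) +
  \sum_x \sum_y Normc.normc (\sum_z H y z * U x z - rayleigh H U x * U x y) +
  \sum_x \sum_x' (x != x')%:R * excess (gap - Normc.normc (rayleigh H U x - rayleigh H U x')) +
  \sum_x \sum_y (far x y)%:R * excess (Normc.normc (U x y) - bd x y).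

Lemma excess_ge0 t : 0 <= excess t.
Proof.
rewrite /excess -expr2 sqrtr_sqr -lerBlDl sub0r; apply: le_trans (ler_norm _) _.
by rewrite normrN.
Qed.

Lemma excess_eq0 t : (excess t == 0) = (t <= 0).
Proof.
rewrite /excess -expr2 sqrtr_sqr; have [t0|t0] := leP t 0.
  by rewrite ler0_norm // subrr eqxx.
by rewrite gtr0_norm // gt_eqF // addr_gt0.
Qed.

Lemma normc_ge0 (c : R[i]) : 0 <= Normc.normc c.
Proof. by case: c => a b /=; rewrite sqrtr_ge0. Qed.

Let ge1 H U : 0 <= \sum_x \sum_x' Normc.normc (\sum_y U x y * conjc (U x' y) - (x == x')%:R).
Proof. by do 2!(apply: sumr_ge0 => ? _); exact: normc_ge0. Qed.
Let ge2 H U : 0 <= \sum_x \sum_y Normc.normc (\sum_z H y z * U x z - rayleigh H U x * U x y).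
Proof. by do 2!(apply: sumr_ge0 => ? _); exact: normc_ge0. Qed.
Let ge3 H U : 0 <= \sum_x \sum_x' (x != x')%:R * excess (gap - Normc.normc (rayleigh H U x - rayleigh H U x')).
Proof. by do 2!(apply: sumr_ge0 => ? _); rewrite mulr_ge0 ?excess_ge0. Qed.
Let ge4 U : 0 <= \sum_x \sum_y (far x y)%:R * excess (Normc.normc (U x y) - bd x y).
Proof. by do 2!(apply: sumr_ge0 => ? _); rewrite mulr_ge0 ?excess_ge0. Qed.

Lemma defect_ge0 H U : 0 <= defect H U.
Proof. exact: (addr_ge0 (addr_ge0 (addr_ge0 (ge1 H U) (ge2 H U)) (ge3 H U)) (ge4 U)). Qed.

Lemma sum2_eq0 (f : 'I_n -> 'I_n -> R) : (forall x y, 0 <= f x y) ->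
  \sum_x \sum_y f x y = 0 -> forall x y, f x y = 0.
Proof.
move=> f0 /eqP; rewrite psumr_eq0 => [/allP h x y|x _]; last exact: sumr_ge0.
have := h x (mem_index_enum _); rewrite /= psumr_eq0 => [/allP h2|? _]; last exact: f0.
by apply/eqP; exact: h2 (mem_index_enum _).
Qed.

Lemma defect_localizing H U : defect H U = 0 -> localizing_mx H.
Proof.
have g12 := addr_ge0 (ge1 H U) (ge2 H U).
have g123 := addr_ge0 g12 (ge3 H U).
rewrite /defect => /eqP; rewrite (paddr_eq0 g123 (ge4 U)) (paddr_eq0 g12 (ge3 H U)).
rewrite (paddr_eq0 (ge1 H U) (ge2 H U)).
move=> /andP[/andP[/andP[/eqP h1 /eqP h2] /eqP h3] /eqP h4].
exists U, (rayleigh H U); split=> [x x'|x y|x x' xx'|x y fxy].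
- have := sum2_eq0 (fun _ _ => normc_ge0 _) h1 x x' => /Normc.eq0_normc/eqP.
  by rewrite subr_eq0 => /eqP.
- have := sum2_eq0 (fun _ _ => normc_ge0 _) h2 x y => /Normc.eq0_normc/eqP.
  by rewrite subr_eq0 => /eqP.
- have := sum2_eq0 (fun x x' => mulr_ge0 (ler0n _ _) (excess_ge0 _)) h3 x x'.
  by move/eqP; rewrite xx' mul1r excess_eq0 subr_le0.
- have := sum2_eq0 (fun x x' => mulr_ge0 (ler0n _ _) (excess_ge0 _)) h4 x y.
  by move/eqP; rewrite fxy mul1r excess_eq0 subr_le0.
Qed.

Lemma localizing_defect H : localizing_mx H -> exists U, defect H U = 0 /\
  forall x y, `|complex.Re (U x y)| <= 1 /\ `|complex.Im (U x y)| <= 1.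
Proof.
move=> [U [l [h1 h2 h3 h4]]]; exists U.
have hl x : rayleigh H U x = l x.
  rewrite /rayleigh; under eq_bigr do rewrite h2 mulrCA.
  rewrite -mulr_sumr -[RHS]mulr1; congr (_ * _).
  by have := h1 x x; rewrite eqxx mulr1n => <-; apply: eq_bigr => y _; rewrite mulrC.
split.
  rewrite /defect !big1 ?addr0 // => x _; rewrite big1 // => y _.
  - have [fxy|_] := boolP (far x y); last by rewrite mul0r.
    by apply/eqP; rewrite mul1r excess_eq0 subr_le0 h4.
  - have [_|xy] := eqVneq x y; first by rewrite mul0r.
    by apply/eqP; rewrite mul1r excess_eq0 subr_le0 !hl h3.
  - by rewrite h2 hl subrr Normc.normc0.
  - by rewrite h1 subrr Normc.normc0.
move=> x y; suff h : complex.Re (U x y) ^+ 2 + complex.Im (U x y) ^+ 2 <= 1.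
  by split; rewrite -(@expr_le1 _ 2) // real_normK ?num_real //;
    apply: le_trans h; rewrite ?lerDl ?lerDr sqr_ge0.
have e : \sum_y (complex.Re (U x y) ^+ 2 + complex.Im (U x y) ^+ 2) = 1.
  have ex := h1 x x; rewrite eqxx mulr1n in ex.
  apply: (@complexI R); rewrite rmorph1 -ex rmorph_sum; apply: eq_bigr => k _ /=.
  by rewrite add_Re2_Im2 sqr_normc.
rewrite -e (bigD1 y) //= lerDl; apply: sumr_ge0 => k _.
by rewrite addr_ge0 ?sqr_ge0.
Qed.

Section Class.
Variables (T : Type) (Q : (T -> R) -> Prop).
Hypotheses (Qcst : forall c, Q (fun=> c))
  (QD : forall f g, Q f -> Q g -> Q (fun t => f t + g t))
  (QM : forall f g, Q f -> Q g -> Q (fun t => f t * g t))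
  (Qsqrt : forall f, Q f -> Q (fun t => Num.sqrt (f t))).
Variables (H U : T -> 'M[R[i]]_n).
Hypotheses (cH : forall x y, complex_class Q (fun t => H t x y))
  (cU : forall x y, complex_class Q (fun t => U t x y)).

Lemma class_excess (f : T -> R) : Q f -> Q (fun t => excess (f t)).
Proof. by move=> hf; apply: QD => //; apply: Qsqrt; exact: QM. Qed.

Lemma class_rayleigh x : complex_class Q (fun t => rayleigh (H t) (U t) x).
Proof.
apply: complex_class_sum => // y; apply: complex_classM => //.
  exact: complex_classJ.
by apply: complex_class_sum => // z; apply: complex_classM.
Qed.

Lemma class_defect : Q (fun t => defect (H t) (U t)).
Proof.
rewrite /defect; apply: QD; [apply: QD; [apply: QD|]|];
  do 2!(apply: class_sum => // ?).
- apply: (class_normc QD QM Qsqrt); apply: (complex_classB Qcst QD QM); last exact: (complex_class_cst Qcst).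
  apply: (complex_class_sum Qcst QD) => y; apply: (complex_classM Qcst QD QM) => //.
  exact: (complex_classJ Qcst QM).
- apply: (class_normc QD QM Qsqrt); apply: (complex_classB Qcst QD QM).
    by apply: (complex_class_sum Qcst QD) => z; apply: complex_classM.
  by apply: (complex_classM Qcst QD QM) => //; exact: class_rayleigh.
- apply: QM => //; apply: class_excess; apply: QD => //; apply: (class_opp Qcst QM).
  by apply: (class_normc QD QM Qsqrt); apply: (complex_classB Qcst QD QM); exact: class_rayleigh.
- apply: QM => //; apply: class_excess; apply: QD => //.
  exact: (class_normc QD QM Qsqrt).
Qed.
End Class.

Let N := #|{: 'I_n * 'I_n * bool}|.

Definition mx_of_row (v : 'rV[R]_N) : 'M[R[i]]_n :=
  \matrix_(x, y) (v 0 (enum_rank (x, y, false)) +i* v 0 (enum_rank (x, y, true))).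

Lemma defect_continuous H : continuous (fun v => defect H (mx_of_row v)).
Proof.
apply: (@class_defect _ (fun f : 'rV[R]_N -> R => continuous f)
   _ _ _ _ (fun=> H) mx_of_row).
- by move=> c v; exact: cst_continuous.
- by move=> f g hf hg v; apply: continuousD; [exact: hf|exact: hg].
- by move=> f g hf hg v; apply: continuousM; [exact: hf|exact: hg].
- move=> f hf v; apply: (@continuous_comp _ _ _ f Num.sqrt); first exact: hf.
  exact: sqrt_continuous.
- by move=> x y; split=> v; exact: cst_continuous.
- move=> x y; split=> v.
    rewrite (_ : (fun t => _) = (fun t : 'rV[R]_N => t 0 (enum_rank (x, y, false)))).
      exact: coord_continuous.
    by apply/funext => t; rewrite mxE.
  rewrite (_ : (fun t => _) = (fun t : 'rV[R]_N => t 0 (enum_rank (x, y, true)))).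
    exact: coord_continuous.
  by apply/funext => t; rewrite mxE.
Qed.

(** Rational matrices near a solution have small defect by continuity; since the entries of a
    solution have parts at most 1, the bound 2 leaves room for the approximation. Conversely, a
    positive minimum over the compact box would exceed some [1 / (k + 1)]. *)
Lemma localizing_mxP H : localizing_mx H <->
  forall k : nat, exists q : 'rV[rat]_N, (forall i, `|ratr (q 0 i) : R| <= 2) /\
    defect H (mx_of_row (map_mx ratr q)) < k.+1%:R^-1.
Proof.
split=> [/localizing_defect[U [dU bU]] k|hk].
  pose v0 : 'rV[R]_N := \row_i let: (x, y, b) := enum_val i in
    if b then complex.Im (U x y) else complex.Re (U x y).
  have hv0 : mx_of_row v0 = U.
    by apply/matrixP => x y; rewrite !mxE !enum_rankK; case: (U x y).
  have bv0 i : `|v0 0 i| <= 1.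
    by rewrite mxE; case: (enum_val i) => -[x y] [] ; have [] := bU x y.
  have k0 : 0 < k.+1%:R^-1 :> R by rewrite invr_gt0.
  have := @defect_continuous H v0; move/cvgrPdist_lt => /(_ _ k0).
  move=> /nbhs_ballP[e /= e0 he].
  have hq i : exists q : rat, `|v0 0 i - ratr q| < Num.min e 1.
    have m0 : 0 < Num.min e 1 by rewrite lt_min e0 ltr01.
    have [q] := @rat_in_itvoo R (v0 0 i - Num.min e 1) (v0 0 i + Num.min e 1) ltac:(lra).
    rewrite in_itv /= => /andP[q1 q2]; exists q.
    by rewrite ltr_norml; apply/andP; split; lra.
  have [q hqq] := choice hq.
  exists (\row_i q i); split=> [i|].
    rewrite mxE; have := hqq i; rewrite lt_min => /andP[_ h].
    have := ler_normB (v0 0 i) (v0 0 i - ratr (q i)); rewrite opprB addrCA subrr addr0.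
    by have := bv0 i; lra.
  have := he (map_mx ratr (\row_i q i)); rewrite /= hv0 dU sub0r normrN.
  move=> h; apply: le_lt_trans (ler_norm _) _; apply: h; split=> // i j.
  by have := hqq j; rewrite lt_min (ord1 i) !mxE => /andP[].
pose K := [set v : 'rV[R]_N | forall i, `[-2, 2]%classic (v ord0 i)].
have cK : compact K.
  exact: (@rV_compact R N (fun=> `[(-2 : R), 2]%classic) (fun=> @segment_compact R (-2) 2)).
have K0 : K !=set0 by exists 0 => i /=; rewrite mxE in_itv /=; apply/andP; split; lra.
have [v vK hv] := @EVT_min_rV R N (fun v => defect H (mx_of_row v)) K K0 cK
   (continuous_subspaceT (@defect_continuous H)).
apply: (@defect_localizing H (mx_of_row v)).
apply/eqP; rewrite eq_le defect_ge0 andbT leNgt; apply/negP => d0.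
have [q [q2 hq]] := hk (Num.truncn (defect H (mx_of_row v))^-1).
have qK : map_mx ratr q \in K.
  by rewrite inE => i /=; rewrite mxE in_itv /= -ler_norml; exact: q2.
have := hv _ qK; apply/negP; rewrite -ltNge; apply: lt_le_trans hq _.
rewrite -[leRHS]invrK lef_pV2 ?posrE ?invr_gt0 //.
by apply/ltW; rewrite truncnS_gt.
Qed.
End LocalizingMatrix.

Lemma measurable_localizing_mx (R : realType) (d : measure_display)
    (T : measurableType d) (n : nat) (gap : R) (far : rel 'I_n)
    (bd : 'I_n -> 'I_n -> R) (H : T -> 'M[R[i]]_n) :
  (forall x y, cmeasurable (fun w => H w x y)) ->
  measurable [set w | localizing_mx gap far bd (H w)].
Proof.
move=> mH.
rewrite (_ : [set w | _] = \bigcap_(k : nat) \bigcup_(q : 'rV[rat]__)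
   ([set w | forall i, `|ratr (q 0 i) : R| <= 2] `&`
    ([set: T] `&` [set w | defect gap far bd (H w) (mx_of_row (map_mx ratr q)) < k.+1%:R^-1]))).
  apply: bigcapT_measurable => k; apply: countable_bigcupT_measurable.
    exact: countableP.
  move=> q; have [h|h] := pselect (forall i, `|ratr (q 0 i) : R| <= 2); last first.
    by rewrite (_ : [set w | _] = set0) ?set0I //; apply/seteqP; split.
  rewrite (_ : [set w : T | _] = setT) ?setTI; last by apply/seteqP; split.
  have md : measurable_fun [set: T] (fun w => defect gap far bd (H w) (mx_of_row (map_mx ratr q))).
    apply: (@class_defect _ _ _ _ _ T (fun f : T -> R => measurable_fun [set: T] f)).
    - by move=> c; exact: measurable_cst.
    - by move=> f g; exact: measurable_funD.
    - by move=> f g; exact: measurable_funM.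
    - by move=> f; exact: measurable_sqrt.
    - exact: mH.
    - by move=> x y; exact: cmeasurable_cst.
  have -> : [set w | defect gap far bd (H w) (mx_of_row (map_mx ratr q)) < k.+1%:R^-1] =
    ~` ([set: T] `&` [set w | k.+1%:R^-1 <= defect gap far bd (H w) (mx_of_row (map_mx ratr q))]).
    by apply/seteqP; split=> w; rewrite setTI /= ltNge => /negP.
  apply: measurableC; apply: (measurable_fun_le measurableT) => //.
apply/seteqP; split=> w /=.
  move=> /localizing_mxP h k _; have [q [h1 h2]] := h k.
  by exists q.
by move=> h; apply/localizing_mxP => k; have [q _ [h1 [_ h2]]] := h k I; exists q.
Qed.

(** * Powers of [L] against stretched exponentials *)

Section Asymptotics.
Variable R : realType.

Lemma powR_eventually_ge (e W : R) : 0 < e ->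
  exists L0 : R, forall L, L0 <= L -> 1 <= L -> W <= L `^ e.
Proof.
move=> e0; exists ((Num.max W 1) `^ e^-1) => L h L1.
have W0 : 0 <= Num.max W 1 by rewrite le_max ler01 orbT.
apply: (@le_trans _ _ (Num.max W 1)); first by rewrite le_max lexx.
have -> : Num.max W 1 = (Num.max W 1 `^ e^-1) `^ e.
  by rewrite -powRrM mulVf ?lt0r_neq0 // powRr1.
by apply: ge0_ler_powR; rewrite ?nnegrE ?powR_ge0 ?(ltW e0) //; lra.
Qed.

(** Each of the four factors is given a quarter of the exponent on the right. For the power of [2 L]
    this rests on [ln y <= y - 1] at [y = (2 L)^(b/2)]. *)
Lemma poly_exp_le (C a1 a2 b kappa : R) (D : nat) :
  0 < C -> 0 <= a1 -> a1 < b -> 0 <= a2 -> a2 < b -> 0 < kappa ->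
  exists L0 : R, forall L, L0 <= L -> 1 <= L ->
    C * (2 * L) ^+ D * expR (L `^ a1 + L `^ a2) <= expR (kappa * L `^ b).
Proof.
move=> C0 a10 a1b a20 a2b k0; have b0 : 0 < b by lra.
have scale W X : 4 * W / kappa <= X -> W <= kappa / 4 * X.
  by rewrite ler_pdivrMr // => h; lra.
have sub a : a < b -> exists L0 : R, forall L, L0 <= L -> 1 <= L ->
    L `^ a <= kappa / 4 * L `^ b.
  move=> ab; have [L0 h0] := @powR_eventually_ge (b - a) (4 * 1 / kappa) ltac:(lra).
  exists L0 => L h L1.
  have -> : L `^ b = L `^ (b - a) * L `^ a.
    by rewrite -powRD ?subrK //; apply/implyP => _; rewrite gt_eqF //; lra.
  rewrite mulrA ler_peMl ?powR_ge0 //.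
  exact: scale (h0 L h L1).
have [L1 h1] := sub _ a1b; have [L2 h2] := sub _ a2b.
have [L3 h3] := @powR_eventually_ge b (4 * C / kappa) b0.
have b20 : 0 < b / 2 by lra.
pose w : R := 2 / b * 2 `^ (b / 2) * D%:R.
have [L4 h4] := @powR_eventually_ge (b / 2) (4 * w / kappa) b20.
exists (Num.max (Num.max L1 L2) (Num.max L3 L4)) => L.
rewrite !ge_max => /andP[/andP[g1 g2] /andP[g3 g4]] L_1.
have L0 : 0 < L by lra.
have i1 := h1 _ g1 L_1; have i2 := h2 _ g2 L_1.
have i3 : C <= expR (kappa / 4 * L `^ b).
  apply: (@le_trans _ _ (kappa / 4 * L `^ b)); last first.
    by apply: le_trans (expR_ge1Dx _); rewrite lerDr.
  exact: scale (h3 _ g3 L_1).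
have i4 : (2 * L) ^+ D <= expR (kappa / 4 * L `^ b).
  have L20 : 0 < 2 * L by rewrite mulr_gt0.
  have -> : (2 * L) ^+ D = expR (D%:R * ln (2 * L)).
    by rewrite [D%:R * _]mulrC expRM_natr lnK ?posrE.
  rewrite ler_expR.
  have e1 : ln (2 * L) <= 2 / b * (2 * L) `^ (b / 2).
    have -> : ln (2 * L) = 2 / b * ln ((2 * L) `^ (b / 2)).
      by rewrite ln_powR; field; rewrite gt_eqF.
    rewrite ler_wpM2l ?divr_ge0 ?(ltW b0) //.
    have p0 : 0 < (2 * L) `^ (b / 2) by rewrite powR_gt0.
    have := @le_ln1Dx _ ((2 * L) `^ (b / 2) - 1) ltac:(lra).
    by rewrite addrCA subrr addr0; lra.
  apply: (@le_trans _ _ (w * L `^ (b / 2))).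
    apply: (le_trans (ler_wpM2l (ler0n _ D) e1)).
    by rewrite powRM ?(ltW L0) // /w le_eqVlt; apply/orP; left; apply/eqP; ring.
  have -> : L `^ b = L `^ (b / 2) * L `^ (b / 2).
    rewrite -powRD; first by congr (_ `^ _); field.
    by apply/implyP => _; rewrite gt_eqF.
  rewrite mulrA ler_wpM2r ?powR_ge0 //.
  exact: scale (h4 _ g4 L_1).
apply: (@le_trans _ _ (expR (kappa / 4 * L `^ b) * expR (kappa / 4 * L `^ b) *
   expR (kappa / 4 * L `^ b + kappa / 4 * L `^ b))).
  have p0 : 0 <= (2 * L) ^+ D by rewrite exprn_ge0 // mulr_ge0 // ltW.
  apply: ler_pM; rewrite ?expR_ge0 //; first by apply: mulr_ge0 => //; exact: ltW.
    by apply: ler_pM => //; exact: ltW.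
  by rewrite ler_expR; lra.
by rewrite -!expRD ler_expR; lra.
Qed.
End Asymptotics.

(** * Sup norm, neighbours and enumeration of a box *)

Section SupNorm.
Variables (R : realType) (d : nat).

Lemma supn_le (u : 'rV[R]_d) c : 0 <= c -> (supn u <= c) <-> (forall j, `|u 0 j| <= c).
Proof.
move=> c0; split=> [h j|h]; last by apply: bigmax_le.
by apply: le_trans h; exact: (le_bigmax _ (fun j => `|u 0 j|) j).
Qed.

Lemma supn_ge0 (u : 'rV[R]_d) : 0 <= supn u.
Proof. exact: bigmax_ge_id. Qed.

Lemma supn_coord (u : 'rV[R]_d) j : `|u 0 j| <= supn u.
Proof. exact: (le_bigmax _ (fun j => `|u 0 j|) j). Qed.

Lemma supnD (u w : 'rV[R]_d) : supn (u + w) <= supn u + supn w.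
Proof.
apply/supn_le; first by rewrite addr_ge0 ?supn_ge0.
move=> j; rewrite mxE; apply: le_trans (ler_normD _ _) _.
by apply: lerD; exact: supn_coord.
Qed.

Lemma supnN (u : 'rV[R]_d) : supn (- u) = supn u.
Proof. by apply: eq_bigr => j _; rewrite mxE normrN. Qed.

Lemma supn0 : supn (0 : 'rV[R]_d) = 0.
Proof.
apply/eqP; rewrite eq_le supn_ge0 andbT; apply/(supn_le _ (lexx 0)) => j.
by rewrite mxE normr0.
Qed.

Lemma adj_sym : symmetric (@adj d).
Proof.
move=> y z; rewrite /adj; congr (_ == _); apply: eq_bigr => j _.
by rewrite -opprB sqrrN.
Qed.

Lemma adj_irr : irreflexive (@adj d).
Proof. by move=> y; rewrite /adj big1 // => j _; rewrite subrr expr0n. Qed.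

Lemma adj_coord (y z : site d) j : adj y z -> `|y 0 j - z 0 j| <= 1.
Proof.
move=> /eqP h; rewrite -(@expr_le1 _ 2) // real_normK ?num_real // -h.
by rewrite (bigD1 j) //= lerDl; apply: sumr_ge0 => k _; rewrite sqr_ge0.
Qed.

Lemma supn_adj (y z : site d) : adj y z -> supn (emb R y - emb R z) <= 1.
Proof.
move=> h; apply/supn_le => // j; rewrite !mxE -rmorphB /= -intr_norm.
by rewrite (_ : 1 = 1%:~R) // ler_int adj_coord.
Qed.

(** Neighbours differ by -1, 0 or 1 in each coordinate. This crude count suffices, since the degree
    enters constants only. *)
Lemma adj_card (I : finType) (f : I -> site d) y : injective f ->
  (#|[pred i | adj y (f i)]| <= 3 ^ d)%N.
Proof.
move=> fI; pose g i : {ffun 'I_d -> 'I_3} := [ffun j => inord (absz (f i 0 j - y 0 j + 1)%R)].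
have := @leq_card_in _ _ g [pred i | adj y (f i)].
rewrite -[X in (_ <= X ^ _)%N](card_ord 3) -[X in (_ <= _ ^ X)%N](card_ord d) -card_ffun.
move=> h; apply: leq_trans (h _) (max_card _) => i k; rewrite !inE => hi hk.
move=> /ffunP e; apply: fI; apply/rowP => j; have := congr1 val (e j).
rewrite !ffunE; have := adj_coord j hi; have := adj_coord j hk.
set a : int := f i 0 j; set b : int := f k 0 j; set c : int := y 0 j => h1 h2.
by rewrite /= !inordK; lia.
Qed.

Lemma box_enum (L : R) (x0 : 'rV[R]_d) : 1 <= L -> exists s : seq (site d),
  [/\ uniq s, forall y, y \in s <-> box L x0 y, (0 < size s)%N &
      (size s)%:R <= (2 * L) ^+ d].
Proof.
move=> L1; pose m := (Num.truncn L).+1.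
pose g (f : {ffun 'I_d -> 'I_m}) : site d := \row_j (Num.ceil (x0 0 j - L / 2) + (f j)%:Z).
pose t := [seq g f | f <- enum {ffun 'I_d -> 'I_m}].
pose s := undup [seq y <- t | `[< box L x0 y >]].
have hs y : y \in s <-> box L x0 y.
  rewrite mem_undup mem_filter; split=> [/andP[/asboolP//]|hy].
  apply/andP; split; first exact/asboolP.
  have hj j : `|(y 0 j)%:~R - x0 0 j| <= L / 2.
    have L0 : 0 <= L / 2 by lra.
    by have /(supn_le _ L0)/(_ j) := hy; rewrite !mxE.
  pose k j := (y 0 j - Num.ceil (x0 0 j - L / 2)).
  have k0 j : 0 <= k j.
    rewrite subr_ge0 ceil_le_int; have := hj j; rewrite ler_norml => /andP[h _]; lra.
  have kL j : (`|k j| < m)%N.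
    have : ((`|k j|%N)%:R : R) <= L.
      have -> : (`|k j|%N)%:R = (k j)%:~R :> R by rewrite natr_absz ger0_norm ?ler0z.
      rewrite /k rmorphB /=; have := ceil_ge (x0 0 j - L / 2).
      by have := hj j; rewrite ler_norml => /andP[_ h]; lra.
    by rewrite /m ltnS => h; rewrite truncn_ge_nat //; lra.
  apply/mapP; exists [ffun j => Ordinal (kL j)]; first by rewrite mem_enum.
  by apply/rowP => j; rewrite mxE ffunE /= gez0_abs // /k addrC subrK.
exists s; split => //; first exact: undup_uniq.
  (* Rounding each coordinate of the centre moves it by at most 1/2, which is within [L / 2] as
     [1 <= L]; the box is therefore not empty. *)
  pose y : site d := \row_j Num.floor (x0 0 j + 1 / 2).
  suff : y \in s by case: (s).
  apply/hs/supn_le; first lra.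
  move=> j; rewrite !mxE; have := floor_le (x0 0 j + 1 / 2); have := lt_succ_floor (x0 0 j + 1 / 2).
  by rewrite intrD => h1 h2; rewrite ler_norml; apply/andP; split; lra.
apply: (@le_trans _ _ (m ^ d)%:R).
  rewrite ler_nat (leq_trans (size_undup _)) // size_filter (leq_trans (count_size _ _)) //.
  by rewrite size_map -cardE card_ffun !card_ord.
rewrite natrX lerXn2r ?nnegrE ?ler0n //; first lra.
by rewrite /m -natr1; have := truncn_le L; lra.
Qed.
End SupNorm.

(** * Translation between the box and matrices *)

Section BoxMatrix.
Variables (R : realType) (d : nat) (L beta tau m eps : R) (x0 : 'rV[R]_d).
Variables (s : seq (site d)).
Hypotheses (us : uniq s) (hs : forall y, y \in s <-> box L x0 y) (s0 : (0 < size s)%N).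
Let n := size s.

Definition site_of (i : 'I_n) : site d := tnth (in_tuple s) i.
Definition site_adj : rel 'I_n := fun i j => adj (site_of i) (site_of j).
Definition site_dist (i j : 'I_n) : R := supn (emb R (site_of i) - emb R (site_of j)).

Lemma site_of_inj : injective site_of.
Proof. exact: (elimT (tuple_uniqP (in_tuple s)) us). Qed.

(** Sites outside the box get a default index, which is never seen: all clauses of [m_localizing]
    quantify and sum over the box only. *)
Definition site_idx (y : site d) : 'I_n := insubd (Ordinal s0) (index y s).

Lemma site_idxK i : site_idx (site_of i) = i.
Proof.
apply/val_inj; rewrite /site_idx val_insubd index_mem mem_tnth /=.
by rewrite /site_of (tnth_nth 0) /= index_uniq.
Qed.

Lemma site_of_box i : box L x0 (site_of i).
Proof. by apply/hs; exact: mem_tnth. Qed.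

Lemma site_ofP y : box L x0 y -> exists i, y = site_of i.
Proof. by move=> /hs hy; have /tnthP := (hy : y \in in_tuple s). Qed.

Lemma site_dist_step i k j : site_adj i k -> site_dist i j <= site_dist k j + 1.
Proof.
move=> hik; rewrite /site_dist.
have -> : emb R (site_of i) - emb R (site_of j) =
   (emb R (site_of i) - emb R (site_of k)) + (emb R (site_of k) - emb R (site_of j)).
  by rewrite addrA subrK.
by apply: le_trans (supnD _ _) _; rewrite addrC lerD2l supn_adj.
Qed.

Lemma site_dist_le i j : 0 <= L -> site_dist i j <= L.
Proof.
move=> L0; have h k : supn (emb R (site_of k) - x0) <= L / 2 by exact: site_of_box.
rewrite /site_dist.
have -> : emb R (site_of i) - emb R (site_of j) =
   (emb R (site_of i) - x0) - (emb R (site_of j) - x0).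
  by rewrite opprB addrA subrK.
by apply: le_trans (supnD _ _) _; rewrite supnN; have := h i; have := h j; lra.
Qed.

Lemma box_sum (f : site d -> R[i]) : \sum_(z \in box L x0) f z = \sum_(i < n) f (site_of i).
Proof.
have -> : box L x0 = [set` s] by apply/seteqP; split=> y /= /hs.
by rewrite -fsbig_seq // big_tnth.
Qed.

Definition site_far : rel 'I_n := fun i j => Ltau L tau <= site_dist j i.
Definition site_bound (i j : 'I_n) : R := expR (- m * site_dist j i).

(** From left to right, two basis vectors with the same eigenvalue would be proportional by
    simplicity, contradicting orthonormality; so distinct centres have distinct eigenvalues and the
    spacing condition applies. From right to left, an arbitrary eigenvector is expanded in a basis:
    all coefficients but one vanish, which gives simplicity and shows that every eigenvalue is one
    of the [l x]. *)
Lemma m_localizing_mx (V : site d -> R) :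
  m_localizing L beta tau m eps V x0 <->
  localizing_mx (expR (- L `^ beta)) site_far site_bound
    (ham site_adj eps (finset.setTfor 'I_n) (fun i => V (site_of i))).
Proof.
set H := ham _ _ _ _; set Th := box L x0.
have hH i j : H i j = (Hker eps V (site_of i) (site_of j))%:C.
  by rewrite mxE !inE /= /Hker (inj_eq site_of_inj).
have hHs i j : H i j = H j i.
  have := @ham_tr R n site_adj eps (fun i j => adj_sym _ _) (finset.setTfor 'I_n)
    (fun i => V (site_of i)).
  by rewrite -/H => /matrixP/(_ i j); rewrite mxE.
have hR (phi : site d -> R[i]) i : Hrestr Th eps V phi (site_of i) = \sum_j H i j * phi (site_of j).
  by rewrite /Hrestr box_sum; apply: eq_bigr => j _; rewrite hH.
have hI (phi psi : site d -> R[i]) : inner Th phi psi = \sum_i phi (site_of i) * conjc (psi (site_of i)).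
  by rewrite /inner box_sum.
have gap0 : 0 < expR (- L `^ beta) := expR_gt0 _.
split.
  move=> [h1 [h2 [Phi [lams [h3 [h4 h5]]]]]].
  exists (\matrix_(i, j) Phi (site_of i) (site_of j)), (fun i => lams (site_of i)).
  have hev i : is_eigvec Th eps V (lams (site_of i)) (Phi (site_of i)).
    split; last by apply: h4; exact: site_of_box.
    apply: contrapT => hno.
    have h0 : inner Th (Phi (site_of i)) (Phi (site_of i)) = 0.
      rewrite hI big1 // => k _; suff -> : Phi (site_of i) (site_of k) = 0 by rewrite mul0r.
      by apply/eqP/negPn/negP => hk; apply: hno; exists (site_of k) => //; exact: site_of_box.
    have := h3 _ _ (site_of_box i) (site_of_box i).
    by rewrite h0 eqxx => /eqP; rewrite eq_sym oner_eq0.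
  split.
  - move=> i i'; under eq_bigr do rewrite !mxE.
    by rewrite -hI h3 ?(inj_eq site_of_inj) //; exact: site_of_box.
  - move=> i j; under eq_bigr do rewrite !mxE.
    under eq_bigr do rewrite -[_ * _]/(_).
    have := h4 _ (site_of_box i) _ (site_of_box j).
    by rewrite hR !mxE => <-; apply: eq_bigr => z _; rewrite !mxE.
  - move=> i i' ii'.
    have ne : lams (site_of i) != lams (site_of i').
      apply/negP => /eqP e; have hi' := hev i'; rewrite -e in hi'.
      have ex : is_eigval Th eps V (lams (site_of i)) by exists (Phi (site_of i)).
      have [c hc] := h1 _ ex _ _ (hev i) hi'.
      have o1 := h3 _ _ (site_of_box i') (site_of_box i).
      have o2 := h3 _ _ (site_of_box i) (site_of_box i).
      have o3 := h3 _ _ (site_of_box i') (site_of_box i').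
      have c0 : c = 0.
        rewrite (inj_eq site_of_inj) eq_sym (negbTE ii') hI in o1.
        rewrite eqxx hI in o2; rewrite -[c]mulr1 -[X in c * X]/(true%:R) -o2 mulr_sumr -[RHS]o1.
        by apply: eq_bigr => k _; rewrite hc ?mulrA //; exact: site_of_box.
      move: o3; rewrite eqxx hI big1 => [/eqP|k _]; first by rewrite eq_sym oner_eq0.
      by rewrite hc ?c0 ?mul0r //; exact: site_of_box.
    have := h2 _ _ _ _ ne; rewrite -[`|_|]/(Normc.normc _)%:C lecR; apply.
      by exists (Phi (site_of i)).
    by exists (Phi (site_of i')).
  - move=> i j hij; rewrite mxE.
    have [_ h] := h5 _ (site_of_box i).
    have := h _ (site_of_box j) hij.
    by rewrite -[`|_|]/(Normc.normc _)%:C lecR.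
move=> [U [l [u1 u2 u3 u4]]].
(* Pairing without conjugation: as [H] is symmetric, [tr] diagonalizes it without knowing that the
   [l x] are real. These are the coefficients in the basis of the conjugated rows of [U]. *)
pose tr (phi : site d -> R[i]) x := \sum_j U x j * phi (site_of j).
have trH lam phi : (forall y, Th y -> Hrestr Th eps V phi y = lam * phi y) ->
    forall x, (l x - lam) * tr phi x = 0.
  move=> hphi x; rewrite mulrBl; apply/eqP; rewrite subr_eq0; apply/eqP.
  rewrite /tr !mulr_sumr.
  transitivity (\sum_j \sum_k U x k * H j k * phi (site_of j)).
    apply: eq_bigr => j _; rewrite mulrA -u2 mulr_suml.
    by apply: eq_bigr => k _; rewrite [U x k * _]mulrC.
  rewrite exchange_big /=; apply: eq_bigr => k _.
  rewrite mulrCA -hphi ?hR; last exact: site_of_box.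
  by rewrite mulr_sumr; apply: eq_bigr => j _; rewrite mulrA hHs.
have UU : \matrix_(i, j) conjc (U j i) *m U = 1%:M.
  apply: mulmx1C; apply/matrixP => i j; rewrite !mxE -u1.
  by apply: eq_bigr => k _; rewrite !mxE.
have inv phi k : phi (site_of k) = \sum_x conjc (U x k) * tr phi x.
  transitivity (\sum_j (1%:M : 'M[R[i]]_n) k j * phi (site_of j)).
    rewrite (bigD1 k) //= mxE eqxx mul1r big1 ?addr0 // => j jk.
    by rewrite mxE eq_sym (negbTE jk) mul0r.
  rewrite -UU; under eq_bigr do rewrite mxE mulr_suml.
  rewrite exchange_big /=; apply: eq_bigr => x _; rewrite /tr mulr_sumr.
  by apply: eq_bigr => j _; rewrite !mxE mulrA.
have evP lam phi : is_eigvec Th eps V lam phi -> exists2 x, l x = lam & tr phi x != 0.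
  move=> [[y hy y0] hphi].
  have [x hx] : exists x, tr phi x != 0.
    apply: contrapT => hno; have [k yk] := site_ofP hy.
    move: y0; rewrite yk inv big1 ?eqxx // => x _.
    suff -> : tr phi x = 0 by rewrite mulr0.
    by apply/eqP/negPn/negP => hx; apply: hno; exists x.
  exists x => //; have /eqP := trH _ _ hphi x.
  by rewrite mulf_eq0 (negbTE hx) orbF subr_eq0 => /eqP.
have sep x x' : l x = l x' -> x = x'.
  move=> e; apply/eqP/negPn/negP => /u3; rewrite e subrr Normc.normc0.
  by rewrite leNgt gap0.
split; last split.
- move=> lam _ phi psi hphi hpsi.
  have [x ex nx] := evP _ _ hphi.
  have tr0 f : is_eigvec Th eps V lam f -> forall x', x' != x -> tr f x' = 0.
    move=> [_ hf] x' xx'; have /eqP := trH _ _ hf x'; rewrite mulf_eq0 => /orP[|/eqP//].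
    by rewrite subr_eq0 -ex => /eqP/sep e; rewrite e eqxx in xx'.
  have val f k : is_eigvec Th eps V lam f -> f (site_of k) = conjc (U x k) * tr f x.
    move=> hf; rewrite inv (bigD1 x) //= big1 ?addr0 // => x' xx'.
    by rewrite (tr0 f hf x' xx') mulr0.
  exists (tr psi x / tr phi x) => y /site_ofP[k ->].
  by rewrite (val psi k hpsi) (val phi k hphi); field.
- move=> lam lam' [phi hphi] [psi hpsi] ne.
  have [x ex _] := evP _ _ hphi; have [x' ex' _] := evP _ _ hpsi.
  rewrite -[`|_|]/(Normc.normc _)%:C lecR -ex -ex'; apply: u3.
  by apply: contraNneq ne => e; rewrite -ex -ex' e.
have idxK := site_idxK.
exists (fun y z => U (site_idx y) (site_idx z)), (fun y => l (site_idx y)); split; [|split].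
- move=> y y' /site_ofP[i ->] /site_ofP[j ->]; rewrite hI !idxK (inj_eq site_of_inj) -u1.
  by apply: eq_bigr => k _; rewrite !idxK.
- move=> y /site_ofP[i ->] z /site_ofP[j ->]; rewrite hR !idxK -u2.
  by apply: eq_bigr => k _; rewrite !idxK.
- move=> y /site_ofP[i ->]; split.
    rewrite hI; have := u1 i i; rewrite eqxx mulr1n => <-.
    by apply: eq_bigr => k _; rewrite !idxK.
  move=> z /site_ofP[j ->] hz; rewrite !idxK -[`|_|]/(Normc.normc _)%:C lecR.
  exact: u4.
Qed.
End BoxMatrix.

(** * Localization from resolvent bounds *)

Section Deterministic.
Variables (R : realType) (n : nat) (A : rel 'I_n) (eps : R) (v : 'I_n -> R).
Hypotheses (A_sym : symmetric A) (A_irr : irreflexive A) (n0 : (0 < n)%N).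
Local Notation sT := (finset.setTfor 'I_n).
Local Notation H := (ham A eps sT v).

Lemma normr_normc (c : R[i]) : `|c| = (Normc.normc c)%:C.
Proof. by []. Qed.

(** The eigenvector equation at a site where the eigenvector is largest, as for Gershgorin discs. *)
Lemma spectral_bound (R0 : R) (P : 'M[R[i]]_n) (dg : 'rV[R[i]]_n) i :
  0 <= eps -> (forall x, `|v x| + eps * #|A x|%:R <= R0) ->
  P \is unitarymx -> P *m H = diag_mx dg *m P -> Normc.normc (dg 0 i) <= R0.
Proof.
move=> e0 hv hP hPH.
have [x hx] : exists x, forall y, Normc.normc (P i y) <= Normc.normc (P i x).
  have [x _ hx] := @arg_maxP _ _ _ (Ordinal n0) xpredT (fun x => Normc.normc (P i x)) isT.
  by exists x => y; exact: hx.
have px0 : 0 < Normc.normc (P i x).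
  rewrite lt_neqAle normc_ge0 andbT eq_sym; apply/negP => /eqP h0.
  have := unitary_rows hP i i; rewrite eqxx mulr1n big1 => [/eqP|y _].
    by rewrite eq_sym oner_eq0.
  have /Normc.eq0_normc -> : Normc.normc (P i y) = 0.
    by apply/eqP; rewrite eq_le normc_ge0 andbT -h0 hx.
  by rewrite mul0r.
have := congr1 (fun M : 'M[R[i]]_n => M i x) hPH; rewrite mul_diag_mx !mxE => e.
have : Normc.normc (dg 0 i) * Normc.normc (P i x) <= R0 * Normc.normc (P i x).
  rewrite -Normc.normcM -e.
  apply: (@le_trans _ _ (\sum_y Normc.normc (P i y * H y x))).
    apply: (big_ind2 (fun (s : R[i]) (t : R) => Normc.normc s <= t)) => //.
      by rewrite Normc.normc0.
    by move=> a b c d' h1 h2; apply: le_trans (le_normcD _ _) _; apply: lerD.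
  apply: (@le_trans _ _ (\sum_y (Normc.normc (P i x) * (eps * (A x y)%:R + (y == x)%:R * `|v x|)))).
    apply: ler_sum => y _; rewrite Normc.normcM; apply: ler_pM => //; try exact: normc_ge0.
    rewrite mxE !inE /= expr0n /= addr0 sqrtr_sqr A_sym.
    apply: le_trans (ler_normD _ _) _; rewrite !normrM normrN (ger0_norm e0).
    by rewrite !normr_nat; case: eqP => [->|_]; rewrite ?mul0r.
  rewrite -mulr_sumr mulrC ler_pM2r // big_split /= -mulr_sumr.
  have -> : \sum_(y < n) (y == x)%:R * `|v x| = `|v x|.
    rewrite (bigD1 x) //= eqxx mul1r big1 ?addr0 // => y yx.
    by rewrite (negbTE yx) mul0r.
  rewrite addrC; apply: le_trans (hv x); rewrite lerD2l ler_wpM2l //.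
  by rewrite -natr_sum ler_nat -sum1_card [X in (_ <= X)%N]big_mkcond.
by rewrite ler_pM2r.
Qed.

Lemma net_point (R0 h e : R) (M : nat) : 0 < h -> `|e| <= R0 -> 2 * R0 / h < M%:R ->
  exists k : 'I_M, `|e - (- R0 + k%:R * h)| <= h.
Proof.
move=> h0 he hM; have e1 : 0 <= (e + R0) / h.
  by rewrite divr_ge0 ?(ltW h0) //; move: he; rewrite ler_norml => /andP[]; lra.
have hk : (Num.truncn ((e + R0) / h) < M)%N.
  rewrite -(ltr_nat R); have h1 : (Num.truncn ((e + R0) / h))%:R <= (e + R0) / h.
    by rewrite truncn_le.
  apply: le_lt_trans h1 _; apply: le_lt_trans hM; rewrite ler_wpM2r ?invr_ge0 ?(ltW h0) //.
  by move: he; rewrite ler_norml => /andP[]; lra.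
exists (Ordinal hk) => /=; set k := Num.truncn _.
have /andP[k1 k2] : k%:R <= (e + R0) / h < k.+1%:R by exact: truncn_itv.
move: k1 k2; rewrite ler_pdivlMr // ltr_pdivrMr // -natr1 mulrDl mul1r => k1 k2.
by rewrite ler_norml; apply/andP; split; lra.
Qed.

(** How the constants fit: every eigenvalue is within [g / 8] of the net. Two eigenvalues closer
    than [g] would both lie within [2 * g] of a net point, which the absence of a double resonance
    at width [2 * g] excludes. With [r = g / 4], the eigenvalue under study is within [r / 2] of its
    net point and the others are at distance at least [g - g / 8 >= 2 * r]. The prefactor
    [2 * n ^ 2] in the last hypothesis undoes the lower bound at the centre. *)
Lemma localizing_of_green (g R0 : R) (M kk : nat) (far : rel 'I_n)
    (B bd : 'I_n -> 'I_n -> R) :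
  0 <= eps -> (forall x, `|v x| + eps * #|A x|%:R <= R0) -> 0 < g -> (0 < kk)%N ->
  2 * R0 / (g / 8) < M%:R ->
  (forall k : 'I_M, ~ exists x,
     (8 * (2 * g) * n%:R)^-1 <= Normc.normc (green A eps sT v ((- R0 + k%:R * (g / 8)) +i* (2 * g)) x x) /\
     exists y, y \in sT :\ x /\ (8 * (2 * g) * n%:R)^-1 <=
        Normc.normc (green A eps (sT :\ x) v ((- R0 + k%:R * (g / 8)) +i* (2 * g)) y y)) ->
  (forall (k : 'I_M) c x y, c \in iter_sqrt kk (-1) -> far x y ->
     Normc.normc (green A eps sT v ((- R0 + k%:R * (g / 8))%:C + (g / 4)%:C / c) x y) <= B x y) ->
  (forall x y, far x y ->
     2 * n%:R ^+ 2 * (2 * (g / 4) * B x y + 2 * n%:R / 2 ^+ (2 ^ kk)) <= bd x y) ->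
  localizing_mx g far bd H.
Proof.
move=> e0 hv g0 kk0 hM hres hgreen hbd.
have [P [dg [hP hreal hH hPH]]] := hermitian_spectralP (ham_herm eps A_sym sT v).
have h0 : 0 < g / 8 by lra.
pose e i := complex.Re (dg 0 i).
have de i : dg 0 i = (e i)%:C by rewrite /e RRe_real.
have he i : `|e i| <= R0.
  have := spectral_bound i e0 hv hP hPH; rewrite de /= expr0n /= addr0 sqrtr_sqr; exact.
have ndist i (E : R) : `|dg 0 i - E%:C| = `|e i - E|%:C.
  by rewrite de -rmorphB /= normr_normc /= expr0n /= addr0 sqrtr_sqr.
have gap i j : i != j -> g <= `|e i - e j|.
  move=> ij; rewrite leNgt; apply/negP => hlt.
  have [k hk] := net_point h0 (he i) hM; apply: (hres k).
  have d0 : 0 < 2 * g by lra.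
  have [||[x hx] hy] := two_eigenvalues_green A_sym d0 hP hPH ij (v := v) (E := - R0 + k%:R * (g / 8)).
  - by rewrite ndist lecR; lra.
  - rewrite ndist lecR.
    have -> : e j - (- R0 + k%:R * (g / 8)) = (e i - (- R0 + k%:R * (g / 8))) - (e i - e j) by lra.
    by apply: le_trans (ler_normB _ _) _; lra.
  exists x; split => //; have [y yS hy'] := hy x; by exists y.
have [s hs] := unitary_perm_large n0 hP.
(* [s] sends an eigenvector to its centre, so row [x] of the new matrix is the eigenvector of index
   [t x]. *)
pose t := (s^-1)%g.
exists (\matrix_(x, y) P (t x) y), (fun x => dg 0 (t x)); split.
- move=> x x'; under eq_bigr do rewrite !mxE.
  by have := unitary_rows hP (t x) (t x'); rewrite (inj_eq perm_inj).
- move=> x y; have := congr1 (fun M : 'M[R[i]]_n => M (t x) y) hPH.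
  rewrite mul_diag_mx !mxE => <-; apply: eq_bigr => z _; rewrite !mxE mulrC; congr (_ * _).
  by have := ham_tr eps A_sym sT v => /matrixP/(_ z y); rewrite !mxE.
- move=> x x' xx'; have := gap (t x) (t x'); rewrite (inj_eq perm_inj) => /(_ xx').
  by rewrite !de -rmorphB /= expr0n /= addr0 sqrtr_sqr.
move=> x y hxy; rewrite mxE; apply: le_trans (hbd x y hxy).
have [k hk] := net_point h0 (he (t x)) hM; set E := - R0 + k%:R * (g / 8) in hk.
have r0 : 0 < (g / 4)%:C :> R[i] by rewrite ltcR; lra.
have hEr : E%:C \is Num.real by rewrite complex_real.
have := @eigenvector_product_le _ _ P H dg E%:C (g / 4)%:C (B x y)%:C kk (t x) x y
  hP hreal hH hEr r0 kk0.
move=> /(_ _ _ _)/wrap[||| h].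
- rewrite ndist -(rmorph_nat (real_complex R)) -fmorphV -rmorphM lecR /=; lra.
- move=> i ix; rewrite ndist -(rmorph_nat (real_complex R)) -rmorphM lecR /=.
  have := gap _ _ ix; have := ler_normB (e i - E) (e (t x) - E).
  have -> : e i - E - (e (t x) - E) = e i - e (t x) by lra.
  lra.
- by move=> c hc; rewrite normr_normc lecR; exact: hgreen.
have hx : (2 * n%:R ^+ 2)^-1 <= Normc.normc (P (t x) x).
  have := hs (t x); rewrite permKV normr_normc => h'; rewrite -lecR; apply: le_trans h'.
  by rewrite fmorphV rmorphM rmorphXn /= !rmorph_nat.
have {}h : Normc.normc (P (t x) x) * Normc.normc (P (t x) y) <=
   2 * (g / 4) * B x y + 2 * n%:R / 2 ^+ (2 ^ kk).
  move: h; rewrite !normr_normc -rmorphM /= => h; rewrite -lecR; apply: le_trans h _.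
  by rewrite rmorphD !rmorphM !fmorphV rmorphXn /= !rmorph_nat.
have nn0 : 0 < 2 * n%:R ^+ 2 :> R by rewrite mulr_gt0 // exprn_gt0 // ltr0n.
rewrite -ler_pdivrMl //; apply: le_trans h.
by rewrite ler_wpM2r ?normc_ge0.
Qed.
End Deterministic.

(** * Choice of scales and numerical estimates *)

Section Scales.
Variable R : realType.
Implicit Types (L g N r ell X : R).

(** [2^kk] must be at least [4 L] for [2^(-2^kk)] to fall below [e^(-2 L)], and of order [L] because
    it counts the resolvents in the union bound. *)
Lemma dyadic_scale L : 1 <= L ->
  exists kk : nat, [/\ (0 < kk)%N, 4 * L <= (2 ^ kk)%:R & (2 ^ kk)%:R <= 10 * L].
Proof.
move=> L1; have L40 : 0 <= 4 * L by lra.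
have t4 : (3 < Num.truncn (4 * L))%N by rewrite truncn_ge_nat //; lra.
have tr : (Num.truncn (4 * L))%:R <= 4 * L by rewrite truncn_le.
have tS := truncnS_gt (4 * L).
move: (Num.truncn (4 * L)) t4 tr tS => t t4 tr tS.
have t1 : (1 < t.+1)%N by rewrite ltnS (leq_trans _ t4).
exists (up_log 2 t.+1); split; first by rewrite up_log_gt0.
  by apply/ltW/(lt_le_trans tS); rewrite ler_nat; exact: up_logP.
have h := up_log_gtn (isT : (1 < 2)%N) t1.
have e : (2 ^ up_log 2 t.+1 = 2 * 2 ^ (up_log 2 t.+1).-1)%N.
  by rewrite -expnS prednK // up_log_gt0.
have : (2 ^ up_log 2 t.+1 <= 2 * t)%N by rewrite e leq_mul2l /= -ltnS.
rewrite -(ler_nat R) natrM; lra.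
Qed.

Lemma net_size (R0 : R) g : 1 <= R0 -> 0 < g -> g <= 1 ->
  exists M : nat, 2 * R0 / (g / 8) < M%:R /\ M%:R <= 17 * R0 / g.
Proof.
move=> R01 g0 g1; exists (Num.truncn (2 * R0 / (g / 8))).+1.
split; first by rewrite truncnS_gt.
have q0 : 0 <= 2 * R0 / (g / 8) by rewrite !divr_ge0 ?mulr_ge0 ?(ltW g0) //; lra.
have : (Num.truncn (2 * R0 / (g / 8)))%:R <= 2 * R0 / (g / 8) by rewrite truncn_le.
rewrite -natr1.
have -> : 2 * R0 / (g / 8) = 16 * (R0 / g) by field; rewrite gt_eqF.
have -> : 17 * R0 / g = 17 * (R0 / g) by field; rewrite gt_eqF.
have : 1 <= R0 / g by rewrite ler_pdivlMr // mul1r; lra.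
lra.
Qed.

(** Resolvent entries decay at rate 2 and the target is rate 1; the spare factor
    [e^(-r) <= e^(-ell)] absorbs the volume factor [6 N ^ 3]. *)
Lemma far_decay L N g r ell (kk : nat) : 1 <= N -> g <= 1 -> 4 * L <= (2 ^ kk)%:R ->
  r <= L -> ell <= r -> 6 * N ^+ 3 <= expR ell ->
  2 * N ^+ 2 * (2 * (g / 4) * expR (- 2 * r) + 2 * N / 2 ^+ (2 ^ kk)) <= expR (- r).
Proof.
move=> N1 g1 hk rL hr hN; have N0 : 0 <= N by lra.
(* Since [e^(1/2) <= 2], one has [2^(-4 L) <= e^(-2 L)], and [r <= L]. *)
have p1 : (2 ^+ (2 ^ kk))^-1 <= expR (- 2 * r).
  have e2 : expR (2^-1) <= 2 :> R.
    have hh : 2^-1 <= expR (- 2^-1) :> R by have := expR_ge1Dx (- 2^-1 : R); lra.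
    move: hh; rewrite expRN lef_pV2 ?posrE ?expR_gt0 //.
  rewrite mulNr expRN lef_pV2 ?posrE ?exprn_gt0 ?expR_gt0 //.
  apply: (@le_trans _ _ (expR (2^-1) ^+ (2 ^ kk))); last by rewrite lerXn2r ?nnegrE ?expR_ge0.
  by rewrite -expRM_natr ler_expR; lra.
set e := expR (- 2 * r) in p1 *; have e_ge0 : 0 <= e by exact: expR_ge0.
apply: (@le_trans _ _ (6 * N ^+ 3 * e)).
  have -> : 6 * N ^+ 3 * e = 2 * N ^+ 2 * (N * e + 2 * N * e) by ring.
  rewrite ler_wpM2l ?mulr_ge0 ?exprn_ge0 //; apply: lerD.
    by rewrite ler_wpM2r //; lra.
  by rewrite ler_wpM2l // mulr_ge0.
apply: (@le_trans _ _ (expR ell * e)); first by rewrite ler_wpM2r.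
by rewrite /e -expRD ler_expR; lra.
Qed.

(** [M] is of order [1 / g] and the squared Hoelder bound of order [g^(2 alpha)], so
    [g^(2 alpha - 1)] remains, up to [N ^ 4]. *)
Lemma double_resonance_small (alpha K R0 M N g X b : R) :
  1 / 2 < alpha -> alpha <= 1 -> 0 < K -> 0 < R0 -> 1 <= N -> 0 <= M ->
  g = expR (- b) -> M <= 17 * R0 / g -> 0 < X ->
  2 * (17 * R0 * (K * K * (32 * 32))) * N ^+ 4 * X^-1 <= expR ((2 * alpha - 1) * b) ->
  M * (N * (K * (2 * (8 * (2 * g) * N)) `^ alpha *
     (N * (K * (2 * (8 * (2 * g) * N)) `^ alpha)))) <= X / 2.
Proof.
move=> al1 al2 K0 R0p N1 M0 gE hM X0 hX.
have g0 : 0 < g by rewrite gE expR_gt0.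
have N0 : 0 < N by lra.
set c := (2 * (8 * (2 * g) * N)) `^ alpha.
have N32 : 0 < 32 * N by rewrite mulr_gt0 ?ltr0n.
have hc : c * c <= 32 * 32 * N ^+ 2 * g `^ (2 * alpha).
  have -> : c = (32 * N) `^ alpha * g `^ alpha.
    by rewrite /c -powRM ?(ltW g0) ?(ltW N32) //; congr (_ `^ _); ring.
  rewrite mulrACA -!powRD; try by apply/implyP => _; rewrite gt_eqF.
  have -> : alpha + alpha = 2 * alpha by ring.
  rewrite ler_wpM2r ?powR_ge0 //.
  have -> : 32 * 32 * N ^+ 2 = (32 * N) `^ 2%:R.
    by rewrite powR_mulrn ?(ltW N32) //; ring.
  by apply: ler_powR; lra.
have gg : g^-1 * g `^ (2 * alpha) = expR (- ((2 * alpha - 1) * b)).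
  rewrite -[g^-1]powR_inv1 ?(ltW g0) // -powRD; last by apply/implyP => _; rewrite gt_eqF.
  rewrite gE -[in LHS](@expRK _ (- b)) /powR gt_eqF ?expR_gt0 // !expRK; congr expR; ring.
apply: (@le_trans _ _ (17 * R0 / g * (N * N * (K * K) * (32 * 32 * N ^+ 2 * g `^ (2 * alpha))))).
  have -> : N * (K * c * (N * (K * c))) = N * N * (K * K) * (c * c) by ring.
  have c0 : 0 <= c by exact: powR_ge0.
  apply: ler_pM => //; first by rewrite !mulr_ge0 // ltW.
  by rewrite ler_wpM2l // !mulr_ge0 // ltW.
have -> : 17 * R0 / g * (N * N * (K * K) * (32 * 32 * N ^+ 2 * g `^ (2 * alpha))) =
  17 * R0 * (K * K * (32 * 32)) * N ^+ 4 * (g^-1 * g `^ (2 * alpha)) by ring.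
rewrite gg expRN ler_pdivrMr ?expR_gt0 //.
move: hX; rewrite -(ler_pM2l X0).
have -> : X * (2 * (17 * R0 * (K * K * (32 * 32))) * N ^+ 4 * X^-1) =
  2 * (17 * R0 * (K * K * (32 * 32)) * N ^+ 4) by field; rewrite gt_eqF.
move=> h; set e := expR _ in h *.
have -> : X / 2 * e = X * e / 2 by ring.
by rewrite ler_pdivlMr // mulrC.
Qed.

(** The energies of the net cost [e^b] and the rest of the union bound is polynomial. In the
    application [t] is [L^tau] and [l] its integer part; [expR 1] pays for the rounding. *)
Lemma decay_small (C R0 M Q N g X b t l L : R) :
  0 <= C -> 0 < R0 -> 0 <= N -> 0 <= M -> 0 <= Q -> 0 <= L -> g = expR (- b) -> M <= 17 * R0 / g ->
  Q <= 10 * L -> t - 1 <= l -> 0 < X ->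
  2 * (17 * R0 * 10 * C * expR 1) * (L * (N * N)) * (X^-1 * expR b) <= expR t ->
  M * Q * (N * N) * (C * expR (- l)) <= X / 2.
Proof.
move=> C0 R0p N0 M0 Q0 L0 gE hM hQ hl X0 hX.
have g0 : 0 < g by rewrite gE expR_gt0.
have gV : g^-1 = expR b by rewrite gE expRN invrK.
have eE : expR (- l) <= expR 1 * (expR t)^-1 by rewrite -expRN -expRD ler_expR; lra.
apply: (@le_trans _ _ (17 * R0 / g * (10 * L) * (N * N) * (C * (expR 1 * (expR t)^-1)))).
  apply: ler_pM; rewrite ?mulr_ge0 ?expR_ge0 //; last by rewrite ler_wpM2l.
  by rewrite ler_wpM2r ?mulr_ge0 // ler_pM.
rewrite gV; move: hX; rewrite -(ler_pM2l X0).
have -> : X * (2 * (17 * R0 * 10 * C * expR 1) * (L * (N * N)) * (X^-1 * expR b)) =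
  2 * (17 * R0 * 10 * C * expR 1 * (L * (N * N)) * expR b) by field; rewrite gt_eqF.
move=> h; rewrite ler_pdivlMr //.
have -> : 17 * R0 * expR b * (10 * L) * (N * N) * (C * (expR 1 / expR t)) * 2 =
  2 * (17 * R0 * 10 * C * expR 1 * (L * (N * N)) * expR b) / expR t by ring.
by rewrite ler_pdivrMr ?expR_gt0.
Qed.
End Scales.

(** * The localization probability in a finite volume *)

Section FiniteVolume.
Context (R : realType) (dT : measure_display) (T : measurableType dT).
Variables (P : probability T R) (mu : probability R R) (n : nat) (alpha K : R).
Hypotheses (alpha_gt : 1 / 2 < alpha) (K0 : 0 < K).
Hypothesis mu_holder : forall a t : R, 0 <= t -> t <= 1 ->
  (mu [set r : R | (a <= r <= a + t)%R] <= (K * t `^ alpha)%:E)%E.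
Variables (v : 'I_n -> T -> R).
Hypothesis mv : forall i, measurable_fun setT (v i).
Hypothesis v_law : forall i (B : set R), measurable B -> P (v i @^-1` B) = mu B.
Hypothesis v_ind : forall B : 'I_n -> set R, (forall i, measurable (B i)) ->
  P [set w | forall i, B i (v i w)] = (\prod_i P (v i @^-1` B i))%E.
Variables (A : rel 'I_n) (eps : R).
Hypotheses (A_sym : symmetric A) (A_irr : irreflexive A) (eps0 : 0 < eps) (n0 : (0 < n)%N).
Variables (rho : 'I_n -> 'I_n -> R) (D : nat).
Hypotheses (rho_diag : forall x, rho x x = 0)
  (rho_step : forall x u y, A x u -> rho x y <= rho u y + 1)
  (A_deg : forall x, (#|A x| <= D)%N)
  (small : D%:R * Num.sqrt eps * half_moment alpha K * expR 2 <= 1).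
Variables (M0 R0 g : R) (M kk : nat) (far : rel 'I_n) (ell : R) (bd : 'I_n -> 'I_n -> R).
Hypotheses (mu_bd : mu [set r | M0 < `|r|] = 0%E) (R0_ge : M0 + eps * D%:R <= R0)
  (g0 : 0 < g) (kk0 : (0 < kk)%N) (M_ge : 2 * R0 / (g / 8) < M%:R)
  (g_small : 16 * (2 * g) * n%:R <= 1)
  (far_ell : forall x y, far x y -> ell <= rho x y)
  (bd_ge : forall x y, far x y -> 2 * n%:R ^+ 2 *
     (2 * (g / 4) * expR (- 2 * rho x y) + 2 * n%:R / 2 ^+ (2 ^ kk)) <= bd x y).
Local Notation sT := (finset.setTfor 'I_n).
Local Notation C := (half_moment alpha K).

(** Three bad events: a double resonance at a point of the net, a large resolvent entry between far
    sites at one of the cutoff energies, and a potential value beyond [M0]. The last has probability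
    0, but is removed so that the net covers the spectrum. *)
Lemma localizing_mx_prob :
  measurable [set w | localizing_mx g far bd (ham A eps sT (v ^~ w))] /\
  ((1 - (M%:R * (n%:R * (K * (2 * (8 * (2 * g) * n%:R)) `^ alpha *
          (n%:R * (K * (2 * (8 * (2 * g) * n%:R)) `^ alpha)))) +
        (M * 2 ^ kk * (n * n))%:R * (C * expR (- ell))))%:E <=
   P [set w | localizing_mx g far bd (ham A eps sT (v ^~ w))])%E.
Proof.
set G := [set w | localizing_mx _ _ _ _].
have mG : measurable G.
  by apply: measurable_localizing_mx => x y; exact: cmeasurable_ham.
split => //; set p1 := _ * (n%:R * _); set p2 := _%:R * (C * _).
pose En (k : 'I_M) := - R0 + k%:R * (g / 8).
have d0 : 0 < 2 * g by rewrite mulr_gt0.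
pose B1 (k : 'I_M) := [set w | exists x,
  (8 * (2 * g) * n%:R)^-1 <= Normc.normc (green A eps sT (v ^~ w) (En k +i* (2 * g)) x x) /\
  resonant v A eps (En k) (2 * g) (sT :\ x) w].
have [mB1 hB1] : measurable [set w | exists k, B1 k w] /\
    (P [set w | exists k, B1 k w] <= p1%:E)%E.
  rewrite /p1 -[in X in (X%:R * _)%:E](card_ord M); apply: measure_exists_le => k.
    exact: (double_resonance_prob K0 mu_holder mv v_law v_ind eps A_sym A_irr (En k) d0 n0 g_small).1.
  exact: (double_resonance_prob K0 mu_holder mv v_law v_ind eps A_sym A_irr (En k) d0 n0 g_small).2.
have C0 : 0 <= C by rewrite (le_trans ler01) // half_moment_ge1.
have sz : size (iter_sqrt kk (-1 : R[i])) = (2 ^ kk)%N by exact: size_iter_sqrt.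
pose cc (j : 'I_(2 ^ kk)) : R[i] := nth 0 (iter_sqrt kk (-1)) j.
have ccP j : cc j \in iter_sqrt kk (-1) by rewrite mem_nth // sz.
pose zz k j : R[i] := (En k)%:C + (g / 4)%:C / cc j.
have Imz k j : complex.Im (zz k j) != 0.
  have cN0 : cc j != 0 by rewrite -normr_eq0 (iter_sqrtN1_norm (ccP j)) oner_eq0.
  apply: contra (iter_sqrtN1_nreal kk0 (ccP j)) => hz.
  have zr : zz k j \is Num.real by move: hz; case: (zz k j) => a b /= hb; rewrite complex_real.
  have gN0 : (g / 4)%:C != 0 :> R[i] by rewrite gt_eqF // ltcR divr_gt0.
  have -> : cc j = (g / 4)%:C / (zz k j - (En k)%:C).
    have -> : zz k j - (En k)%:C = (g / 4)%:C / cc j by rewrite /zz addrAC subrr add0r.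
    by rewrite invf_div mulrCA divff // mulr1.
  by rewrite rpred_div ?rpredB ?complex_real.
pose B2 (i : 'I_M * 'I_(2 ^ kk) * ('I_n * 'I_n)) := [set w | far i.2.1 i.2.2 /\
  expR (- 2 * rho i.2.1 i.2.2) < Normc.normc (green A eps sT (v ^~ w) (zz i.1.1 i.1.2) i.2.1 i.2.2)].
have [mB2 hB2] : measurable [set w | exists i, B2 i w] /\
    (P [set w | exists i, B2 i w] <= p2%:E)%E.
  have -> : p2 = #|{: 'I_M * 'I_(2 ^ kk) * ('I_n * 'I_n)}|%:R * (C * expR (- ell)).
    by rewrite /p2 !card_prod !card_ord.
  have hg i := green_large_prob alpha_gt K0 mu_holder mv v_law v_ind A_sym A_irr eps0
      (Imz i.1.1 i.1.2) rho_diag rho_step A_deg small i.2.1 i.2.2.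
  apply: measure_exists_le => i; rewrite /B2; case fi : (far i.2.1 i.2.2).
  - rewrite (_ : [set w | _] = [set w | expR (- 2 * rho i.2.1 i.2.2) <
       Normc.normc (green A eps sT (v ^~ w) (zz i.1.1 i.1.2) i.2.1 i.2.2)]); first exact: (hg i).1.
    by apply/seteqP; split => w /=; [case|split].
  - by rewrite (_ : [set w | _] = set0) //; apply/seteqP; split => w //= [].
  - set F := (fun w : T => true /\ _).
    have -> : F = [set w | expR (- 2 * rho i.2.1 i.2.2) <
       Normc.normc (green A eps sT (v ^~ w) (zz i.1.1 i.1.2) i.2.1 i.2.2)].
      by apply/seteqP; split => w /=; [case|split].
    apply: le_trans (hg i).2 _; rewrite lee_fin ler_wpM2l // ler_expR lerN2.
    exact: far_ell.
  - set F := (fun w : T => false /\ _).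
    have -> : F = set0 by apply/seteqP; split => w //= [].
    by rewrite measure0 lee_fin mulr_ge0 ?expR_ge0.
pose B3 (i : 'I_n) := v i @^-1` [set r | M0 < `|r|].
have mM : measurable [set r : R | M0 < `|r|].
  rewrite (_ : [set r | _] = ~` ([set: R] `&` [set r | `|r| <= M0])).
    by apply: measurableC; apply: (measurable_fun_le measurableT).
  by apply/seteqP; split=> r; rewrite setTI /= ltNge => /negP.
have [mB3 hB3] : measurable [set w | exists i, B3 i w] /\
    (P [set w | exists i, B3 i w] <= (#|'I_n|%:R * 0)%:E)%E.
  apply: measure_exists_le => i.
    by rewrite -[X in measurable X]setTI; exact: mv.
  have e : (P (v i @^-1` [set r | (M0 < `|r|)%R]) <= 0%:E)%E by rewrite (v_law i mM) mu_bd.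
  exact: e.
pose bad := [set w | exists k, B1 k w] `|` [set w | exists i, B2 i w] `|` [set w | exists i, B3 i w].
have mbad : measurable bad by do 2?apply: measurableU.
have Pbad : (P bad <= (p1 + p2)%:E)%E.
  apply: le_trans (measureU2 _ _ _) _ => //; first exact: measurableU.
  rewrite mulr0 in hB3; rewrite -[(p1 + p2)%:E]adde0; apply: leeD => //.
  by apply: le_trans (measureU2 _ _ _) _ => //; rewrite EFinD; apply: leeD.
have sub : ~` bad `<=` G.
  move=> w hw; apply: (@localizing_of_green R n A eps (v ^~ w) A_sym n0 g R0 M kk far
    (fun x y => expR (- 2 * rho x y)) bd (ltW eps0)) => //.
  - move=> x; apply: le_trans R0_ge; apply: lerD.
      by rewrite leNgt; apply/negP => hx; apply: hw; right; exists x.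
    by rewrite ler_pM2l // ler_nat.
  - move=> k [x [h1 [y h2]]]; apply: hw; left; left; exists k, x; split => //.
    by exists y.
  - move=> k c x y hc fxy; rewrite leNgt; apply/negP => hlt; apply: hw; left; right.
    have hj : (index c (iter_sqrt kk (-1)) < 2 ^ kk)%N by rewrite -sz index_mem.
    by exists ((k, Ordinal hj), (x, y)); split => //=; rewrite /zz /cc /= nth_index.
apply: (@le_trans _ _ (P (~` bad))); last by apply: le_measure; rewrite ?inE //; exact: measurableC.
rewrite probability_setC // EFinB; apply: leeB => //.
Qed.
End FiniteVolume.

(** * The disorder threshold and the limit of large boxes *)

Theorem theorem1p7 (R : realType) (d : nat) (mu : probability R R)
  (alpha K theta q p gamma1 : R) :
  (0 < d)%N ->
  (* mu: bounded support, non-degenerate, Hoelder continuous of order alpha *)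
  (exists M : R, mu [set r | M < `|r|] = 0%E) ->
  (forall a : R, mu [set a] != 1%E) ->
  1 / 2 < alpha -> alpha <= 1 -> 0 < K ->
  (forall a t : R, 0 <= t -> t <= 1 -> (mu [set r : R | (a <= r <= a + t)%R] <= (K * t `^ alpha)%:E)%E) ->
  (* the fixed parameters theta, q, p, gamma1 *)
  (6 / (2 * alpha - 1) + 9 / 2) * d%:R < theta ->
  3 * d%:R / (2 * alpha - 1) < q -> q < (theta - 9 / 2 * d%:R) / 2 ->
  0 < p -> p < (2 * alpha - 1) * q - 3 * d%:R ->
  1 < gamma1 -> gamma1 < Num.min (1 + p / (p + 2 * d%:R))
                                 ((2 * theta - 4 * d%:R) / (5 * d%:R + 4 * q)) ->
  exists eps0 : R, 0 < eps0 /\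
  forall xi zeta beta gamma tau : R,
    0 < xi -> xi < 1 -> xi < zeta -> zeta < beta -> beta < gamma^-1 -> gamma^-1 < 1 ->
    1 < gamma -> gamma < Num.sqrt (zeta / xi) ->
    Num.max ((1 + gamma1) / (2 * gamma1))
      (Num.max ((1 + gamma * beta) / 2) (((gamma - 1) * beta + 1) / gamma)) < tau ->
    tau < 1 ->
    exists (Ltilde m : R), 0 < m /\
    forall eps : R, 0 < eps -> eps <= eps0 ->
    forall (dT : measure_display) (T : measurableType dT) (P : probability T R)
           (omega : site d -> T -> R),
      iid_with_law P omega mu ->
      forall (L : R) (x : 'rV[R]_d), Ltilde <= L ->
        let E := [set w : T | m_localizing L beta tau m eps (fun y => omega y w) x] in
        measurable E /\ ((1 - expR (- L `^ xi))%:E <= P E)%E.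
Proof.
move=> d0 [M0' hM0'] _ al1 al2 K0 holder _ _ _ _ _ _ _.
pose C := half_moment alpha K.
have C1 : 1 <= C by exact: half_moment_ge1.
pose D := (3 ^ d)%N; have D0 : 1 <= D%:R :> R by rewrite ler1n expn_gt0.
pose W := D%:R * C * expR 2.
have W1 : 1 <= W.
  have e2 : 1 <= expR 2 :> R by have := expR_ge1Dx (2 : R); lra.
  have DC : 1 <= D%:R * C by apply: (le_trans C1); rewrite ler_peMl //; lra.
  by apply: (le_trans DC); rewrite ler_peMr //; lra.
have W0 : 0 < W by lra.
pose M0 := Num.max M0' 0.
have mM (a : R) : measurable [set r : R | a < `|r|].
  rewrite (_ : [set r | _] = ~` ([set: R] `&` [set r | `|r| <= a])).
    by apply: measurableC; apply: (measurable_fun_le measurableT).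
  by apply/seteqP; split=> r; rewrite setTI /= ltNge => /negP.
have hM0 : mu [set r | M0 < `|r|] = 0%E.
  apply/eqP; rewrite eq_le measure_ge0 andbT -hM0'; apply: le_measure; rewrite ?inE //.
  by move=> r /=; rewrite /M0 gt_max => /andP[].
have M00 : 0 <= M0 by rewrite /M0 le_max lexx orbT.
(* Chosen so that [sqrt eps * W <= 1], the smallness required by the induction on moments. [W]
   depends on [d], [alpha] and [K] only, so the threshold is fixed before [xi]. *)
exists (W ^- 2); split; first by rewrite invr_gt0 exprn_gt0 //; lra.
move=> xi zeta beta gamma tau xi0 xi1 xz zb bg g1 gam1 _ htau tau1.
have xb : xi < beta by lra.
have b1 : beta < 1 by lra.
(* The second term of the maximum gives [2 * tau > 1 + gamma * beta], and both [1] and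
   [gamma * beta] exceed [beta]. *)
have bt : beta < tau.
  move: htau; rewrite !gt_max => /andP[_ /andP[h _]].
  have : beta < gamma * beta by rewrite ltr_pMl //; lra.
  by move: h; rewrite ltr_pdivrMr //; lra.
(* The hopping contributes at most [eps * D <= D] to the spectral radius; adding [D] also makes
   [R0 >= 1]. *)
pose R0 := M0 + D%:R; have R00 : 1 <= R0 by rewrite /R0; lra.
have R0p : 0 < R0 by lra.
have Cp : 0 < C by lra.
pose a2 := 2 * alpha - 1; have a20 : 0 < a2 by rewrite /a2; lra.
have c1_0 : 0 < 2 * (17 * R0 * (K * K * (32 * 32))) by rewrite !mulr_gt0 ?ltr0n.
have c2_0 : 0 < 2 * (17 * R0 * 10 * C * expR 1) by rewrite !mulr_gt0 ?expR_gt0 ?ltr0n.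
have c4_0 : 0 < 6 * expR 1 :> R by rewrite mulr_gt0 ?expR_gt0 ?ltr0n.
(* In this order: the bound [16 * (2 * g) * n <= 1], the double resonances, the large resolvent
   entries with [beta < tau], and the volume factor in [far_decay]. [xi] fills the exponents that
   have no counterpart. *)
have [L1 h1] := @poly_exp_le R 32 xi xi beta 1 d ltac:(lra) (ltW xi0) xb (ltW xi0) xb ltr01.
have [L2 h2] := @poly_exp_le R _ xi xi beta a2 (4 * d) c1_0 (ltW xi0) xb (ltW xi0) xb a20.
have [L3 h3] := @poly_exp_le R _ xi beta tau 1 (2 * d + 1) c2_0 (ltW xi0) ltac:(lra) ltac:(lra) bt ltr01.
have [L4 h4] := @poly_exp_le R _ xi xi tau 1 (3 * d) c4_0 (ltW xi0) ltac:(lra) (ltW xi0) ltac:(lra) ltr01.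
exists (Num.max (Num.max L1 L2) (Num.max (Num.max L3 L4) 1)), 1; split => //.
move=> eps e0 he dT T P omega [om [olaw oind]] L x0.
rewrite !ge_max => /andP[/andP[l1 l2] /andP[/andP[l3 l4] L_1]] E.
have [s [us hs s0 sN]] := box_enum x0 L_1.
pose n := size s; pose v (i : 'I_n) := omega (site_of i).
pose g := expR (- L `^ beta).
have -> : E = [set w | localizing_mx g (site_far L tau (s := s)) (site_bound 1 (s := s))
     (ham (@site_adj d s) eps (finset.setTfor 'I_n) (v ^~ w))].
  apply/seteqP; split => w /=.
    by move/(m_localizing_mx beta tau 1 eps us hs s0).
  by move=> h; apply/(m_localizing_mx beta tau 1 eps us hs s0).
have v_ind (B : 'I_n -> set R) : (forall i, measurable (B i)) ->
    P [set w | forall i, B i (v i w)] = (\prod_i P (v i @^-1` B i))%E.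
  (* Independence is stated for families indexed by the lattice, so [B] is extended to all sites
     through [site_idx]. *)
  move=> mB; pose B' y := B (site_idx s0 y).
  have hB' (i : 'I_n) : B' (site_of i) = B i by rewrite /B' (site_idxK us).
  have := oind s B' us (fun y => mB _); rewrite big_tnth.
  under [in X in _ = X -> _]eq_bigr do rewrite -/(site_of _) hB'.
  move=> <-; congr (P _); apply/seteqP; split => w /= h.
    by move=> y ys; have /tnthP[i ->] := (ys : y \in in_tuple s); rewrite -/(site_of i) hB'; exact: h.
  by move=> i; have := h (site_of i) (mem_tnth _ _); rewrite /= hB'.
have [kk [kk0 kk1 kk2]] := dyadic_scale L_1.
have g0 : 0 < g by exact: expR_gt0.
have g_le1 : g <= 1 by rewrite /g expR_le1 oppr_le0 powR_ge0.
have n1 : 1 <= n%:R :> R by rewrite ler1n.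
have [M [M_gt M_le]] := net_size R00 g0 g_le1.
have L0 : 0 <= L := le_trans ler01 L_1.
have L20 : 0 <= 2 * L by rewrite mulr_ge0.
have xiE : 1 <= expR (L `^ xi + L `^ xi) by apply: le_trans (expR_ge1Dx _); rewrite lerDl addr_ge0 ?powR_ge0.
have g_small : 16 * (2 * g) * n%:R <= 1.
  have : 32 * (2 * L) ^+ d <= expR (1 * L `^ beta).
    by apply: le_trans (h1 L l1 L_1); rewrite ler_peMr // mulr_ge0 // exprn_ge0.
  rewrite mul1r => hh; have gE : g * expR (L `^ beta) = 1 by rewrite /g -expRD addNr expR0.
  have : g * (32 * n%:R) <= g * expR (L `^ beta).
    by rewrite ler_pM2l //; apply: le_trans hh; rewrite ler_pM2l.
  by rewrite gE; lra.
pose ell := Ltau L tau.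
have ell_gt : L `^ tau - 1 <= ell.
  by rewrite /ell /Ltau; have := lt_succ_floor (L `^ tau); rewrite intrD; lra.
have small : D%:R * Num.sqrt eps * half_moment alpha K * expR 2 <= 1.
  have hsq : Num.sqrt eps <= W^-1.
    rewrite -[leRHS]ger0_norm ?invr_ge0; last lra.
    by rewrite -sqrtr_sqr ler_wsqrtr // exprVn.
  have -> : D%:R * Num.sqrt eps * half_moment alpha K * expR 2 = Num.sqrt eps * W.
    by rewrite /W /C; ring.
  by rewrite -ler_pdivlMr ?div1r //; lra.
have R0_ge : M0 + eps * D%:R <= R0.
  rewrite /R0 lerD2l ler_piMl //; apply: le_trans he _.
  by rewrite invf_le1 ?exprn_gt0 ?exprn_ege1.
have dsym (i j : 'I_n) : @site_dist R d s i j = site_dist R j i.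
  by rewrite /site_dist -opprB supnN.
have n3 : 6 * n%:R ^+ 3 <= expR ell.
  have q1 : 6 * expR 1 * (2 * L) ^+ (3 * d) <= expR (1 * L `^ tau).
    by apply: le_trans (h4 L l4 L_1); rewrite ler_peMr // mulr_ge0 ?exprn_ge0 // ltW.
  apply: (@le_trans _ _ (expR (-1) * expR (L `^ tau))); last by rewrite -expRD ler_expR; lra.
  rewrite mul1r in q1; rewrite -(@ler_pM2l _ (expR 1)) ?expR_gt0 //.
  rewrite [leRHS]mulrA -expRD subrr expR0 mul1r; apply: le_trans q1.
  rewrite mulrCA mulrA ler_pM2l // mulnC exprM lerXn2r ?nnegrE // exprn_ge0 //.
have bd_ge (i j : 'I_n) : site_far L tau i j -> 2 * n%:R ^+ 2 *
     (2 * (g / 4) * expR (- 2 * @site_dist R d s i j) + 2 * n%:R / 2 ^+ (2 ^ kk)) <= site_bound 1 i j.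
  rewrite /site_far /site_bound dsym mulN1r; set r := site_dist _ _ _ => hr.
  have rL : r <= L by apply: (site_dist_le hs); lra.
  by apply: far_decay kk1 rL hr n3.
have far_ge (i j : 'I_n) : site_far L tau i j -> ell <= @site_dist R d s i j.
  by rewrite dsym.
have [mE hE] := @localizing_mx_prob R dT T P mu n alpha K al1 K0 holder v
  (fun i => om _) (fun i => olaw _) v_ind (@site_adj d s) eps
  (fun i j => adj_sym _ _) (fun i => adj_irr _) e0 s0 (@site_dist R d s) D
  (fun i => etrans (congr1 (@supn R d) (subrr _)) (supn0 R d))
  (fun i u y h => site_dist_step R y h)
  (fun i => adj_card (site_of i) (site_of_inj us)) small M0 R0 g M kk
  (site_far L tau (s := s)) ell (site_bound 1 (s := s)) hM0 R0_ge g0 kk0 M_gt g_small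
  far_ge bd_ge.
split => //; apply: le_trans hE; rewrite lee_fin lerD2l lerN2.
set X := expR (- L `^ xi); have X0 : 0 < X by exact: expR_gt0.
have XV : X^-1 = expR (L `^ xi) by rewrite /X expRN invrK.
have nL (k : nat) : n%:R ^+ k <= (2 * L) ^+ (k * d).
  by rewrite mulnC exprM lerXn2r ?nnegrE ?ler0n ?exprn_ge0.
(* Half of the allowed failure probability [e^(-L^xi)] goes to the double resonances and half to the
   large resolvent entries. *)
rewrite [X in _ <= X](splitr X); apply: lerD.
  apply: (double_resonance_small al1 al2 K0 R0p n1 (ler0n _ _) erefl M_le X0).
  apply: le_trans (h2 L l2 L_1); rewrite XV; apply: ler_pM; rewrite ?expR_ge0 //.
  - by rewrite mulr_ge0 ?exprn_ge0 ?ler0n ?(ltW c1_0).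
  - by rewrite ler_pM2l ?nL.
  - by rewrite ler_expR lerDl powR_ge0.
rewrite !natrM; apply: (decay_small (ltW Cp) R0p (ler0n _ _) (ler0n _ _) (ler0n _ _) L0 erefl M_le kk2 ell_gt X0).
rewrite XV -expRD -[expR (L `^ tau)](_ : expR (1 * L `^ tau) = _) ?mul1r //.
have := h3 L l3 L_1; rewrite mul1r; apply: le_trans; rewrite ler_wpM2r ?expR_ge0 //.
rewrite ler_pM2l // exprD expr1 mulrC; apply: ler_pM; rewrite ?mulr_ge0 ?ler0n //.
  by rewrite -expr2 nL.
by rewrite ler_peMl // ler1n.
Qed.
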